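(* Let $R$ be a commutative Noetherian local ring and let $M$ and $N$ be finitely generated $R$-modules such that $\operatorname{Tor}_i^R(M,N)=0$ for $i\gg 0$. Suppose that $M$ has reducible complexity and set $q=\sup\{i\mid \operatorname{Tor}_i^R(M,N)\neq 0\}$. Then the following statements hold. (i) If $\operatorname{G-dim}_R(M)<\infty$ and $q=0$, then $$\operatorname{depth}_R(M)+\operatorname{depth}_R(N)=\operatorname{depth}_R(M\otimes_R N)+\operatorname{depth} R.$$ (ii) If $q>0$ and $\operatorname{depth}_R(\operatorname{Tor}_q^R(M,N))\leq 1$, then $$\operatorname{depth}_R(M)+\operatorname{depth}_R(N)=\operatorname{depth} R+\operatorname{depth}_R(\operatorname{Tor}_q^R(M,N))-q.$$
   Context: All modules are finitely generated over the commutative Noetherian local ring $R$. Syzygies and complexity: let $\cdots\to F_{n+1}\to F_n\to\cdots\to F_0\to M\to 0$ be the minimal free resolution of $M$. The $n$-th syzygy $\Omega^n_R(M)$ is the cokernel of $F_{n+1}\to F_n$, and the $n$-th Betti number $\beta_n^R(M)$ is the rank of $F_n$. The complexity of $M$ is $\operatorname{cx}_R(M)=\inf\{i\in\mathbb{N}\cup\{0\}\mid \exists\,\gamma\in\mathbb{R}\text{ such that }\beta_n^R(M)\leq \gamma n^{i-1}\text{ for }n\gg 0\}$. The module $K_\eta$: let $\eta\in\operatorname{Ext}^*_R(M,N)=\bigoplus_{i\ge 0}\operatorname{Ext}^i_R(M,N)$ be homogeneous of positive degree $|\eta|$, represented by a map $f_\eta:\Omega^{|\eta|}_R(M)\to N$.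 Then $K_\eta$ denotes the pushout of $f_\eta$ and the inclusion $\Omega^{|\eta|}_R(M)\hookrightarrow F_{|\eta|-1}$; up to isomorphism it does not depend on the choice of $f_\eta$, and there is an exact sequence $0\to N\to K_\eta\to\Omega^{|\eta|-1}_R(M)\to 0$. Reducible complexity (inductive definition): (a) every $R$-module of finite projective dimension has reducible complexity; (b) an $R$-module $M$ of finite positive complexity has reducible complexity if there is a homogeneous element $\eta\in\operatorname{Ext}^*_R(M,M)$ of positive degree such that $\operatorname{cx}_R(K_\eta)<\operatorname{cx}_R(M)$, $\operatorname{depth}_R(M)=\operatorname{depth}_R(K_\eta)$, and $K_\eta$ has reducible complexity. Gorenstein dimension: with $(-)^*=\operatorname{Hom}_R(-,R)$, an $R$-module $G$ has $G$-dimension zero if the biduality map $G\to G^{**}$ is an isomorphism, $\operatorname{Ext}^i_R(G,R)=0$ for all $i>0$, and $\operatorname{Ext}^i_R(G^*,R)=0$ for all $i>0$. $\operatorname{G-dim}_R(M)$ is the infimum of all nonnegative integers $n$ for which there is an exact sequence $0\to G_n\to\cdots\to G_0\to M\to 0$ in which all $G_i$ have $G$-dimension zero. *)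

(* Defs.v *)
From HB Require Import structures.
From mathcomp Require Import all_boot all_order all_algebra.
From mathcomp Require Import generic_quotient ring_quotient freeg.
From mathcomp Require Import boolp classical_sets functions.
From mathcomp Require Import constructive_ereal reals ereal Rstruct.

Set Implicit Arguments.
Unset Strict Implicit.
Unset Printing Implicit Defensive.

Import Order.TTheory GRing.Theory Num.Theory.

Local Open Scope classical_set_scope.
Local Open Scope ring_scope.
Local Open Scope quotient_scope.

(* Numerical invariants (depth, complexity, ...) take values in the extended
   real line over the concrete real numbers. *)
Notation RR := (Rdefinitions.R : realType).

Section Submodules.
Variables (R : comNzRingType) (V : lmodType R).
Implicit Types S U : set V.

Definition submodule U : Prop :=
  U 0 /\ forall (a : R) u v, U u -> U v -> U (a *: u + v).

Definition span_set S : set V := smallest submodule S.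

Lemma submodule_span S : submodule (span_set S).
Proof.
split=> [U [[U0 _] _] //|a u v Su Sv U [Usub SU]].
by apply: Usub.2; [apply: Su|apply: Sv].
Qed.

Lemma span_set_id S : submodule S -> span_set S = S.
Proof. exact: smallest_id. Qed.

Definition span_pred S : {pred V} := fun x => `[< span_set S x >].

Lemma span_predE S x : (x \in span_pred S) = `[< span_set S x >].
Proof. by []. Qed.

Lemma span_pred_closed S : submod_closed (span_pred S).
Proof.
have [S0 SD] := submodule_span S.
split; first exact: asboolT.
move=> a u v; rewrite !span_predE => /asboolP Su /asboolP Sv.
by apply/asboolP; apply: SD.
Qed.

HB.instance Definition _ S :=
  GRing.isSubmodClosed.Build R V (span_pred S) (span_pred_closed S).

(* The submodule generated by S, as a module; it is S itself when S is
   already a submodule. *)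
Definition submod S : Type := {x : V | x \in span_pred S}.

HB.instance Definition _ S := [isSub of submod S for @sval V _].
HB.instance Definition _ S := [Choice of submod S by <:].
HB.instance Definition _ S :=
  [SubChoice_isSubLmodule of submod S by <:].

Lemma mem_span S x : S x -> x \in span_pred S.
Proof. by move=> Sx; apply/asboolT; apply: sub_gen_smallest. Qed.

Lemma val_submodP S a (x y : submod S) :
  val (a *: x + y) = a *: val x + val y.
Proof. by []. Qed.

(* The quotient of V by the submodule generated by S. *)
Definition quot_mod S : Type := ring_quotient.Quotient.quot (span_pred S).

HB.instance Definition _ S := GRing.Zmodule.on (quot_mod S).
HB.instance Definition _ S :
  EqQuotient V (ring_quotient.Quotient.equiv (span_pred S)) (quot_mod S) :=
  EqQuotient.on (quot_mod S).

Definition proj S (x : V) : quot_mod S := \pi_(quot_mod S) x.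

Lemma projP S x y : reflect (proj S x = proj S y) (x - y \in span_pred S).
Proof. by rewrite ring_quotient.Quotient.idealrBE; exact: eqP. Qed.

Lemma projD S x y : proj S (x + y) = proj S x + proj S y.
Proof. exact: ring_quotient.Quotient.pi_add. Qed.

Lemma projK S (x : quot_mod S) : proj S (repr x) = x.
Proof. exact: reprK. Qed.

Definition quot_scale S (a : R) (x : quot_mod S) : quot_mod S :=
  proj S (a *: repr x).

Lemma quot_scaleE S a x : quot_scale a (proj S x) = proj S (a *: x).
Proof.
apply/projP; rewrite -scalerBr rpredZ //.
by apply/projP; rewrite projK.
Qed.

Fact quot_scaleA S a b (x : quot_mod S) :
  quot_scale a (quot_scale b x) = quot_scale (a * b) x.
Proof. by rewrite -(projK x) !quot_scaleE scalerA. Qed.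

Fact quot_scale1 S (x : quot_mod S) : quot_scale 1 x = x.
Proof. by rewrite -(projK x) quot_scaleE scale1r. Qed.

Fact quot_scaleDr S : right_distributive (@quot_scale S) +%R.
Proof.
move=> a x y; rewrite -(projK x) -(projK y).
by rewrite -projD !quot_scaleE -projD scalerDr.
Qed.

Fact quot_scaleDl S (x : quot_mod S) :
  {morph (fun a => quot_scale a x) : a b / a + b}.
Proof. by move=> a b; rewrite -(projK x) !quot_scaleE -projD scalerDl. Qed.

HB.instance Definition _ S := GRing.Zmodule_isLmodule.Build R (quot_mod S)
  (@quot_scaleA S) (@quot_scale1 S) (@quot_scaleDr S) (@quot_scaleDl S).

End Submodules.

Arguments proj {R V} S x.

(* The subquotient Z / B. *)
Definition subquot (R : comNzRingType) (V : lmodType R) (Z B : set V) :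
  lmodType R := quot_mod [set x : submod Z | B (val x)].

Definition trivial_mod (R : comNzRingType) (V : lmodType R) : Prop :=
  forall x : V, x = 0.

Section Generators.
Variables (R : comNzRingType) (V : lmodType R).

Definition fin_gen (S : set V) : Prop :=
  exists s : seq V, span_set [set` s] = S.

Definition minimal_gens (S : set V) : set (seq V) :=
  [set s | span_set [set` s] = S /\
     forall t : seq V, span_set [set` t] = S -> (size s <= size t)%N].

(* A generating sequence of S of least length, if S is finitely generated. *)
Definition min_gens (S : set V) : seq V := xget [::] (minimal_gens S).

Definition relations (s : seq V) : set 'rV[R]_(size s) :=
  [set c | \sum_(i < size s) c 0 i *: s`_i = 0].

End Generators.

Arguments relations {R V} s.

Definition fg_module (R : comNzRingType) (M : lmodType R) : Prop :=
  fin_gen [set: M].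

Section LocalRings.
Variable R : comNzRingType.

Definition ideal (I : set R) : Prop := submodule (I : set R^o).

Definition noetherian_ring : Prop := forall I : set R, ideal I -> fin_gen (I : set R^o).

Definition maximal_ideal (m : set R) : Prop :=
  [/\ ideal m, m <> setT &
      forall I : set R, ideal I -> m `<=` I -> I <> setT -> I = m].

Definition local_ring : Prop := exists! m, maximal_ideal m.

(* Meaningful when R is local. *)
Definition max_ideal : set R := get maximal_ideal.

End LocalRings.

Arguments noetherian_ring : clear implicits.
Arguments local_ring : clear implicits.
Arguments max_ideal : clear implicits.

Section Depth.
Variables (R : comNzRingType) (M : lmodType R).

Definition ideal_mul (s : seq R) : set M :=
  [set v | exists a w, a \in s /\ v = a *: w].

Definition regular_seq (s : seq R) : Prop :=
  [/\ forall a, a \in s -> max_ideal R a,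
      forall i, (i < size s)%N ->
        forall v : quot_mod (ideal_mul (take i s)), s`_i *: v = 0 -> v = 0
    & ~ trivial_mod (quot_mod (ideal_mul s))].

(* The zero module has infinite depth. *)
Definition depth : \bar RR :=
  if `[< trivial_mod M >] then +oo%E
  else ereal_sup [set ((size s)%:R)%:E | s in regular_seq].

End Depth.

Section FreeResolution.
Variables (R : comNzRingType) (M : lmodType R).

(* The rank of F_n together with the kernel of F_n -> F_{n-1} (F_{-1} = M):
   F_{n+1} maps the standard basis to a minimal generating sequence of the
   kernel at stage n. *)
Fixpoint res_stage (n : nat) : {r : nat & set 'rV[R]_r} :=
  let next (V : lmodType R) (S : set V) :=
    existT (fun r => set 'rV[R]_r) (size (min_gens S)) (relations (min_gens S))
  in
  match n with
  | 0 => next M setT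
  | n'.+1 => next 'rV[R]_(projT1 (res_stage n')) (projT2 (res_stage n'))
  end.

Definition betti n : nat := projT1 (res_stage n).

Definition free_mod n : lmodType R := 'rV[R]_(betti n).

Definition res_kernel n : set (free_mod n) := projT2 (res_stage n).

Arguments res_kernel : clear implicits.

(* F_{n+1} -> F_n *)
Definition res_diff n : free_mod n.+1 -> free_mod n :=
  fun c => \sum_(i < betti n.+1) c 0 i *: (min_gens (res_kernel n))`_i.

Definition syzygy n : lmodType R := quot_mod (range (@res_diff n)).

(* The inclusion of the (n+1)-st syzygy into F_n, induced by F_{n+1} -> F_n. *)
Definition syz_incl n : syzygy n.+1 -> free_mod n := fun x => res_diff (repr x).

Definition complexity : \bar RR :=
  ereal_inf [set (i%:R)%:E | i in [set i : nat |
    exists gamma : RR, exists n0 : nat, forall n, (n0 <= n)%N ->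
      (betti n)%:R <= gamma * (n%:R : RR) ^ (i%:Z - 1)]].

End FreeResolution.

Arguments res_kernel {R} M n _.
Arguments res_diff {R} M n _.
Arguments syz_incl {R} M n _.

Section Tensor.
Variable R : comNzRingType.

Definition bilinear_relations (M N : lmodType R) : set {freeg (M * N) / R} :=
  [set D | exists a x x' y,
     D = << (a *: x + x', y) >> - a *: << (x, y) >> - << (x', y) >>] `|`
  [set D | exists a x y y',
     D = << (x, a *: y + y') >> - a *: << (x, y) >> - << (x, y') >>].

Definition tensor (M N : lmodType R) : lmodType R :=
  quot_mod (@bilinear_relations M N).

Definition tens (M N : lmodType R) (x : M) (y : N) : tensor M N :=
  proj _ << (x, y) >>.

(* f (x) id_N, for linear f *)
Definition tensor_map (M M' N : lmodType R) (f : M -> M') (t : tensor M N) :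
    tensor M' N :=
  fglift (fun z : M * N => tens (f z.1) z.2) (repr t).

Definition Tor_cycles (n : nat) (M N : lmodType R) :
    set (tensor (free_mod M n) N) :=
  match n with
  | 0 => setT
  | n'.+1 => [set t | tensor_map (res_diff M n') t = 0]
  end.

Definition Tor_boundaries (n : nat) (M N : lmodType R) :
    set (tensor (free_mod M n) N) :=
  range (tensor_map (N := N) (res_diff M n)).

Definition Tor (n : nat) (M N : lmodType R) : lmodType R :=
  subquot (@Tor_cycles n M N) (@Tor_boundaries n M N).

(* -oo if all Tor_i vanish. *)
Definition Tor_sup (M N : lmodType R) : \bar RR :=
  ereal_sup [set (i%:R)%:E | i in [set i | ~ trivial_mod (Tor i M N)]].

End Tensor.

Section ExtAndHom.
Variable R : comNzRingType.

Definition Hom (M N : lmodType R) : lmodType R :=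
  submod [set f : M -> N | linear f].

Definition Ext_cocycles (n : nat) (M N : lmodType R) :
    set (free_mod M n -> N) :=
  [set f | linear f /\ f \o res_diff M n = 0].

Definition Ext_coboundaries (n : nat) (M N : lmodType R) :
    set (free_mod M n -> N) :=
  match n with
  | 0 => [set 0]
  | n'.+1 => [set g \o res_diff M n' | g in [set g | linear g]]
  end.

Definition Ext (n : nat) (M N : lmodType R) : lmodType R :=
  subquot (@Ext_cocycles n M N) (@Ext_coboundaries n M N).

(* f_eta : the map induced on the n-th syzygy of M by a cocycle of class eta. *)
Definition Ext_map (n : nat) (M N : lmodType R) (eta : Ext n M N) :
    syzygy M n -> N :=
  fun x => val (repr eta) (repr x).

Definition pushout (A B C : lmodType R) (f : A -> B) (g : A -> C) :
    lmodType R :=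
  quot_mod [set p : B * C | exists a, p = (f a, - g a)].

(* K_eta, for eta of degree n + 1. *)
Definition K_mod (n : nat) (M N : lmodType R) (eta : Ext n.+1 M N) :
    lmodType R :=
  pushout (Ext_map eta) (syz_incl M n).

End ExtAndHom.

Section Resolutions.
Variable R : comNzRingType.

(* An exact sequence 0 -> G_n -> ... -> G_0 -> M -> 0 with all G_i in P; the
   sequence is continued by zero modules. *)
Definition resolution (P : lmodType R -> Prop) (M : lmodType R) (n : nat) :
    Prop :=
  exists (G : nat -> lmodType R) (d : forall i, {linear G i.+1 -> G i})
         (e : {linear G 0 -> M}),
  [/\ forall i, (i <= n)%N -> P (G i),
      forall i, (n < i)%N -> trivial_mod (G i),
      range e = setT,
      range (d 0) = [set x | e x = 0]
    & forall i, range (d i.+1) = [set x | d i x = 0]].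

Definition projective (P : lmodType R) : Prop :=
  forall (A B : lmodType R) (p : {linear A -> B}) (f : {linear P -> B}),
    range p = setT -> exists g : {linear P -> A}, forall x, p (g x) = f x.

Definition proj_dim (M : lmodType R) : \bar RR :=
  ereal_inf [set (n%:R)%:E | n in
    resolution (fun P => fg_module P /\ projective P) M].

Definition dual (M : lmodType R) : lmodType R := Hom M R^o.

Fact biduality_subproof (M : lmodType R) (x : M) :
  (fun f : dual M => val f x) \in span_pred [set h : dual M -> R^o | linear h].
Proof.
apply: mem_span => a f g.
exact: (congr1 (fun h : M -> R^o => h x) (val_submodP a f g)).
Qed.

Definition biduality (M : lmodType R) (x : M) : dual (dual M) :=
  exist _ (fun f : dual M => val f x) (biduality_subproof x).

Definition Gdim_zero (G : lmodType R) : Prop :=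
  [/\ fg_module G,
      bijective (@biduality G),
      forall i, (0 < i)%N -> trivial_mod (Ext i G R^o)
    & forall i, (0 < i)%N -> trivial_mod (Ext i (dual G) R^o)].

Definition Gdim (M : lmodType R) : \bar RR :=
  ereal_inf [set (n%:R)%:E | n in resolution Gdim_zero M].

End Resolutions.

Local Open Scope ereal_scope.

Inductive reducible_complexity (R : comNzRingType) : lmodType R -> Prop :=
| rc_finite_proj_dim (M : lmodType R) :
    fg_module M -> proj_dim M < +oo -> reducible_complexity M
| rc_reduction (M : lmodType R) (n : nat) (eta : Ext n.+1 M M) :
    fg_module M -> 0 < complexity M -> complexity M < +oo ->
    complexity (K_mod eta) < complexity M ->
    depth M = depth (K_mod eta) ->
    reducible_complexity (K_mod eta) ->
    reducible_complexity M.

(* Main.v *)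
Require Import Defs.
From HB Require Import structures.
From mathcomp Require Import all_boot all_order all_algebra.
From mathcomp Require Import freeg.
From mathcomp Require Import boolp classical_sets functions.
From mathcomp Require Import constructive_ereal reals ereal Rstruct.

Set Implicit Arguments.
Unset Strict Implicit.
Unset Printing Implicit Defensive.

Import Order.TTheory GRing.Theory Num.Theory.

Local Open Scope classical_set_scope.
Local Open Scope ring_scope.

(** Write [T_i] for [Tor_i(M, N)], [s] for the depth of [N], and [e] for the
    difference between the depths of [R] and [M].  The two formulas say that
    [depth T_0 + e = s] when [q = 0], and that [depth T_q + e = s + q] when
    [q > 0] and [T_q] has depth at most one.  They follow the inductive
    definition of reducible complexity, except in the case [e = q = 0].

    A step of that definition is a sequence [0 -> M -> K -> Omega^n M -> 0],
    for a class of degree [n + 1] ([K_exact]).  As [M] and [K] have the same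
    depth, they share the number [e], and they also share [q].  The long exact
    sequence gives [0 -> T_q(M) -> T_q(K) -> X -> 0], where [X] lies in
    [T_(q+n)(M)].  For [q > 0] this last module is [T_q(M)] or zero, so that
    [X] has positive depth when [T_q(M)] has, and the depth lemma shows that
    [T_q(M)] and [T_q(K)] have the same depth as long as the former is at most
    one.  For [q = 0] the module [X] is [T_0(Omega^n M)], which is at least as
    deep as [T_0(M)] up to depth [s], since [T_0(Omega^(j+1) M)] is the kernel
    of a surjection from a power of [N] to [T_0(Omega^j M)].  Hence [T_0(M)]
    and [T_0(K)] have the same depth if the latter is less than [s], which is
    to say if [e > 0] ([depth_formulas_step]).

    The induction starts from modules of finite projective dimension.  There
    [e] is the length of the minimal free resolution, by the formula of
    Auslander and Buchsbaum, and the two depth formulas are due to Auslander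
    ([mfree_depth], [mfree_depth_top]).  They rest on one principle
    ([inj_mod_max]): if a map [f] of free modules is such that the kernel of
    [f (x) N] is deeper than [N], while its image and its cokernel are at least
    as deep as [N], then [f] is injective modulo the maximal ideal.

    There remains the case [e = q = 0], in which the Gorenstein dimension is
    used.  An approximation [0 -> H -> X -> M -> 0] by a totally reflexive
    module, with [H] of finite projective dimension, shows that [M] itself is
    totally reflexive because its depth is that of [R] ([Gdim_full_depth]).
    So [M] is a syzygy of arbitrarily high order: there is an exact sequence
    [0 -> M -> P_0 -> P_1 -> ...] of free modules whose dual is exact.
    Reducible complexity implies that [Tor] of all the cosyzygies with [N]
    vanishes ([rc_cosyz_tor]), so the sequence stays exact when tensored with
    [N] and [T_0] has depth at least [s].  If it were deeper, the principle
    above would make [P_0 -> P_1] injective modulo the maximal ideal, hence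
    injective, and [M] would be zero ([coresolved_tensor_hasdep]). *)

(** * Linear maps, submodules and Noetherian modules *)

Definition mkl (R : pzRingType) (U V : lmodType R) (f : U -> V)
    (lf : linear f) : {linear U -> V} :=
  HB.pack f (GRing.isLinear.Build R U V *:%R f lf).

Lemma mklE (R : pzRingType) (U V : lmodType R) (f : U -> V) (lf : linear f) x :
  mkl lf x = f x.
Proof. by []. Qed.

(** Chain maps and homotopies are built degree by degree, where each step only
    exists and the type of the next map depends on the degree. *)
Lemma dep_choice (S : nat -> Type) (Q : forall i, S i -> S i.+1 -> Prop)
    (x0 : S 0) :
  (forall i x, exists y, Q i x y) ->
  exists s : forall i, S i, s 0 = x0 /\ forall i, Q i (s i) (s i.+1).
Proof.
move=> ex; pose nx i x := projT1 (cid (ex i x)).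
exists (fix s i : S i := match i with 0 => x0 | j.+1 => nx j (s j) end).
split=> // i.
exact: projT2 (cid (ex i _)).
Qed.

Section Submodules.
Variables (R : comNzRingType) (V : lmodType R).
Implicit Types (A U W : set V).

Lemma smod0 U : submodule U -> U 0. Proof. by case. Qed.

Lemma smodD U u v : submodule U -> U u -> U v -> U (u + v).
Proof. by case=> _ lU Uu Uv; rewrite -[u]scale1r; apply: lU. Qed.

Lemma smodZ U a u : submodule U -> U u -> U (a *: u).
Proof. by case=> U0 lU Uu; rewrite -[_ *: _]addr0; apply: lU. Qed.

Lemma smodN U u : submodule U -> U u -> U (- u).
Proof. by move=> sU Uu; rewrite -scaleN1r; apply: smodZ. Qed.

Lemma smodB U u v : submodule U -> U u -> U v -> U (u - v).
Proof. by move=> sU Uu Uv; apply: smodD => //; apply: smodN. Qed.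

Lemma smod_sum U (I : Type) (r : seq I) (P : pred I) (F : I -> V) :
  submodule U -> (forall i, P i -> U (F i)) -> U (\sum_(i <- r | P i) F i).
Proof.
by move=> sU UF; elim/big_rec: _ => [|i x Pi Ux]; [case: sU|apply: smodD; auto].
Qed.

Lemma smodT : submodule [set: V]. Proof. by []. Qed.

Lemma smod00 : submodule [set 0 : V].
Proof. by split=> // a u v /= -> ->; rewrite scaler0 addr0. Qed.

Definition addm U W : set V := [set v | exists u w, [/\ U u, W w & v = u + w]].

Lemma smod_add U W : submodule U -> submodule W -> submodule (addm U W).
Proof.
move=> sU sW; split; first by exists 0, 0; rewrite addr0; split=> //; exact: smod0.
move=> a _ _ [u [w [Uu Ww ->]]] [u' [w' [Uu' Ww' ->]]].
exists (a *: u + u'), (a *: w + w'); split; first exact: sU.2.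
  exact: sW.2.
by rewrite scalerDr addrACA.
Qed.

Lemma addm_l U W : submodule W -> U `<=` addm U W.
Proof. by move=> sW u Uu; exists u, 0; rewrite addr0; split=> //; exact: smod0. Qed.

Lemma addm_r U W : submodule U -> W `<=` addm U W.
Proof. by move=> sU w Ww; exists 0, w; rewrite add0r; split=> //; exact: smod0. Qed.

Definition scalem (a : R) A : set V := [set a *: v | v in A].

Lemma smod_scale a A : submodule A -> submodule (scalem a A).
Proof.
move=> sA; split; first by exists 0; [exact: smod0|rewrite scaler0].
move=> b _ _ [u Au <-] [v Av <-]; exists (b *: u + v); first exact: sA.2.
by rewrite scalerDr !scalerA mulrC.
Qed.

Lemma span_sub (S : set V) U : submodule U -> S `<=` U -> span_set S `<=` U.
Proof. by move=> sU SU v; apply. Qed.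

Lemma span_incl (S : set V) : S `<=` span_set S.
Proof. by move=> v Sv U [_]; apply. Qed.

Lemma span_setS (S S' : set V) : S `<=` S' -> span_set S `<=` span_set S'.
Proof.
by move=> SS'; apply: span_sub (submodule_span _) _ => v /SS'; apply: span_incl.
Qed.

Lemma span_pred_id U v : submodule U -> v \in span_pred U -> U v.
Proof. by move=> sU /asboolP; rewrite span_set_id. Qed.

Lemma proj0P U v : submodule U -> proj U v = 0 <-> U v.
Proof.
move=> sU; have p0 : proj U 0 = 0.
  by apply: (addrI (proj U 0)); rewrite -projD !addr0.
split=> [|Uv]; last by rewrite -p0; apply/projP; rewrite subr0; exact: mem_span.
by rewrite -p0 => /projP; rewrite subr0; exact: span_pred_id.
Qed.

Lemma proj_linear (S : set V) : linear (proj S).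
Proof. by move=> a u v; rewrite projD; congr (_ + _); rewrite -quot_scaleE. Qed.

Definition rcomb n (s : 'I_n -> V) (c : 'I_n -> R) : V := \sum_i c i *: s i.

Lemma rcomb_linear n (s : 'I_n -> V) : linear (rcomb s : ('I_n -> R^o) -> V).
Proof.
move=> a c c'; rewrite /rcomb scaler_sumr -big_split /=.
by apply: eq_bigr => i _; rewrite scalerDl scalerA.
Qed.

Lemma span_seqE (s : seq V) :
  span_set [set` s] = range (rcomb (fun i : 'I_(size s) => s`_i)).
Proof.
apply/seteqP; split.
  apply: span_sub.
    split; first by exists 0 => //; rewrite /rcomb big1 // => i _; rewrite scale0r.
    move=> a _ _ [c _ <-] [c' _ <-]; exists (a *: (c : 'I_(size s) -> R^o) + c') => //.
    by rewrite rcomb_linear.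
  move=> v /= vs; have lt : (index v s < size s)%N by rewrite index_mem.
  exists (fun j => (j == Ordinal lt)%:R) => //.
  rewrite /rcomb (bigD1 (Ordinal lt)) //= eqxx scale1r big1 ?addr0 ?nth_index //.
  by move=> j /negPf ->; rewrite scale0r.
move=> _ [c _ <-]; apply: smod_sum (submodule_span _) _ => i _.
by apply: smodZ (submodule_span _) _; apply: span_incl; rewrite /= mem_nth.
Qed.

(** The condition on chains, unlike finite generation of all submodules, is
    carried over directly by preimages and images, hence to extensions. *)
Definition noeth : Prop :=
  forall U : nat -> set V, (forall i, submodule (U i)) ->
    (forall i, U i `<=` U i.+1) -> exists n, forall i, (n <= i)%N -> U i = U n.

Lemma chain_le (U : nat -> set V) :
  (forall i, U i `<=` U i.+1) -> forall i j, (i <= j)%N -> U i `<=` U j.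
Proof.
move=> inc i j /subnK <-; elim: (j - i)%N => // k IH v /IH; exact: inc.
Qed.

Lemma noeth_max (P : set (set V)) : noeth ->
  (forall U, P U -> submodule U) -> (exists U, P U) ->
  exists U, P U /\ forall W, P W -> U `<=` W -> W = U.
Proof.
move=> nV sP [U0 PU0]; apply: contrapT => nmax.
have step (i : nat) (x : {U | P U}) :
    exists y : {U | P U}, sval x `<=` sval y /\ sval y <> sval x.
  case: x => U PU /=; apply: contrapT => nx; apply: nmax; exists U; split=> //.
  move=> W PW UW; apply: contrapT => WU; apply: nx; by exists (exist _ W PW).
have [s [_ ss]] := dep_choice (exist _ U0 PU0 : (fun=> {U | P U}) 0%N) step.
have [||n nP] := nV (fun i => sval (s i)).
- by move=> i; apply: sP; case: (s i).
- by move=> i; case: (ss i).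
by case: (ss n) => _; apply; rewrite nP.
Qed.

Lemma noeth_fin_gen U : noeth -> submodule U -> fin_gen U.
Proof.
move=> nV sU.
have [||W [[[s sW] WU] maxW]] :=
    @noeth_max (fun W => fin_gen W /\ W `<=` U) nV.
- by move=> W [[s <-] _]; exact: submodule_span.
- exists (span_set [set` [::]]); split; first by exists [::].
  by apply: span_sub => // v.
exists s; rewrite sW; apply/seteqP; split=> // u Uu.
have sm : W `<=` span_set [set` u :: s].
  by rewrite -sW; apply: span_setS => v /= vs; rewrite inE vs orbT.
rewrite -(maxW (span_set [set` u :: s]) _ sm).
  by apply: span_incl; rewrite /= inE eqxx.
split; first by exists (u :: s).
apply: span_sub => // v /=; rewrite inE => /orP[/eqP -> //|vs].
by apply: WU; rewrite -sW; apply: span_incl.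
Qed.

End Submodules.

Section NoethTransfer.
Variable R : comNzRingType.

Lemma smod_preim (V W : lmodType R) (f : {linear V -> W}) (U : set W) :
  submodule U -> submodule (f @^-1` U).
Proof.
move=> sU; split; first by rewrite /preimage /= linear0; exact: smod0.
by move=> a u v; rewrite /preimage /= linearP; exact: sU.2.
Qed.

Lemma smod_img (V W : lmodType R) (f : {linear V -> W}) (U : set V) :
  submodule U -> submodule (f @` U).
Proof.
move=> sU; split; first by exists 0; [exact: smod0|rewrite linear0].
by move=> a _ _ [u Uu <-] [v Uv <-]; exists (a *: u + v); rewrite ?linearP //; exact: sU.2.
Qed.

Lemma smod_ker (V W : lmodType R) (f : {linear V -> W}) :
  submodule [set v | f v = 0].
Proof. exact: smod_preim (@smod00 R W). Qed.

Lemma smod_range (V W : lmodType R) (f : {linear V -> W}) : submodule (range f).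
Proof. by apply: smod_img; exact: smodT. Qed.

Lemma noeth_ext (V1 V2 V3 : lmodType R)
    (f : {linear V1 -> V2}) (g : {linear V2 -> V3}) :
  (forall y, g y = 0 -> exists x, y = f x) -> noeth V1 -> noeth V3 -> noeth V2.
Proof.
move=> ex n1 n3 U sU inc.
have [||a Ha] := n1 (fun i => f @^-1` U i); first by move=> i; exact: smod_preim.
  by move=> i x; apply: inc.
have [||b Hb] := n3 (fun i => g @` U i); first by move=> i; exact: smod_img.
  by move=> i _ [x Ux <-]; exists x => //; apply: inc.
have leab := chain_le inc.
exists (maxn a b) => i le; apply/seteqP; split; last exact: leab.
move=> v Uv; have [w Uw gw] : exists2 w, U (maxn a b) w & g w = g v.
  suff : (g @` U (maxn a b)) (g v) by [].
  rewrite (Hb (maxn a b)) ?leq_maxr // -(Hb i) ?(leq_trans (leq_maxr a b)) //.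
have [x vwx] : exists x, v - w = f x by apply: ex; rewrite linearB /= gw subrr.
have Ux : (f @^-1` U (maxn a b)) x.
  rewrite (Ha (maxn a b)) ?leq_maxl // -(Ha i) ?(leq_trans (leq_maxl a b)) //.
  by rewrite /preimage /= -vwx; apply: smodB => //; apply: leab Uw.
by rewrite -(subrK w v) vwx; apply: smodD.
Qed.

Lemma noeth_surj (V1 V2 : lmodType R) (f : {linear V1 -> V2}) :
  (forall y, exists x, y = f x) -> noeth V1 -> noeth V2.
Proof.
move=> sf n1; apply: (@noeth_ext V1 V2 V1 f \0) => // y _; exact: sf.
Qed.

Lemma noeth_inj (V1 V2 : lmodType R) (f : {linear V1 -> V2}) :
  (forall x, f x = 0 -> x = 0) -> noeth V2 -> noeth V1.
Proof.
move=> injf n2; apply: (@noeth_ext V2 V1 V2 \0 f) => // y /injf ->; by exists 0.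
Qed.

Lemma noeth_prod (V1 V2 : lmodType R) :
  noeth V1 -> noeth V2 -> noeth (V1 * V2)%type.
Proof.
pose i1 := fun x : V1 => (x, 0 : V2).
have li1 : linear i1 by move=> a u v; congr pair; rewrite /= scaler0 addr0.
apply: (@noeth_ext V1 (V1 * V2)%type V2 (mkl li1) snd) => -[x y] /= ->.
by exists x.
Qed.

Lemma noeth_pow (V : lmodType R) n : noeth V -> noeth ('I_n -> V).
Proof.
move=> nV; elim: n => [|n IH].
  move=> U sU inc; exists 0%N => i _; apply/seteqP; split=> v _.
    rewrite (_ : v = 0); first exact: smod0.
    by apply/funext => -[].
  rewrite (_ : v = 0); first exact: smod0.
  by apply/funext => -[].
pose g := fun v : 'I_n.+1 -> V => v ord0.
pose f := fun (v : 'I_n -> V) (i : 'I_n.+1) => if unlift ord0 i is Some j then v j else 0.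
have lg : linear g by [].
have lf : linear f.
  move=> a u v; apply/funext => i; rewrite /f fctE -[RHS]/(a *: _ + _).
  by case: unlift => // ; rewrite scaler0 addr0.
apply: (@noeth_ext _ _ _ (mkl lf) (mkl lg)) => // y gy.
exists (fun j => y (fintype.lift ord0 j)); apply/funext => i; rewrite mklE /f.
by case: unliftP => [j ->//|->].
Qed.

Hypothesis noethR : noetherian_ring R.

Lemma noeth_ring : noeth R^o.
Proof.
move=> U sU inc; have leU := chain_le inc.
pose W := [set x : R^o | exists i, U i x].
have sW : submodule W.
  split; first by exists 0%N; exact: smod0.
  move=> a u v [i Uu] [j Uv]; exists (maxn i j); apply: (sU _).2.
    exact: leU (leq_maxl i j) _ Uu.
  exact: leU (leq_maxr i j) _ Uv.
have [s sE] := noethR sW.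
have [n nP] : exists n, forall x, x \in s -> U n x.
  have : forall x, x \in s -> W x.
    by rewrite -sE => x xs; apply: span_incl.
  elim: s {sE} => [|x s IH] sub; first by exists 0%N.
  have [|n nP] := IH; first by move=> y ys; apply: sub; rewrite inE ys orbT.
  have [m Um] : W x by apply: sub; rewrite inE eqxx.
  exists (maxn n m) => y; rewrite inE => /orP[/eqP ->|ys].
    exact: leU (leq_maxr n m) _ Um.
  exact: leU (leq_maxl n m) _ (nP _ ys).
exists n => i le; apply/seteqP; split; last exact: leU.
move=> v Uv; suff : W v by rewrite -sE; apply: span_sub => // y; exact: nP.
by exists i.
Qed.

Lemma fg_noeth (M : lmodType R) : fg_module M -> noeth M.
Proof.
move=> [s sE]; pose f := rcomb (fun i : 'I_(size s) => s`_i).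
apply: (noeth_surj (f := mkl (@rcomb_linear _ _ _ (fun i : 'I_(size s) => s`_i)))).
  move=> y; have : [set: M] y by [].
  by rewrite -sE span_seqE => -[c _ <-]; exists c.
exact: noeth_pow noeth_ring.
Qed.

Lemma noeth_fg (M : lmodType R) : noeth M -> fg_module M.
Proof. by move=> nM; apply: noeth_fin_gen nM (@smodT _ _). Qed.

End NoethTransfer.

Section IdealOps.
Variables (R : comNzRingType) (I : set R).
Hypothesis sI : submodule (I : set R^o).

Lemma idealD a b : I a -> I b -> I (a + b). Proof. exact: (smodD sI). Qed.
Lemma idealB a b : I a -> I b -> I (a - b). Proof. exact: (smodB sI). Qed.
Lemma idealM a b : I b -> I (a * b). Proof. exact: (smodZ a sI). Qed.

End IdealOps.

(** * Local rings: units, Nakayama, prime avoidance *)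

Section Local.
Variable R : comNzRingType.
Hypotheses (noethR : noetherian_ring R) (localR : local_ring R).
Local Notation mx := (max_ideal R).

Lemma maxi_maximal : maximal_ideal mx.
Proof. by have [m [mm _]] := localR; exact: (getI mm). Qed.

Lemma maxi_smod : submodule (mx : set R^o).
Proof. by case: maxi_maximal. Qed.

Lemma maxi1 : ~ mx 1.
Proof.
have [mi mT _] := maxi_maximal; move=> m1; apply: mT; apply/seteqP; split=> // x _.
by rewrite -[x]mulr1; apply: (smodZ x mi).
Qed.

Lemma maxi0 : mx 0. Proof. exact: (smod0 maxi_smod). Qed.

Lemma maxiM a b : mx b -> mx (a * b).
Proof. exact: (idealM maxi_smod). Qed.

Lemma maxiMr a b : mx a -> mx (a * b).
Proof. by move=> ma; rewrite mulrC; exact: maxiM. Qed.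

(** A proper ideal lies in a maximal one, and there is only one of those. *)
Lemma unit_mx r : ~ mx r -> exists s, s * r = 1.
Proof.
move=> nr; apply: contrapT => nu.
pose P (I : set R^o) := [/\ submodule I, I r & ~ I 1].
have [| |I [[sI Ir I1] Imax]] := noeth_max (noeth_ring noethR) (P := P).
- by move=> U [].
- exists [set x : R^o | exists s, x = s * r]; split; last first.
  + by move=> [s s1]; apply: nu; exists s.
  + by exists 1; rewrite mul1r.
  split; first by exists 0; rewrite mul0r.
  by move=> a _ _ [s ->] [t ->]; exists (a * s + t); rewrite mulrDl -mulrA.
suff maxI : maximal_ideal I.
  have [m [_ mu]] := localR; apply: nr.
  by rewrite -(mu _ maxi_maximal) (mu _ maxI).
split=> //; first by move=> IT; apply: I1; rewrite IT.
move=> J sJ IJ JT; apply: Imax => //; split=> //; first exact: IJ.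
move=> J1; apply: JT; apply/seteqP; split=> // x _.
by rewrite -[x]mulr1; apply: (smodZ x sJ).
Qed.

Lemma unit_1mx a : mx a -> exists s, s * (1 - a) = 1.
Proof.
move=> ma; apply: unit_mx => m1; apply: maxi1.
by rewrite -(subrK a 1); apply: smodD maxi_smod _ _.
Qed.

(** Nakayama: over a maximal proper submodule [W] between [U] and [A] the
    quotient [A / W] is simple, hence killed by [a]. *)
Lemma nakayama (V : lmodType R) (A U : set V) a : noeth V ->
  submodule A -> submodule U -> U `<=` A -> mx a ->
  addm U (scalem a A) = A -> U = A.
Proof.
move=> nV sA sU UA ma e; apply: contrapT => neUA.
pose P W := [/\ submodule W, U `<=` W, W `<=` A & W <> A].
have [| |W [[sW UW WA neWA] Wmax]] := noeth_max nV (P := P).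
- by move=> ? [].
- by exists U; split.
have [v [Av Wv]] : exists v, A v /\ ~ W v.
  apply: contrapT => nv; apply: neWA; apply/seteqP; split=> // v Av.
  by apply: contrapT => Wv; apply: nv; exists v.
suff aW : forall w, A w -> W (a *: w).
  apply: Wv; rewrite -e in Av; have [u [_ [Uu [w Aw <-] ->]]] := Av.
  by apply: smodD => //; [exact: UW|exact: aW].
move=> w Aw; apply: contrapT => naw.
pose L := [set x : V | exists r : R, x = r *: (a *: w)].
have sL : submodule L.
  split; first by exists 0; rewrite scale0r.
  by move=> b _ _ [r ->] [t ->]; exists (b * r + t); rewrite scalerDl !scalerA.
have LW : addm W L = A.
  apply: contrapT => nLW.
  apply: naw; rewrite -(Wmax (addm W L)).
  - by apply: addm_r => //; exists 1; rewrite scale1r.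
  - split=> //; first exact: smod_add.
      by move=> u /UW; apply: addm_l.
    move=> _ [u [_ [Wu [r ->] ->]]]; apply: smodD => //; first exact: WA.
    by apply: smodZ => //; apply: smodZ.
  - exact: addm_l.
have := Aw; rewrite -LW => -[u [_ [Wu [r ->] ew]]].
have [s se] := unit_1mx (maxiM r ma).
have Ww : W w.
  rewrite -[w]scale1r -se -scalerA scalerBl scale1r [X in X - _]ew.
  by rewrite scalerA addrK; apply: smodZ.
by apply: naw; apply: smodZ.
Qed.

End Local.

Section Avoidance.
Variable R : comNzRingType.
Hypotheses (noethR : noetherian_ring R) (localR : local_ring R).
Local Notation mx := (max_ideal R).

Definition prime_set (P : set R) : Prop :=
  submodule (P : set R^o) /\ forall a b, P (a * b) -> P a \/ P b.

(** Such sets are stable under intersection and meet the maximal ideal; this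
    yields a single element that is regular on several modules at once. *)
Definition generic (Z : set R) : Prop :=
  exists (I : finType) (P : I -> set R),
    [/\ forall i, prime_set (P i), forall i, exists x, mx x /\ ~ P i x
      & forall a, mx a -> (forall i, ~ P i a) -> Z a].

Lemma genericI Z Z' : generic Z -> generic Z' -> generic (Z `&` Z').
Proof.
move=> [I [P [pP xP ZP]]] [J [Q [pQ xQ ZQ]]].
exists (I + J)%type, (fun k => match k with inl i => P i | inr j => Q j end).
split; [by case|by case|] => a ma na; split.
  by apply: ZP => // i; apply: (na (inl i)).
by apply: ZQ => // j; apply: (na (inr j)).
Qed.

(** Prime avoidance: if [a] avoids the primes in [s] but lies in [P i], then
    adding to it some [b] outside [P i] that lies in every prime of [s] not
    contained in [P i] corrects it. *)
Lemma generic_ex Z : generic Z -> exists a, mx a /\ Z a.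
Proof.
move=> [I [P [pP xP ZP]]].
suff [a [ma na]] : exists a, mx a /\ forall i, i \in enum I -> ~ P i a.
  by exists a; split=> //; apply: ZP => // i; apply: na; rewrite mem_enum.
elim: (enum I) => [|i s [a [ma na]]]; first by exists 0; split; [exact: (maxi0 localR)|].
have [Pia|Pia] := pselect (P i a); last first.
  by exists a; split=> // j; rewrite inE => /orP[/eqP ->//|]; exact: na.
have [b [mb nb sb]] : exists b,
    [/\ mx b, ~ P i b & forall j, j \in s -> P j `<=` P i \/ P j b].
  elim: s {na} => [|j s [b [mb nb sb]]]; first by have [x []] := xP i; exists x.
  have [ji|ji] := pselect (P j `<=` P i).
    by exists b; split=> // k; rewrite inE => /orP[/eqP ->|/sb //]; left.
  have [y [Py ny]] : exists y, P j y /\ ~ P i y.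
    by apply: contrapT => ne; apply: ji => y Py; apply: contrapT => ny; apply: ne; exists y.
  exists (y * b); split; first exact: maxiM.
    by case/(pP i).2.
  move=> k; rewrite inE => /orP[/eqP ->|/sb[]]; [right|by left|right].
    by rewrite mulrC; apply: (smodZ b (pP j).1).
  exact: (idealM (pP k).1).
exists (a + b); split; first exact: (idealD (maxi_smod localR)).
have nab : ~ P i (a + b).
  by move=> Pab; apply: nb; rewrite -(addKr a b) addrC; exact: (idealB (pP i).1).
move=> j; rewrite inE => /orP[/eqP ->//|js Pj].
have [ji|Pjb] := sb _ js; first exact: nab (ji _ Pj).
by apply: (na _ js); rewrite -(addrK b a); exact: (idealB (pP j).1).
Qed.

End Avoidance.

(** * Depth of subquotients *)

Section Subquotients.
Variable R : comNzRingType.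
Local Notation mx := (max_ideal R).

Section Def.
Variable V : lmodType R.
Implicit Types A U : set V.

(** The subquotient [A / U] is represented by the pair [(A, U)]. *)
Definition sqpair A U : Prop := [/\ submodule A, submodule U & U `<=` A].

Definition sqreg a A U : Prop := forall v, A v -> U (a *: v) -> U v.

(** The condition [Hom(R / m, A / U) = 0], which is equivalent to positive
    depth by prime avoidance. *)
Definition socfree A U : Prop :=
  forall v, A v -> (forall r, mx r -> U (r *: v)) -> U v.

(** The submodule [U + a A]: the pair [(A, qmul a A U)] is [A / U] modulo [a]. *)
Definition qmul a A U : set V := addm U (scalem a A).

(** Depth at least [n].  Regular sequences are taken on pairs, so that dividing
    by an element changes the submodule [U] but not the ambient module. *)
Fixpoint dge n A U : Prop :=
  if n is n'.+1 then exists a, [/\ mx a, sqreg a A U & dge n' A (qmul a A U)]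
  else True.

Lemma qmul_pair a A U : sqpair A U -> sqpair A (qmul a A U).
Proof.
move=> [sA sU UA]; split=> //; first by apply: smod_add => //; exact: smod_scale.
by move=> _ [u [_ [Uu [v Av <-] ->]]]; apply: smodD => //; [exact: UA|exact: smodZ].
Qed.

Lemma qmulC a b A U : qmul a A (qmul b A U) = qmul b A (qmul a A U).
Proof.
suff H c d : qmul c A (qmul d A U) `<=` qmul d A (qmul c A U).
  by apply/seteqP; split; exact: H.
move=> _ [_ [w [[u [x [Uu Sx ->]]] Sw ->]]].
exists (u + w), x; rewrite addrAC; split=> //; by exists u, w.
Qed.

Lemma qmul_sub a A U : submodule A -> U `<=` qmul a A U.
Proof. by move=> sA; apply: addm_l; exact: smod_scale. Qed.

Lemma qmulI a A U u v : U u -> A v -> qmul a A U (u + a *: v).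
Proof. by move=> Uu Av; exists u, (a *: v); split=> //; exists v. Qed.

Lemma qmulE a A U w : qmul a A U w -> exists u v, [/\ U u, A v & w = u + a *: v].
Proof. by move=> [u [_ [Uu [v Av <-] ->]]]; exists u, v. Qed.

Lemma sqreg_qmul a c A U : sqpair A U -> sqreg a A U -> sqreg c A U ->
  sqreg c A (qmul a A U) -> sqreg a A (qmul c A U).
Proof.
move=> pA ra rc rca v Av; have [sA sU UA] := pA.
have [_ sq qA] := qmul_pair a pA.
move=> /qmulE[u [w [Uu Aw e]]].
have /qmulE[u' [w' [Uu' Aw' e']]] : qmul a A U w.
  apply: rca => //; rewrite (_ : c *: w = - u + a *: v); last by rewrite e addKr.
  by apply: qmulI => //; exact: smodN.
rewrite -(subrK (c *: w') v); apply: qmulI => //; apply: ra.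
  by apply: smodB => //; exact: smodZ.
rewrite scalerBr e e' scalerDr !scalerA [c * a]mulrC addrA addrK.
by apply: smodD => //; exact: smodZ.
Qed.

Lemma sqreg_socfree a A U : mx a -> sqreg a A U -> socfree A U.
Proof. by move=> ma ra v Av H; apply: ra => //; exact: H. Qed.

(** Both [Hom(R / m, M / a M)] and [Hom(R / m, M / b M)] are isomorphic to
    [Ext^1(R / m, M)]; the isomorphism between them takes [v] to the [w] with
    [a v = b w]. *)
Lemma socfree_swap a b A U : sqpair A U -> mx a -> mx b -> sqreg a A U ->
  sqreg b A U -> socfree A (qmul a A U) -> socfree A (qmul b A U).
Proof.
move=> pA ma mb ra rb sf v Av H; have [sA sU UA] := pA.
have /qmulE[u [w [Uu Aw e]]] := H _ ma.
have /qmulE[u' [w' [Uu' Aw' e']]] : qmul a A U w.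
  apply: sf => // r mr; have /qmulE[u1 [w1 [Uu1 Aw1 e1]]] := H _ mr.
  rewrite -(subrK (a *: w1) (r *: w)); apply: qmulI => //; apply: rb.
    by apply: smodB => //; exact: smodZ.
  have -> : b *: (r *: w - a *: w1) = a *: u1 - r *: u.
    have e2 : a *: u1 + a *: (b *: w1) = r *: u + r *: (b *: w).
      by rewrite -!scalerDr -e1 -e !scalerA mulrC.
    rewrite scalerBr !scalerA [b * r]mulrC [b * a]mulrC -!scalerA.
    by apply/eqP; rewrite subr_eq addrAC e2 addrAC subrr add0r.
  by apply: smodB => //; exact: smodZ.
rewrite -(subrK (b *: w') v); apply: qmulI => //; apply: ra.
  by apply: smodB => //; exact: smodZ.
rewrite scalerBr e e' scalerDr !scalerA [b * a]mulrC addrA addrK.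
by apply: smodD => //; exact: smodZ.
Qed.

End Def.

Section Generic.
Variable V : lmodType R.
Hypotheses (noethR : noetherian_ring R) (localR : local_ring R) (nV : noeth V).
Implicit Types A U : set V.

Let ann U v : set R^o := [set r : R^o | U (r *: v)].

Let ann_smod U v : submodule U -> submodule (ann U v).
Proof.
move=> sU; split; first by rewrite /ann /= scale0r; exact: smod0.
by move=> a r t Ur Ut; rewrite /ann /= scalerDl -scalerA; exact: sU.2.
Qed.

(** Every zero divisor lies in a maximal annihilator of an element.  These are
    prime, and only finitely many of them are distinct, since the elements
    having them span a finitely generated module. *)
Lemma generic_sqreg A U : sqpair A U -> socfree A U -> generic [set a | sqreg a A U].
Proof.
move=> [sA sU UA] sf.
pose mxann v := [/\ A v, ~ U v &
  forall w, A w -> ~ U w -> ann U v `<=` ann U w -> ann U w = ann U v].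
have annP v : mxann v -> prime_set (ann U v).
  move=> [Av Uv maxv]; split; first exact: ann_smod.
  move=> a b; rewrite {1}/ann /= => Uab.
  have [Ub|Ub] := pselect (U (b *: v)); [by right|left].
  rewrite -(maxv (b *: v)) //; first by rewrite /ann /= scalerA.
    exact: smodZ.
  by move=> r Ur; rewrite /ann /= scalerA mulrC -scalerA; exact: smodZ.
pose F W := exists2 s : seq V, (forall v, v \in s -> mxann v) & W = span_set [set` s].
have [| |W [[s smx Ws] Wmax]] := noeth_max nV (P := F).
- by move=> _ [s _ ->]; exact: submodule_span.
- by exists (span_set [set` [::]]), [::].
have key v : mxann v -> exists i : 'I_(size s), ann U s`_i = ann U v.
  move=> mv; have Wv : W v.
    rewrite -(Wmax (span_set [set` v :: s])).
    - by apply: span_incl; rewrite /= inE eqxx.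
    - by exists (v :: s) => // w; rewrite inE => /orP[/eqP ->//|]; exact: smx.
    - by rewrite Ws; apply: span_setS => w /= ws; rewrite inE ws orbT.
  have [Av Uv maxv] := mv.
  suff [i sub] : exists i : 'I_(size s), ann U s`_i `<=` ann U v.
    exists i; have [_ _ maxi] := smx _ (mem_nth 0 (ltn_ord i)).
    by rewrite (maxi v).
  apply: contrapT => nsub.
  have /choice[r rP] (i : 'I_(size s)) : exists r : R, U (r *: s`_i) /\ ~ U (r *: v).
    apply: contrapT => ne; apply: nsub; exists i => r Ur; apply: contrapT => nr.
    by apply: ne; exists r.
  (* The product of the [r i] kills [s], hence [v], modulo [U]. *)
  have pr : ~ U ((\prod_i r i) *: v).
    elim/big_ind: _ => [|a b Ua Ub|i _]; first by rewrite scale1r.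
      by case/(annP _ mv).2.
    by case: (rP i).
  move: Wv; rewrite Ws span_seqE => -[c _ vE]; apply: pr.
  rewrite -vE scaler_sumr; apply: smod_sum => // i _.
  rewrite scalerA (bigD1 i) //= -mulrA mulrC -scalerA; apply: smodZ => //.
  by case: (rP i).
exists 'I_(size s), (fun i : 'I_(size s) => ann U s`_i); split.
- by move=> i; apply: annP; apply: smx; exact: mem_nth.
- move=> i; have [Ai Ui _] := smx _ (mem_nth 0 (ltn_ord i)).
  apply: contrapT => nx; apply: Ui; apply: sf => // r mr.
  by apply: contrapT => Ur; apply: nx; exists r.
move=> a ma na v Av Uav; apply: contrapT => Uv.
pose G (J : set R^o) :=
  exists2 w, A w /\ ~ U w & ann U v `<=` ann U w /\ J = ann U w.
have [| |J [[w [Aw Uw] [vw Jw]] Jmax]] := noeth_max (noeth_ring noethR) (P := G).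
- by move=> _ [w _ [_ ->]]; exact: ann_smod.
- by exists (ann U v); exists v => //; split.
have [|i ie] := key w.
  split=> // x Ax Ux wx; rewrite -Jw; apply: Jmax; last by rewrite Jw.
  by exists x => //; split=> //; exact: subset_trans wx.
by apply: (na i); rewrite ie; apply: vw.
Qed.

Lemma dge1_socfree A U n : dge n.+1 A U -> socfree A U.
Proof. by case=> a [ma ra _]; exact: sqreg_socfree ra. Qed.

Lemma dgeS_generic A U n : sqpair A U -> dge n.+1 A U -> generic [set a | sqreg a A U].
Proof. by move=> pA /dge1_socfree; exact: generic_sqreg. Qed.

(** A generic element [c] is regular on [A / U] and on its quotients by [a] and
    by [b].  It may begin the regular sequence after [a], by induction, and
    then [a] and [c] commute, as do [b] and [c]. *)
Lemma dge_swap n A U a b : sqpair A U -> mx a -> mx b -> sqreg a A U ->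
  sqreg b A U -> dge n A (qmul a A U) -> dge n A (qmul b A U).
Proof.
elim: n U a b => // n IH U a b pA ma mb ra rb dn.
have sfa := dge1_socfree dn.
have sfb := socfree_swap pA ma mb ra rb sfa.
have ga := generic_sqreg (qmul_pair a pA) sfa.
have gb := generic_sqreg (qmul_pair b pA) sfb.
have g0 := generic_sqreg pA (sqreg_socfree ma ra).
have [c [mc [rc [rca rcb]]]] := generic_ex localR (genericI g0 (genericI ga gb)).
have [c0 [mc0 rc0 dc0]] := dn.
exists c; split=> //.
have dc := IH _ c0 c (qmul_pair a pA) mc0 mc rc0 rca dc0.
rewrite qmulC in dc; rewrite qmulC.
apply: (IH _ a b (qmul_pair c pA)) => //; exact: sqreg_qmul.
Qed.

Lemma dge_reg n A U a : sqpair A U -> mx a -> sqreg a A U ->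
  dge n.+1 A U -> dge n A (qmul a A U).
Proof. by move=> pA ma ra [b [mb rb]]; exact: dge_swap. Qed.

Lemma dgeS n A U : dge n.+1 A U -> dge n A U.
Proof. by elim: n U => // n IH U [a [ma ra /IH]]; exists a. Qed.

Lemma dge_le m n A U : (m <= n)%N -> dge n A U -> dge m A U.
Proof. by move=> /subnK <-; elim: (n - m)%N => // k IH /dgeS. Qed.

Lemma dge_zero n A : dge n A A.
Proof.
elim: n => // n IH; exists 0; split; [exact: (maxi0 localR)|by move=> v|].
rewrite (_ : qmul 0 A A = A) //; apply/seteqP; split.
  by move=> _ /qmulE[u [v [Au _ ->]]]; rewrite scale0r addr0.
by move=> u Au; exists u, 0; split; rewrite ?addr0 //; exists u; rewrite ?scale0r.
Qed.

(** Otherwise a maximal [U] such that [A / U] is nonzero and of infinite depth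
    could be enlarged by a regular element, according to Nakayama. *)
Lemma dge_bounded A U : sqpair A U -> U <> A -> exists n, ~ dge n A U.
Proof.
move=> pA neUA; apply: contrapT => nb.
have inf0 n : dge n A U by apply: contrapT => nd; apply: nb; exists n.
pose P W := [/\ sqpair A W, W <> A & forall n, dge n A W].
have [| |W [[pW neW infW] Wmax]] := noeth_max nV (P := P).
- by move=> W [[]].
- by exists U.
have [sA sW WA] := pW; have [a [ma ra _]] := infW 1%N.
have sub : W `<=` qmul a A W by exact: qmul_sub.
apply: (neW); apply/seteqP; split=> // v Av; apply: (ra) => //.
rewrite -(Wmax (qmul a A W)) //; first by rewrite -[a *: v]add0r; apply: qmulI => //; exact: smod0.
split; [exact: qmul_pair| |by move=> n; apply: dge_reg ra _ => //; exact: infW].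
by move=> e; apply: neW; exact: nakayama e.
Qed.

Definition hasdep A U n : Prop := dge n A U /\ ~ dge n.+1 A U.

Lemma hasdep_ex A U : sqpair A U -> U <> A -> exists n, hasdep A U n.
Proof.
move=> pA /(dge_bounded pA) [n nd]; elim: n nd => [[]//|n IH nd].
by have [d|/IH //] := pselect (dge n A U); exists n.
Qed.

Lemma hasdep_dge A U n k : hasdep A U n -> dge k A U <-> (k <= n)%N.
Proof.
move=> [d nd]; split=> [dk|le]; last exact: dge_le d.
by rewrite leqNgt; apply/negP => lt; apply: nd; exact: dge_le dk.
Qed.

Lemma hasdep_neq A U n : hasdep A U n -> U <> A.
Proof. by move=> [_ nd] e; apply: nd; rewrite e; exact: dge_zero. Qed.

Lemma hasdep_inj A U n n' : hasdep A U n -> hasdep A U n' -> n = n'.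
Proof.
move=> h h'; apply/eqP; rewrite eqn_leq.
by rewrite (iffLR (hasdep_dge _ h') h.1) (iffLR (hasdep_dge _ h) h'.1).
Qed.

End Generic.
End Subquotients.

(** * Exact sequences and depth *)

Section Exact.
Variable R : comNzRingType.
Hypotheses (noethR : noetherian_ring R) (localR : local_ring R).
Local Notation mx := (max_ideal R).

(** [f] induces an isomorphism from [A / U] to [A' / U']. *)
Record piso (V V' : lmodType R) (f : {linear V -> V'}) (A U : set V)
    (A' U' : set V') : Prop := Piso {
  piso_fun : forall v, A v -> A' (f v);
  piso_inj : forall v, A v -> U' (f v) <-> U v;
  piso_surj : forall w, A' w -> exists v, A v /\ U' (w - f v) }.

(** [f] and [g] induce an exact sequence
    [0 -> A1 / U1 -> A2 / U2 -> A3 / U3 -> 0]. *)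
Record pses (V1 V2 V3 : lmodType R) (f : {linear V1 -> V2}) (g : {linear V2 -> V3})
    (A1 U1 : set V1) (A2 U2 : set V2) (A3 U3 : set V3) : Prop := Pses {
  pses_p1 : sqpair A1 U1;
  pses_p2 : sqpair A2 U2;
  pses_p3 : sqpair A3 U3;
  pses_f : forall x, A1 x -> A2 (f x);
  pses_inj : forall x, A1 x -> U2 (f x) <-> U1 x;
  pses_g : forall y, A2 y -> A3 (g y);
  pses_mid : forall y, A2 y -> U3 (g y) <-> exists x, A1 x /\ U2 (y - f x);
  pses_surj : forall z, A3 z -> exists y, A2 y /\ U3 (z - g y) }.

Lemma pses_id (V0 V : lmodType R) :
  pses (\0 : {linear V0 -> V}) (idfun : {linear V -> V})
    [set 0] [set 0] setT [set 0] setT [set 0].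
Proof.
have p0 (W : lmodType R) : sqpair [set: W] [set 0] by split=> //; exact: smod00.
split=> //.
- by split=> //; exact: smod00.
- move=> t _; split=> [/= ->|[x [_ e0]]]; first by exists 0; rewrite subrr.
  by have e1 : t - 0 = 0 := e0; rewrite subr0 in e1; rewrite e1.
by move=> z _; exists z; rewrite /= subrr.
Qed.

Section Piso.
Variables (V V' : lmodType R) (f : {linear V -> V'}) (A : set V) (A' : set V').

Lemma piso_qmul U U' a : sqpair A U -> sqpair A' U' -> piso f A U A' U' ->
  piso f A (qmul a A U) A' (qmul a A' U').
Proof.
move=> [sA sU UA] [sA' sU' UA'] [ff fi fs]; split=> //.
  move=> v Av; split=> /qmulE[u [w [Uu Aw e]]]; last first.
    by rewrite e linearD linearZ; apply: qmulI; [apply/fi => //; exact: UA|exact: ff].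
  have [w' [Aw' Uw']] := fs _ Aw.
  rewrite -(subrK (a *: w') v); apply: qmulI => //; apply/fi.
    by apply: smodB => //; exact: smodZ.
  rewrite linearB linearZ /= e -addrA -scalerBr.
  by apply: smodD => //; exact: smodZ.
move=> w /fs[v [Av Uv]]; exists v; split=> //; exact: qmul_sub.
Qed.

Lemma piso_sqreg U U' a : sqpair A U -> sqpair A' U' -> piso f A U A' U' ->
  sqreg a A U <-> sqreg a A' U'.
Proof.
move=> [sA sU UA] [sA' sU' UA'] [ff fi fs]; split=> ra v Av Uav.
  have [w [Aw Uw]] := fs _ Av.
  rewrite -(subrK (f w) v); apply: smodD => //; apply/fi => //; apply: ra => //.
  apply/fi; first exact: smodZ.
  rewrite linearZ /= (_ : a *: f w = a *: v - a *: (v - f w)); last first.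
    by rewrite -scalerBr opprB addrC subrK.
  by apply: smodB => //; exact: smodZ.
by apply/fi => //; apply: ra; [exact: ff|rewrite -linearZ; apply/fi => //; exact: smodZ].
Qed.

Lemma piso_dge n U U' : sqpair A U -> sqpair A' U' -> piso f A U A' U' ->
  dge n A U <-> dge n A' U'.
Proof.
elim: n U U' => // n IH U U' p p' fi; split=> -[a [ma ra da]]; exists a; split=> //.
- exact/(piso_sqreg a p p' fi).
- exact/(IH _ _ (qmul_pair a p) (qmul_pair a p') (piso_qmul a p p' fi)).
- exact/(piso_sqreg a p p' fi).
- exact/(IH _ _ (qmul_pair a p) (qmul_pair a p') (piso_qmul a p p' fi)).
Qed.

Lemma piso_hasdep n U U' : sqpair A U -> sqpair A' U' -> piso f A U A' U' ->
  hasdep A U n <-> hasdep A' U' n.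
Proof.
move=> p p' fi; rewrite /hasdep.
have := piso_dge n p p' fi; have := piso_dge n.+1 p p' fi; tauto.
Qed.

End Piso.

Section Pses.
Variables (V1 V2 V3 : lmodType R) (f : {linear V1 -> V2}) (g : {linear V2 -> V3}).
Variables (A1 : set V1) (A2 : set V2) (A3 : set V3).
Hypotheses (n1 : noeth V1) (n2 : noeth V2) (n3 : noeth V3).

(** The snake lemma.  With it the three inequalities of the depth lemma follow
    by induction, dividing at each step by an element that is regular on all the
    terms concerned. *)
Lemma pses_qmul U1 U2 U3 a : pses f g A1 U1 A2 U2 A3 U3 -> sqreg a A3 U3 ->
  pses f g A1 (qmul a A1 U1) A2 (qmul a A2 U2) A3 (qmul a A3 U3).
Proof.
move=> [p1 p2 p3 ff fi gg mid surj] ra.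
have [[sA1 sU1 UA1] [sA2 sU2 UA2] [sA3 sU3 UA3]] := And3 p1 p2 p3.
split=> //; try exact: qmul_pair.
- move=> x Ax; split=> /qmulE[u [y [Uu Ay e]]]; last first.
    by rewrite e linearD linearZ; apply: qmulI; [apply/fi => //; exact: UA1|exact: ff].
  have [x' [Ax' Ux']] : exists x', A1 x' /\ U2 (y - f x').
    apply/mid => //; apply: ra; first exact: gg.
    rewrite -linearZ (_ : a *: y = f x - u); last by rewrite e [u + _]addrC addrK.
    apply/mid; first by apply: smodB => //; [exact: ff|exact: UA2].
    by exists x; split=> //; rewrite addrC addrA addNr add0r; exact: smodN.
  rewrite -(subrK (a *: x') x); apply: qmulI => //; apply/fi.
    by apply: smodB => //; exact: smodZ.
  rewrite linearB linearZ /= e -addrA -scalerBr.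
  by apply: smodD => //; exact: smodZ.
- move=> y Ay; split.
    move=> /qmulE[u [z [Uu Az e]]]; have [y' [Ay' Uy']] := surj _ Az.
    have [x [Ax Ux]] : exists x, A1 x /\ U2 (y - a *: y' - f x).
      apply/mid; first by apply: smodB => //; exact: smodZ.
      rewrite linearB linearZ /= e -addrA -scalerBr.
      by apply: smodD => //; exact: smodZ.
    exists x; split=> //; rewrite -(subrK (a *: y') (y - _)).
    by apply: qmulI => //; rewrite addrAC.
  move=> [x [Ax /qmulE[u [w [Uu Aw e]]]]].
  rewrite -(subrK (f x) y) e addrAC linearD linearZ /=; apply: qmulI; last exact: gg.
  apply/mid; first by apply: smodD => //; [exact: UA2|exact: ff].
  by exists x; rewrite addrK.
- move=> z /surj[y [Ay Uy]]; exists y; split=> //; exact: qmul_sub.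
Qed.

Lemma sqreg_left U1 U2 U3 a : pses f g A1 U1 A2 U2 A3 U3 -> sqreg a A2 U2 -> sqreg a A1 U1.
Proof.
move=> S ra x Ax Ux; have [sA1 _ _] := pses_p1 S.
apply/(pses_inj S) => //; apply: ra; first exact: (pses_f S).
by rewrite -linearZ; apply/(pses_inj S) => //; exact: smodZ.
Qed.

Lemma sqreg_mid U1 U2 U3 a : pses f g A1 U1 A2 U2 A3 U3 ->
  sqreg a A1 U1 -> sqreg a A3 U3 -> sqreg a A2 U2.
Proof.
move=> S r1 r3 y Ay Uay.
have [[sA1 sU1 UA1] [sA2 sU2 UA2] _] := And3 (pses_p1 S) (pses_p2 S) (pses_p3 S).
have [x [Ax Ux]] : exists x, A1 x /\ U2 (y - f x).
  apply/(pses_mid S) => //; apply: r3; first exact: (pses_g S).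
  rewrite -linearZ; apply/(pses_mid S); first exact: smodZ.
  by exists 0; rewrite linear0 subr0; split=> //; exact: smod0.
rewrite -(subrK (f x) y); apply: smodD => //; apply/(pses_inj S) => //; apply: r1 => //.
apply/(pses_inj S); first exact: smodZ.
rewrite linearZ /= (_ : a *: f x = a *: y - a *: (y - f x)); last first.
  by rewrite -scalerBr opprB addrC subrK.
by apply: smodB => //; exact: smodZ.
Qed.

Lemma socfree_left U1 U2 U3 : pses f g A1 U1 A2 U2 A3 U3 -> socfree A2 U2 -> socfree A1 U1.
Proof.
move=> S sf x Ax H; have [sA1 _ _] := pses_p1 S.
apply/(pses_inj S) => //; apply: sf; first exact: (pses_f S).
by move=> r mr; rewrite -linearZ; apply/(pses_inj S); [exact: smodZ|exact: H].
Qed.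

Lemma dge_mid U1 U2 U3 n : pses f g A1 U1 A2 U2 A3 U3 ->
  dge n A1 U1 -> dge n A3 U3 -> dge n A2 U2.
Proof.
elim: n U1 U2 U3 => // n IH U1 U2 U3 S d1 d3.
have g1 := dgeS_generic noethR n1 (pses_p1 S) d1.
have g3 := dgeS_generic noethR n3 (pses_p3 S) d3.
have [a [ma [r1 r3]]] := generic_ex localR (genericI g1 g3).
exists a; split=> //; first exact: sqreg_mid S r1 r3.
exact: IH (pses_qmul S r3) (dge_reg noethR localR n1 (pses_p1 S) ma r1 d1) (dge_reg noethR localR n3 (pses_p3 S) ma r3 d3).
Qed.

Lemma dge_left U1 U2 U3 n : pses f g A1 U1 A2 U2 A3 U3 ->
  dge n.+1 A2 U2 -> dge n A3 U3 -> dge n.+1 A1 U1.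
Proof.
elim: n U1 U2 U3 => [|n IH] U1 U2 U3 S d2 d3.
  by have [a [ma r2 _]] := d2; exists a; split=> //; exact: sqreg_left S r2.
have g2 := dgeS_generic noethR n2 (pses_p2 S) d2.
have g3 := dgeS_generic noethR n3 (pses_p3 S) d3.
have [a [ma [r2 r3]]] := generic_ex localR (genericI g2 g3).
exists a; split=> //; first exact: sqreg_left S r2.
exact: IH (pses_qmul S r3) (dge_reg noethR localR n2 (pses_p2 S) ma r2 d2) (dge_reg noethR localR n3 (pses_p3 S) ma r3 d3).
Qed.

(** The connecting homomorphism in degree zero: for a socle element of
    [A3 / U3] lifted to [v], the element [a v] is a socle element of
    [A1 / a A1]. *)
Lemma socfree_right U1 U2 U3 a : pses f g A1 U1 A2 U2 A3 U3 -> mx a ->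
  sqreg a A1 U1 -> sqreg a A2 U2 -> socfree A1 (qmul a A1 U1) -> socfree A3 U3.
Proof.
move=> S ma r1 r2 sf z Az Hz.
have [[sA1 sU1 UA1] [sA2 sU2 UA2] [sA3 sU3 UA3]] := And3 (pses_p1 S) (pses_p2 S) (pses_p3 S).
have [v [Av Uv]] := pses_surj S Az.
rewrite -(subrK (g v) z); apply: smodD => //; apply/(pses_mid S) => //.
have Hv r : mx r -> exists x, A1 x /\ U2 (r *: v - f x).
  move=> mr; apply/(pses_mid S); first exact: smodZ.
  rewrite linearZ /= (_ : r *: g v = r *: z - r *: (z - g v)); last first.
    by rewrite -scalerBr opprB addrC subrK.
  by apply: smodB => //; [exact: Hz|exact: smodZ].
have [x [Ax Ux]] := Hv _ ma.
have /qmulE[u [x' [Uu Ax' e]]] : qmul a A1 U1 x.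
  apply: sf => // r mr; have [y [Ay Uy]] := Hv _ mr.
  rewrite -(subrK (a *: y) (r *: x)); apply: qmulI => //; apply/(pses_inj S).
    by apply: smodB => //; exact: smodZ.
  have -> : f (r *: x - a *: y) = a *: (r *: v - f y) - r *: (a *: v - f x).
    have -> : f (r *: x - a *: y) = r *: f x - a *: f y by rewrite linearB; congr (_ - _); rewrite linearZ.
    rewrite [in RHS]scalerBr [X in _ = _ - X]scalerBr opprB [RHS]addrC !scalerA [a * r]mulrC.
    by rewrite subrKA.
  by apply: smodB => //; exact: smodZ.
exists x'; split=> //; apply: r2; first by apply: smodB => //; exact: (pses_f S).
rewrite scalerBr (_ : _ - _ = (a *: v - f x) + f u); last first.
  have -> : f x = f u + a *: f x' by rewrite e linearD linearZ.
  by rewrite opprD addrA addrAC subrK.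
by apply: smodD => //; apply/(pses_inj S) => //; exact: UA1.
Qed.

Lemma dge_right U1 U2 U3 n : pses f g A1 U1 A2 U2 A3 U3 ->
  dge n A2 U2 -> dge n.+1 A1 U1 -> dge n A3 U3.
Proof.
elim: n U1 U2 U3 => // n IH U1 U2 U3 S d2 d1.
have g1 := dgeS_generic noethR n1 (pses_p1 S) d1.
have g2 := dgeS_generic noethR n2 (pses_p2 S) d2.
have [a [ma [r1 r2]]] := generic_ex localR (genericI g1 g2).
have sf : socfree A3 U3.
  apply: (socfree_right S ma r1 r2); apply: (@dge1_socfree _ _ _ _ n).
  exact: (dge_reg noethR localR n1 (pses_p1 S) ma r1 d1).
have g3 := generic_sqreg noethR n3 (pses_p3 S) sf.
have [b [mb [s1 [s2 s3]]]] := generic_ex localR (genericI g1 (genericI g2 g3)).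
exists b; split=> //.
exact: IH (pses_qmul S s3) (dge_reg noethR localR n2 (pses_p2 S) mb s2 d2) (dge_reg noethR localR n1 (pses_p1 S) mb s1 d1).
Qed.

End Pses.

Lemma pair_full (V : lmodType R) : sqpair [set: V] [set 0].
Proof. by split=> //; exact: smod00. Qed.

Lemma subquot_dge (V : lmodType R) (Z B : set V) n : sqpair Z B ->
  dge n [set: subquot Z B] [set 0] <-> dge n Z B.
Proof.
move=> [sZ sB BZ].
pose S := [set x : submod Z | B (val x)].
have lv : linear (val : submod Z -> V) by [].
have sS : submodule S by exact: (smod_preim (mkl lv)).
have memZ (x : submod Z) : Z (val x) by apply: span_pred_id => //; exact: valP.
have pS : sqpair setT S by split=> //; exact: smodT.
have i1 : piso (mkl lv) setT S Z B.
  split=> // [v _|w Zw]; first exact: memZ.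
  by exists (Sub w (mem_span Zw)); split=> //; rewrite mklE SubK subrr; exact: smod0.
have i2 : piso (mkl (@proj_linear R (submod Z) S)) setT S setT [set 0].
  split=> // [v _|w _]; first by rewrite mklE -(proj0P v sS).
  by exists (repr w); split=> //; rewrite mklE projK /= subrr.
have h1 := piso_dge n pS (And3 sZ sB BZ) i1.
have h2 := piso_dge n pS (pair_full (subquot Z B)) i2.
by rewrite -h1 h2.
Qed.

End Exact.

(** * Tensor products *)

Section Tensor.
Variable R : comNzRingType.

Lemma fglift_linear (K : choiceType) (W : lmodType R) (f : K -> W) :
  linear (fglift f : {freeg K / R} -> W).
Proof.
have add : additive (fglift f : {freeg K / R} -> W) by exact: lift_is_additive.
have add0 : fglift f (0 : {freeg K / R}) = 0.
  by have := add 0 0; rewrite !subrr.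
have addD D D' : fglift f (D + D' : {freeg K / R}) = fglift f D + fglift f D'.
  have addN E : fglift f (- E : {freeg K / R}) = - fglift f E.
    by have := add 0 E; rewrite !sub0r add0 sub0r.
  by have := add D (- D'); rewrite addN !opprK.
have addS (I : Type) (r : seq I) (F : I -> {freeg K / R}) :
    fglift f (\sum_(i <- r) F i) = \sum_(i <- r) fglift f (F i).
  by elim: r => [|i r IH]; rewrite ?big_nil ?big_cons ?addD ?IH.
move=> c D D'; rewrite addD; congr (_ + _).
rewrite -[X in _ = c *: fglift f X]freeg_sumE -[c *: D]/(fgscale c D) /fgscale.
rewrite !addS scaler_sumr.
by apply: eq_bigr => x _; rewrite !liftU scalerA.
Qed.

Section Lift.
Variables (M N W : lmodType R) (b : M -> N -> W).
Hypotheses (bl : forall y, linear (b^~ y)) (br : forall x, linear (b x)).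

Let fl : {linear {freeg (M * N)%type / R} -> W} :=
  mkl (@fglift_linear (M * N)%type W (fun z => b z.1 z.2)).

Let fl1 x y : fl << (x, y) >> = b x y.
Proof. by rewrite mklE liftU scale1r. Qed.

Let fl_ker : span_set (@bilinear_relations R M N) `<=` [set D | fl D = 0].
Proof.
apply: span_sub; first exact: smod_ker.
move=> D [] [a [x [x' [y ->]]]]; apply: (_ : fl _ = 0).
  rewrite !linearB [fl (a *: _)]linearZ_LR !fl1 (bl y a x x').
  by rewrite -addrA -opprD subrr.
rewrite !linearB [fl (a *: _)]linearZ_LR !fl1 (br x a x' y).
by rewrite -addrA -opprD subrr.
Qed.

Definition tlift_fun (t : tensor M N) : W := fglift (fun z => b z.1 z.2) (repr t).

Let tlift_proj D : tlift_fun (proj _ D) = fl D.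
Proof.
apply/eqP; rewrite -subr_eq0 -[tlift_fun _]/(fl _) -linearB; apply/eqP.
apply: fl_ker; apply/asboolP; rewrite -span_predE.
by apply/projP; rewrite projK.
Qed.

Lemma tlift_linear : linear tlift_fun.
Proof.
move=> a u v; rewrite -(projK u) -(projK v) -[a *: proj _ _ + _]proj_linear.
by rewrite !tlift_proj linearP.
Qed.

Definition tlift : {linear tensor M N -> W} := mkl tlift_linear.

Lemma tliftE x y : tlift (tens x y) = b x y.
Proof. by rewrite mklE tlift_proj fl1. Qed.

End Lift.

Section Pure.
Variables M N : lmodType R.

Lemma tens_relP (D : {freeg (M * N)%type / R}) :
  @bilinear_relations R M N D -> proj (@bilinear_relations R M N) D = 0.
Proof.
move=> BD; pose p := mkl (@proj_linear R _ (@bilinear_relations R M N)).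
rewrite -[LHS]/(p D) -(linear0 p); apply/projP; rewrite subr0; exact: mem_span.
Qed.

Lemma tens_linl y : linear (fun x : M => tens x y : tensor M N).
Proof.
move=> a x x'; pose p := mkl (@proj_linear R _ (@bilinear_relations R M N)).
have := @tens_relP _ (or_introl (ex_intro _ a (ex_intro _ x (ex_intro _ x' (ex_intro _ y erefl))))).
rewrite -[LHS]/(p _) !linearB => /eqP; rewrite subr_eq0 subr_eq => /eqP e.
by rewrite -[LHS]/(p _) e linearZ addrC.
Qed.

Lemma tens_linr x : linear (fun y : N => tens x y : tensor M N).
Proof.
move=> a y y'; pose p := mkl (@proj_linear R _ (@bilinear_relations R M N)).
have := @tens_relP _ (or_intror (ex_intro _ a (ex_intro _ x (ex_intro _ y (ex_intro _ y' erefl))))).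
rewrite -[LHS]/(p _) !linearB => /eqP; rewrite subr_eq0 subr_eq => /eqP e.
by rewrite -[LHS]/(p _) e linearZ addrC.
Qed.

Lemma tens_ind (P : tensor M N -> Prop) : P 0 ->
  (forall t u, P t -> P u -> P (t + u)) -> (forall x y, P (tens x y)) ->
  forall t, P t.
Proof.
move=> P0 PD P1 t; pose p := mkl (@proj_linear R _ (@bilinear_relations R M N)).
rewrite -(projK t) -(freeg_sumE (repr t)) -[proj _ _]/(p _) linear_sum.
apply: big_ind => // z _; set c := coeff _ _.
have -> : << c *g z >> = c *: << z >> :> {freeg (M * N)%type / R}.
  by apply/eqP/freeg_eqP => w; rewrite coeffZ !coeffU mul1r.
case: z c => x y c; have -> : p (c *: << (x, y) >>) = c *: tens x y by exact: linearZ.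
have -> : c *: tens x y = tens (c *: x) y by have := linearZ_LR (mkl (tens_linl y)) c x; rewrite mklE => ->.
exact: P1.
Qed.

Lemma tens_ext (W : lmodType R) (f g : {linear tensor M N -> W}) :
  (forall x y, f (tens x y) = g (tens x y)) -> f =1 g.
Proof.
move=> e; apply: tens_ind => [|t u et eu|//]; first by rewrite !linear0.
by rewrite !linearD et eu.
Qed.

End Pure.

Section Map.
Variable N : lmodType R.

Lemma tmap_bil (M M' : lmodType R) (f : {linear M -> M'}) y :
  linear (fun x => tens (f x) y : tensor M' N).
Proof. by move=> a x x'; rewrite linearP tens_linl. Qed.

Definition tmap (M M' : lmodType R) (f : {linear M -> M'}) :
    {linear tensor M N -> tensor M' N} :=
  tlift (tmap_bil f) (fun x => @tens_linr M' N (f x)).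

Lemma tmap_tens (M M' : lmodType R) (f : {linear M -> M'}) x y :
  tmap f (tens x y) = tens (f x) y.
Proof. exact: tliftE. Qed.

Lemma tmap_comp (M M' M'' : lmodType R) (f : {linear M -> M'}) (g : {linear M' -> M''})
    (h : {linear M -> M''}) :
  (forall x, h x = g (f x)) -> forall t, tmap h t = tmap g (tmap f t).
Proof.
move=> e t; rewrite -[RHS]/((tmap g \o tmap f) t); move: t; apply: tens_ext => x y.
by rewrite -[RHS]/(tmap g (tmap f (tens x y))) !tmap_tens e.
Qed.

Lemma tmap_id (M : lmodType R) (f : {linear M -> M}) :
  (forall x, f x = x) -> forall t, tmap f t = t.
Proof.
move=> e t; rewrite -[RHS]/((idfun : {linear _ -> _}) t); move: t.
by apply: tens_ext => x y; rewrite tmap_tens e.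
Qed.

Lemma tmap_add (M M' : lmodType R) (f g h : {linear M -> M'}) :
  (forall x, h x = f x + g x) -> forall t, tmap h t = tmap f t + tmap g t.
Proof.
move=> e t; rewrite -[RHS]/((tmap f \+ tmap g) t); move: t.
apply: tens_ext => x y; rewrite -[RHS]/(tmap f _ + tmap g _) !tmap_tens e.
exact: (linearD (mkl (tens_linl y))).
Qed.

Lemma tmap_zero (M M' : lmodType R) (f : {linear M -> M'}) :
  (forall x, f x = 0) -> forall t, tmap f t = 0.
Proof.
move=> e t; have e0 x : f x = f x + f x by rewrite !e addr0.
by apply: (addrI (tmap f t)); rewrite -(tmap_add e0) addr0.
Qed.

Lemma tmap_ext (M M' : lmodType R) (f g : {linear M -> M'}) :
  (forall x, f x = g x) -> forall t, tmap f t = tmap g t.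
Proof. by move=> e; apply: tens_ext => x y; rewrite !tmap_tens e. Qed.

Lemma tmap_opp (M M' : lmodType R) (f g : {linear M -> M'}) :
  (forall x, f x = - g x) -> forall t, tmap f t = - tmap g t.
Proof.
move=> e t; apply/eqP; rewrite -addr_eq0; apply/eqP.
rewrite -(tmap_add (h := \0)); first by exact: tmap_zero.
by move=> x; rewrite e addNr.
Qed.

Lemma tmap_surj (M M' : lmodType R) (f : {linear M -> M'}) :
  (forall y, exists x, y = f x) -> forall u, exists t, u = tmap f t.
Proof.
move=> sf; apply: tens_ind => [|_ _ [t ->] [u ->]|x y].
- by exists 0; rewrite linear0.
- by exists (t + u); rewrite linearD.
by have [z ->] := sf x; exists (tens z y); rewrite tmap_tens.
Qed.

End Map.
End Tensor.

Section TensorOps.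
Variables (R : comNzRingType) (M N : lmodType R).

Lemma tensBl (x x' : M) (y : N) : tens (x - x') y = tens x y - tens x' y.
Proof. exact: (linearB (mkl (@tens_linl R M N y))). Qed.

Lemma tensZr a (x : M) (y : N) : tens x (a *: y) = a *: tens x y.
Proof. exact: (linearZ_LR (mkl (@tens_linr R M N x))). Qed.

End TensorOps.

Section RightExact.
Variables (R : comNzRingType) (N : lmodType R).

(** Modulo the range of [d (x) N] the class of [x (x) y] depends on [g x] only,
    which inverts the map induced by [g (x) N]. *)
Lemma tmap_exact (Q P M : lmodType R) (d : {linear Q -> P}) (g : {linear P -> M}) :
  (forall y, exists x, y = g x) -> (forall x, g x = 0 <-> exists z, x = d z) ->
  forall t : tensor P N, tmap N g t = 0 <-> exists u, t = tmap N d u.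
Proof.
move=> sg eg t; split=> [|[u ->]]; last first.
  rewrite -(tmap_comp (h := \0)); first by apply: tmap_zero.
  by move=> x; symmetry; apply/eg; exists x.
have /choice[l lP] : forall y, exists x, y = g x by [].
pose C := range (tmap N d); have sC : submodule C by exact: smod_range.
pose p := mkl (@proj_linear R _ C).
have pd u : p (tmap N d u) = 0 by apply/(proj0P _ sC); exists u.
have wd x x' y : g x = g x' -> p (tens x y) = p (tens x' y).
  move=> e; have [z ze] : exists z, x - x' = d z by apply/eg; rewrite linearB e subrr.
  apply/eqP; rewrite -subr_eq0 -linearB; apply/eqP.
  by rewrite -tensBl ze -tmap_tens pd.
have bl y : linear (fun x => p (tens (l x) y)).
  move=> a x x'; rewrite -linearP -[X in _ = p X](@tens_linl _ P N y a (l x) (l x')).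
  by apply: wd; rewrite linearP -!lP.
have br x : linear (fun y => p (tens (l x) y)).
  by move=> a y y'; rewrite tens_linr linearP.
have e : tlift bl br \o tmap N g =1 p.
  apply: tens_ext => x y; rewrite -[LHS]/(tlift bl br (tmap N g _)) tmap_tens tliftE.
  by apply: wd; rewrite -lP.
move=> gt; have : p t = 0 by rewrite -e -[LHS]/(tlift bl br (tmap N g _)) gt linear0.
by move=> /(proj0P _ sC)[u _ <-]; exists u.
Qed.

End RightExact.

Section TensorRing.
Variables (R : comNzRingType).

Lemma tens1_linl (M : lmodType R) (r : R^o) : linear (fun x : M => (r : R) *: x).
Proof. by move=> a x y; rewrite scalerDr !scalerA mulrC. Qed.

Lemma tens1_linr (M : lmodType R) (x : M) : linear (fun r : R^o => (r : R) *: x).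
Proof. by move=> a r s; rewrite scalerDl scalerA. Qed.

(** The natural isomorphism from [M (x) R] to [M]. *)
Definition tens1 (M : lmodType R) : {linear tensor M R^o -> M} :=
  tlift (@tens1_linl M) (@tens1_linr M).

Lemma tens1E (M : lmodType R) x (r : R) : tens1 M (tens x (r : R^o)) = r *: x.
Proof. exact: tliftE. Qed.

Lemma tens1_nat (M M' : lmodType R) (f : {linear M -> M'}) t :
  tens1 M' (tmap R^o f t) = f (tens1 M t).
Proof.
rewrite -[RHS]/((f \o tens1 M) t) -[LHS]/((tens1 M' \o tmap R^o f) t); move: t.
apply: tens_ext => x r; rewrite -[LHS]/(tens1 M' (tmap R^o f _)) tmap_tens.
by rewrite -[RHS]/(f (tens1 M _)) !tens1E linearZ_LR.
Qed.

Lemma tens1K (M : lmodType R) t : tens (tens1 M t) (1 : R^o) = t.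
Proof.
pose h := mkl (@tens_linl R M R^o 1).
rewrite -[LHS]/((h \o tens1 M) t) -[RHS]/((idfun : {linear _ -> _}) t); move: t.
apply: tens_ext => x r; rewrite -[LHS]/(h (tens1 M _)) tens1E linearZ_LR mklE -tensZr.
by congr tens; exact: mulr1.
Qed.

End TensorRing.

Section TensorFree.
Variables (R : comNzRingType) (N : lmodType R).

Section Coord.
Variable b : nat.

Lemma coord_linl (y : N) : linear (fun (x : 'rV[R]_b) (i : 'I_b) => x 0 i *: y).
Proof.
by move=> a x x'; apply/funext => i; rewrite !mxE scalerDl -scalerA.
Qed.

Lemma coord_linr (x : 'rV[R]_b) : linear (fun (y : N) (i : 'I_b) => x 0 i *: y).
Proof.
move=> a y y'; apply/funext => i; rewrite -[RHS]/(a *: (_ *: _) + _).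
by rewrite scalerDr !scalerA mulrC.
Qed.

(** The isomorphism from [R^b (x) N] to [N^b]. *)
Definition tcoord : {linear tensor 'rV[R]_b N -> 'I_b -> N} := tlift coord_linl coord_linr.

Definition tuncoord (v : 'I_b -> N) : tensor 'rV[R]_b N :=
  \sum_i tens (delta_mx 0 i) (v i).

Lemma tuncoord_linear : linear tuncoord.
Proof.
move=> a u v; rewrite /tuncoord scaler_sumr -big_split /=; apply: eq_bigr => i _.
by rewrite -[(a *: u + v) i]/(a *: u i + v i) tens_linr.
Qed.

Lemma tcoordE x y i : tcoord (tens x y) i = x 0 i *: y.
Proof. by rewrite /tcoord tliftE. Qed.

Lemma tcoordK t : tuncoord (tcoord t) = t.
Proof.
rewrite -[LHS]/((mkl tuncoord_linear \o tcoord) t) -[RHS]/((idfun : {linear _ -> _}) t); move: t.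
apply: tens_ext => x y; rewrite -[LHS]/(tuncoord (tcoord _)) /tuncoord.
rewrite [in RHS](row_sum_delta x) -[RHS]/(mkl (@tens_linl R _ N y) _) linear_sum.
apply: eq_bigr => i _; by rewrite tcoordE linearZ_LR mklE tensZr.
Qed.

Lemma tuncoordK v : tcoord (tuncoord v) = v.
Proof.
apply/funext => j; rewrite /tuncoord linear_sum fct_sumE.
have E i : tcoord (tens (delta_mx 0 i) (v i)) j = (j == i)%:R *: v i.
  by rewrite tcoordE mxE eqxx.
under eq_bigr do rewrite E.
rewrite (bigD1 j) //= eqxx scale1r big1 ?addr0 // => i ij.
by rewrite eq_sym (negPf ij) scale0r.
Qed.

Lemma tcoord_inj t : tcoord t = 0 -> t = 0.
Proof.
by move=> e; rewrite -(tcoordK t) -(tcoordK 0) e linear0.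
Qed.

End Coord.

Lemma tcoord_tmap b c (f : {linear 'rV[R]_b -> 'rV[R]_c}) t j :
  tcoord c (tmap N f t) j = \sum_i f (delta_mx 0 i) 0 j *: tcoord b t i.
Proof.
rewrite -{1}(tcoordK t) /tuncoord !linear_sum fct_sumE; apply: eq_bigr => i _.
by rewrite tmap_tens tcoordE.
Qed.

Lemma noeth_tensor_free b : noeth N -> noeth (tensor 'rV[R]_b N).
Proof. by move=> nN; apply: (noeth_inj (f := tcoord b)); [exact: tcoord_inj|exact: noeth_pow]. Qed.

Lemma fg_cover (M : lmodType R) : fg_module M ->
  exists n (g : {linear 'rV[R]_n -> M}), forall y, exists x, y = g x.
Proof.
move=> [s sE].
have lg : linear (fun x : 'rV[R]_(size s) => rcomb (fun i : 'I_(size s) => s`_i) (x 0)).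
  move=> a x y; rewrite -rcomb_linear; congr rcomb.
  by apply/funext => i; rewrite !mxE.
exists (size s), (mkl lg) => y; have : [set: M] y by [].
rewrite -sE span_seqE => -[c _ <-]; exists (\row_i c i); rewrite mklE.
by congr rcomb; apply/funext => i; rewrite mxE.
Qed.

Lemma noeth_tensor (M : lmodType R) : fg_module M -> noeth N -> noeth (tensor M N).
Proof.
move=> /fg_cover[n [g sg]] /(@noeth_tensor_free n).
by apply: (noeth_surj (f := tmap N g)); exact: tmap_surj.
Qed.

End TensorFree.

(** * Maps of free modules tensored with a module *)

Section PowerDepth.
Variable R : comNzRingType.
Hypotheses (noethR : noetherian_ring R) (localR : local_ring R).
Local Notation mx := (max_ideal R).

Definition pow (V : lmodType R) b (A : set V) : set ('I_b -> V) :=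
  [set v | forall i, A (v i)].

Arguments pow {V} b A.

Section One.
Variables (V : lmodType R) (b : nat).
Implicit Types A U : set V.

Lemma pow_smod A : submodule A -> submodule (pow b A).
Proof.
move=> sA; split=> [i|a u v Au Av i]; first exact: smod0.
by rewrite -[(_ + _) i]/(a *: u i + v i); apply: sA.2.
Qed.

Lemma pow_pair A U : sqpair A U -> sqpair (pow b A) (pow b U).
Proof.
by move=> [sA sU UA]; split; [exact: pow_smod|exact: pow_smod|move=> v Uv i; apply: UA].
Qed.

Lemma pow_qmul a A U : qmul a (pow b A) (pow b U) = pow b (qmul a A U).
Proof.
apply/seteqP; split=> [w /qmulE[u [v [Uu Av ->]]] i|w Hw].
  by rewrite -[(_ + _) i]/(u i + a *: v i); apply: qmulI.
have /choice[u /choice[v uv]] : forall i, exists u, exists v, [/\ U u, A v & w i = u + a *: v].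
  by move=> i; apply: qmulE.
have -> : w = (u : 'I_b -> V) + a *: (v : 'I_b -> V).
  by apply/funext => i; have [_ _ ->] := uv i.
by apply: qmulI => i; have [] := uv i.
Qed.

Lemma pow_sqreg a A U : sqreg a A U -> sqreg a (pow b A) (pow b U).
Proof. by move=> ra v Av Uv i; apply: ra => //; exact: Uv. Qed.

Lemma pow_sqreg_inv a A U : (0 < b)%N -> submodule A ->
  sqreg a (pow b A) (pow b U) -> sqreg a A U.
Proof.
by case: b => // n _ sA ra v Av Uv; apply: (ra (fun=> v) _ _ ord0) => i.
Qed.

Lemma pow_dge n A U : dge n A U -> dge n (pow b A) (pow b U).
Proof.
elim: n U => // n IH U [a [ma ra /IH da]]; exists a; split=> //; first exact: pow_sqreg.
by rewrite pow_qmul.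
Qed.

Lemma pow_dge_inv n A U : (0 < b)%N -> submodule A ->
  dge n (pow b A) (pow b U) -> dge n A U.
Proof.
move=> b0 sA; elim: n U => // n IH U [a [ma ra da]]; exists a; split=> //.
  exact: pow_sqreg_inv ra.
by apply: IH; rewrite -pow_qmul.
Qed.

Lemma tensor_free_piso :
  piso (tcoord V b) [set: tensor 'rV[R]_b V] [set 0] (pow b setT) (pow b [set 0]).
Proof.
split=> // [v _|w _]; last first.
  by exists (tuncoord w); split=> // i; rewrite tuncoordK subrr.
split=> [e|-> i]; last by rewrite linear0.
by apply: tcoord_inj; apply/funext => i; exact: e.
Qed.

Lemma tensor_free_dge n : dge n [set: V] [set 0] ->
  dge n [set: tensor 'rV[R]_b V] [set 0].
Proof.
move=> d; apply/(piso_dge n _ _ tensor_free_piso); last exact: pow_dge.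
  exact: pair_full.
by apply: pow_pair; exact: pair_full.
Qed.

Lemma tensor_free_dge_inv n : (0 < b)%N -> dge n [set: tensor 'rV[R]_b V] [set 0] ->
  dge n [set: V] [set 0].
Proof.
move=> b0 /(piso_dge n _ _ tensor_free_piso) d.
apply: (pow_dge_inv b0) => //; apply: d; first exact: pair_full.
by apply: pow_pair; exact: pair_full.
Qed.

Lemma tensor_free_hasdep n : (0 < b)%N -> hasdep [set: V] [set 0] n ->
  hasdep [set: tensor 'rV[R]_b V] [set 0] n.
Proof.
move=> b0 [d nd]; split; first exact: tensor_free_dge.
by move=> /(tensor_free_dge_inv b0).
Qed.

End One.

Section MatrixAction.
Variables (b c : nat) (f : {linear 'rV[R]_b -> 'rV[R]_c}).

Lemma mact_linear (V : lmodType R) :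
  linear (fun (v : 'I_b -> V) (j : 'I_c) => \sum_i f (delta_mx 0 i) 0 j *: v i).
Proof.
move=> a u v; apply/funext => j.
rewrite -[RHS]/(a *: (\sum_i _) + \sum_i _) scaler_sumr -big_split /=.
apply: eq_bigr => i _; rewrite -[(a *: u + v) i]/(a *: u i + v i).
by rewrite scalerDr !scalerA mulrC.
Qed.

(** [f (x) V] in coordinates. *)
Definition mact (V : lmodType R) : {linear ('I_b -> V) -> 'I_c -> V} :=
  mkl (@mact_linear V).

Lemma mact_scale (V : lmodType R) (x : 'rV[R]_b) (v : V) :
  mact V (fun i => x 0 i *: v) = fun j => f x 0 j *: v.
Proof.
apply/funext => j; rewrite /mact mklE [in RHS](row_sum_delta x) linear_sum summxE.
rewrite scaler_suml; apply: eq_bigr => i _.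
by rewrite [f (_ *: _)]linearZ_LR mxE scalerA mulrC.
Qed.

(** If [N] has depth [s], the functor [Ext^s(k, -)] turns [f (x) N] into a sum
    of copies of [f (x) k].  Here it is injective, because the kernel [A0] of
    [f (x) N] has depth greater than [s] while its image and cokernel have
    depth at least [s]; so [f] is injective modulo the maximal ideal.  Killing
    a regular sequence reduces this to the socle, that is, to [s = 0]. *)
Lemma inj_mod_max s (V V0 V1 V2 : lmodType R) (A U : set V) (A0 U0 : set V0)
    (A1 U1 : set V1) (A2 U2 : set V2) (f0 : {linear V0 -> 'I_b -> V})
    (g1 : {linear ('I_b -> V) -> V1}) (h1 : {linear V1 -> 'I_c -> V})
    (g2 : {linear ('I_c -> V) -> V2}) :
  noeth V -> noeth V0 -> noeth V1 -> noeth V2 -> sqpair A U ->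
  pses f0 g1 A0 U0 (pow b A) (pow b U) A1 U1 ->
  pses h1 g2 A1 U1 (pow c A) (pow c U) A2 U2 ->
  (forall v, h1 (g1 v) = mact V v) ->
  hasdep A U s -> dge s.+1 A0 U0 -> dge s A1 U1 -> dge s A2 U2 ->
  forall x : 'rV[R]_b, (forall j, mx (f x 0 j)) -> forall i, mx (x 0 i).
Proof.
move=> nV n0 n1 n2 + + + hg; elim: s U U0 U1 U2 => [|s IH] U U0 U1 U2 pA S T [dA ndA] d0 d1 d2 x fx.
  have [sA sU UA] := pA.
  have [v [Av mv Uv]] : exists v, [/\ A v, forall r, mx r -> U (r *: v) & ~ U v].
    apply: contrapT => nv; apply: ndA.
    have sf : socfree A U.
      by move=> v Av mv; apply: contrapT => Uv; apply: nv; exists v.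
    have [a [ma ra]] := generic_ex localR (generic_sqreg noethR nV pA sf).
    by exists a.
  pose w := (fun i => x 0 i *: v) : 'I_b -> V.
  have Aw : pow b A w by move=> i; exact: smodZ.
  have [y [Ay Uy]] : exists y, A0 y /\ pow b U (w - f0 y).
    apply/(pses_mid S) => //; apply/(pses_inj T); first exact: (pses_g S).
    by rewrite hg mact_scale => j; apply: mv.
  have Uw : pow b U w.
    have sUb := pow_smod b sU.
    rewrite -(subrK (f0 y) w); apply: (smodD sUb) => //; apply/(pses_inj S) => //.
    have [sA0 _ _] := pses_p1 S.
    apply: (dge1_socfree d0) => // r mr; apply/(pses_inj S); first exact: smodZ.
    rewrite linearZ_LR (_ : r *: f0 y = r *: w - r *: (w - f0 y)); last first.
      by rewrite -scalerBr opprB addrC subrK.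
    apply: (smodB sUb); last exact: (smodZ _ sUb).
    by move=> i; rewrite -[(r *: w) i]/(r *: (x 0 i *: v)) scalerA; apply: mv; exact: maxiMr.
  move=> i; apply: contrapT => /(unit_mx noethR localR)[t tx]; apply: Uv.
  by rewrite -[v]scale1r -tx -scalerA; apply: smodZ => //; exact: Uw.
have gA := dgeS_generic noethR nV pA dA.
have g0 := dgeS_generic noethR n0 (pses_p1 S) d0.
have g1' := dgeS_generic noethR n1 (pses_p3 S) d1.
have g2' := dgeS_generic noethR n2 (pses_p3 T) d2.
have [a [ma [ra [r0 [r1 r2]]]]] := generic_ex localR (genericI gA (genericI g0 (genericI g1' g2'))).
have S' := pses_qmul S r1; have T' := pses_qmul T r2; rewrite !pow_qmul in S' T'.
apply: (IH _ _ _ _ (qmul_pair a pA) S' T') => //.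
- split; first exact: (dge_reg noethR localR nV pA ma ra dA).
  by move=> d; apply: ndA; exists a.
- exact: (dge_reg noethR localR n0 (pses_p1 S) ma r0 d0).
- exact: (dge_reg noethR localR n1 (pses_p3 S) ma r1 d1).
- exact: (dge_reg noethR localR n2 (pses_p3 T) ma r2 d2).
Qed.

End MatrixAction.

(** Gaussian elimination.  Given functionals dual to the images of the first
    [k] basis vectors, subtract from the next basis vector its components along
    the former; some coordinate of the image of the result is invertible, and it
    serves as the next functional after a correction. *)
Lemma split_mod_max b c (f : {linear 'rV[R]_b -> 'rV[R]_c}) :
  (forall x : 'rV[R]_b, (forall j, mx (f x 0 j)) -> forall i, mx (x 0 i)) ->
  exists g : {linear 'rV[R]_c -> 'rV[R]_b}, forall x, g (f x) = x.
Proof.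
move=> inj; pose e (i : 'I_b) := f (delta_mx 0 i).
suff [G GP] : exists G : 'I_b -> {linear 'rV[R]_c -> R^o},
    forall i j : 'I_b, G i (e j) = (i == j)%:R.
  have lg : linear (fun y => \row_i G i y : 'rV[R]_b).
    by move=> a x y; apply/rowP => i; rewrite !mxE linearP.
  exists (mkl lg) => x; rewrite mklE; apply/rowP => i; rewrite mxE.
  rewrite [in LHS](row_sum_delta x) !linear_sum (bigD1 i) //= big1 => [|j ji].
    by rewrite !linearZ_LR GP eqxx addr0; exact: mulr1.
  by rewrite !linearZ_LR GP eq_sym (negPf ji) scaler0.
suff H k : (k <= b)%N -> exists G : 'I_b -> {linear 'rV[R]_c -> R^o},
    forall i j : 'I_b, (i < k)%N -> (j < k)%N -> G i (e j) = (i == j)%:R.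
  by have [G GP] := H b (leqnn b); exists G => i j; apply: GP.
elim: k => [_|k IH lk]; first by exists (fun=> \0).
have [G GP] := IH (ltnW lk); pose m := Ordinal lk.
pose x : 'rV[R]_b := delta_mx 0 m - \sum_(i < b | (i < k)%N) (G i (e m) : R) *: delta_mx 0 i.
have [j nj] : exists j, ~ mx (f x 0 j).
  apply: contrapT => nj; apply: (maxi1 localR).
  have : mx (x 0 m) by apply: inj => j; apply: contrapT => nx; apply: nj; exists j.
  rewrite !mxE !eqxx summxE big1 ?subr0 // => i ik.
  by rewrite !mxE eqxx -val_eqE /= gtn_eqF ?mulr0.
have [t tj] := unit_mx noethR localR nj.
have lh : linear (fun y : 'rV[R]_c => t * y 0 j : R^o).
  by move=> a y z; rewrite !mxE mulrDr mulrCA.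
have Gx (i : 'I_b) : (i < k)%N -> G i (f x) = 0.
  move=> ik; rewrite /x linearB linear_sum linearB linear_sum (bigD1 i) //= big1.
    rewrite [f (_ *: _)]linearZ_LR [X in _ - (X + _)]linearZ_LR (GP i i) // eqxx addr0.
    by rewrite -[_ *: _]/(_ * _) mulr1 subrr.
  move=> l /andP[lk' li]; rewrite [f (_ *: _)]linearZ_LR [LHS]linearZ_LR (GP i l) //.
  by rewrite eq_sym (negPf li) scaler0.
pose h := mkl lh.
have lS : linear (fun y => \sum_(i < b | (i < k)%N) (h (e i) : R) *: G i y : R^o).
  move=> a y z; rewrite scaler_sumr -big_split /=; apply: eq_bigr => i _.
  by rewrite linearP scalerDr !scalerA mulrC.
pose h' : {linear 'rV[R]_c -> R^o} := h \- mkl lS.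
have h'E y : h' y = h y - \sum_(i < b | (i < k)%N) (h (e i) : R) *: G i y by [].
have h'0 (i : 'I_b) : (i < k)%N -> h' (e i) = 0.
  move=> ik; rewrite h'E (bigD1 i) //= big1.
    by rewrite (GP i i) // eqxx addr0 -[_ *: _]/(_ * _) mulr1 subrr.
  by move=> l /andP[lk' li]; rewrite (GP l i) // (negPf li) scaler0.
have h'1 : h' (e m) = 1.
  have -> : e m = f x + \sum_(i < b | (i < k)%N) (G i (e m) : R) *: e i.
    by rewrite /x linearB linear_sum; under eq_bigr do rewrite linearZ_LR; rewrite subrK.
  rewrite linearD linear_sum big1 ?addr0; last by move=> i ik; rewrite linearZ_LR h'0 ?scaler0.
  rewrite h'E big1 ?subr0 ?mklE // => i ik; by rewrite Gx ?scaler0.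
have lG (i : 'I_b) : linear (fun y => if i == m then h' y else G i y - (G i (e m) : R) *: h' y).
  move=> a y z; case: ifP => _; first by rewrite linearP.
  rewrite (linearP (G i)) (linearP h') [X in _ - X]scalerDr opprD addrACA.
  by rewrite [in RHS]scalerBr; congr (_ - _ + _); rewrite !scalerA; congr (_ *: _); exact: mulrC.
exists (fun i => mkl (lG i)) => i l; rewrite !ltnS => li ll; rewrite mklE.
have neqm (p : 'I_b) : p != m -> (p <= k)%N -> (p < k)%N.
  by move=> pm pk; rewrite ltn_neqAle pk andbT.
have [->|lm] := eqVneq l m.
  by case: eqVneq => [//|im]; rewrite h'1 -[_ *: _]/(_ * _) mulr1 subrr.
rewrite h'0 ?neqm // scaler0 subr0; case: eqVneq => [->|im]; first by rewrite eq_sym (negPf lm).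
by rewrite GP // neqm.
Qed.

End PowerDepth.

(** * Projective resolutions *)

Section Projective.
Variable R : comNzRingType.

Lemma free_projective b : projective ('rV[R]_b : lmodType R).
Proof.
move=> A B p f sp.
have /choice[a aP] (i : 'I_b) : exists a, p a = f (delta_mx 0 i).
  have : range p (f (delta_mx 0 i)) by rewrite sp.
  by case=> a _ e; exists a.
have lg : linear (fun x : 'rV[R]_b => \sum_i x 0 i *: a i).
  move=> c x y; rewrite scaler_sumr -big_split /=; apply: eq_bigr => i _.
  by rewrite !mxE scalerDl scalerA.
exists (mkl lg) => x; rewrite mklE [in RHS](row_sum_delta x) !linear_sum.
by apply: eq_bigr => i _; rewrite !linearZ_LR aP.
Qed.

Lemma pair_linear (A B C : lmodType R) (f : {linear A -> C}) (g : {linear B -> C}) :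
  linear (fun x : (A * B)%type => f x.1 + g x.2).
Proof. by move=> a x y; rewrite !linearP addrACA -scalerDr. Qed.

Lemma inl_linear (A B : lmodType R) : linear (fun x : A => (x, 0) : (A * B)%type).
Proof. by move=> a x y; congr pair; rewrite /= scaler0 addr0. Qed.

Lemma inr_linear (A B : lmodType R) : linear (fun y : B => (0, y) : (A * B)%type).
Proof. by move=> a x y; congr pair; rewrite /= scaler0 addr0. Qed.

Definition copair (A B C : lmodType R) (f : {linear A -> C}) (g : {linear B -> C}) :
  {linear (A * B)%type -> C} := mkl (pair_linear f g).

Definition inj1 (A B : lmodType R) : {linear A -> (A * B)%type} := mkl (@inl_linear A B).
Definition inj2 (A B : lmodType R) : {linear B -> (A * B)%type} := mkl (@inr_linear A B).

Lemma prod_projective (P Q : lmodType R) :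
  projective P -> projective Q -> projective (P * Q)%type.
Proof.
move=> pP pQ A B p f sp.
have [g1 e1] := pP _ _ p (f \o inj1 P Q) sp.
have [g2 e2] := pQ _ _ p (f \o inj2 P Q) sp.
exists (copair g1 g2) => -[x y]; rewrite mklE linearD e1 e2 -[LHS]/(f (x, 0) + f (0, y)).
by rewrite -linearD; congr (f (_, _)); rewrite /= ?addr0 ?add0r.
Qed.

Lemma fg_pair (A B : lmodType R) : noetherian_ring R ->
  fg_module A -> fg_module B -> fg_module (A * B)%type.
Proof.
move=> nR fA fB; apply: noeth_fg; apply: noeth_prod; exact: fg_noeth.
Qed.

Lemma fg_img (A B : lmodType R) (f : {linear A -> B}) : noetherian_ring R ->
  fg_module A -> (forall y, exists x, y = f x) -> fg_module B.
Proof. by move=> nR fA sf; apply: noeth_fg; apply: noeth_surj sf (fg_noeth nR fA). Qed.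

Lemma fg_sub (A B : lmodType R) (f : {linear A -> B}) : noetherian_ring R ->
  fg_module B -> (forall x, f x = 0 -> x = 0) -> fg_module A.
Proof. by move=> nR fB jf; apply: noeth_fg; apply: noeth_inj jf (fg_noeth nR fB). Qed.

Lemma free_fg b : fg_module ('rV[R]_b : lmodType R).
Proof.
exists [seq delta_mx 0 i | i <- enum 'I_b]; apply/seteqP; split=> // x _.
rewrite (row_sum_delta x); apply: smod_sum; first exact: submodule_span.
move=> i _; apply: (smodZ _ (submodule_span _)).
by apply: span_incl; apply/mapP; exists i; rewrite ?mem_enum.
Qed.

Lemma proj_lift (P A B : lmodType R) (g : {linear A -> B}) (f : {linear P -> B}) :
  projective P -> (forall x, exists a, f x = g a) ->
  exists h : {linear P -> A}, forall x, g (h x) = f x.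
Proof.
move=> pP fg; pose C := range g; have sC : submodule C by exact: smod_range.
have mg a : g a \in span_pred C by apply: mem_span; exists a.
have mf x : f x \in span_pred C by have [a ->] := fg x.
have lg : linear (fun a => Sub (g a) (mg a) : submod C).
  by move=> c a a'; apply: val_inj; rewrite val_submodP !SubK linearP.
have lf : linear (fun x => Sub (f x) (mf x) : submod C).
  by move=> c a a'; apply: val_inj; rewrite val_submodP !SubK linearP.
have [|h hP] := pP _ _ (mkl lg) (mkl lf).
  apply/seteqP; split=> // y _; have [a _ ya] := span_pred_id sC (valP y).
  by exists a => //; apply: val_inj; rewrite mklE SubK.
by exists h => x; have := congr1 val (hP x); rewrite !mklE !SubK.
Qed.

End Projective.

Section Resolutions.
Variable R : comNzRingType.

Record is_res (M : lmodType R) (F : nat -> lmodType R)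
    (d : forall i, {linear F i.+1 -> F i}) (e : {linear F 0 -> M}) : Prop := IsRes {
  res_proj : forall i, projective (F i);
  res_fg : forall i, fg_module (F i);
  res_aug : forall y, exists x, y = e x;
  res_ex0 : forall x, e x = 0 <-> exists z, x = d 0 z;
  res_exS : forall i x, d i x = 0 <-> exists z, x = d i.+1 z }.

Arguments res_proj {M F d e}.
Arguments res_fg {M F d e}.

Definition chain_map (F G : nat -> lmodType R) (dF : forall i, {linear F i.+1 -> F i})
    (dG : forall i, {linear G i.+1 -> G i}) (f : forall i, {linear F i -> G i}) : Prop :=
  forall i x, dG i (f i.+1 x) = f i (dF i x).

(** [f - g] is the boundary of the homotopy [h]. *)
Definition homotopic (F G : nat -> lmodType R) (dF : forall i, {linear F i.+1 -> F i})
    (dG : forall i, {linear G i.+1 -> G i}) (f g : forall i, {linear F i -> G i})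
    (h : forall i, {linear F i -> G i.+1}) : Prop :=
  (forall x, f 0 x = g 0 x + dG 0 (h 0 x)) /\
  forall i x, f i.+1 x = g i.+1 x + (dG i.+1 (h i.+1 x) + h i (dF i x)).

Section Compare.
Variables (M M' : lmodType R) (F G : nat -> lmodType R).
Variables (dF : forall i, {linear F i.+1 -> F i}) (dG : forall i, {linear G i.+1 -> G i}).
Variables (eF : {linear F 0 -> M}) (eG : {linear G 0 -> M'}).
Hypotheses (rF : is_res dF eF) (rG : is_res dG eG).

Lemma lift_chain (f : {linear M -> M'}) : exists phi : forall i, {linear F i -> G i},
  (forall x, eG (phi 0 x) = f (eF x)) /\ chain_map dF dG phi.
Proof.
have [|p0 e0] := proj_lift (g := eG) (f := f \o eF) (res_proj rF 0%N).
  by move=> x; exact: (res_aug rG (f (eF x))).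
pose S i := {p : {linear F i -> G i} | forall x, exists z, p (dF i x) = dG i z}.
have h0 x : exists z, p0 (dF 0 x) = dG 0 z.
  apply/(res_ex0 rG); rewrite e0 -[LHS]/(f (eF _)).
  by have -> : eF (dF 0 x) = 0; [apply/(res_ex0 rF); exists x|rewrite linear0].
pose Q i (p : S i) (p' : S i.+1) := forall x, dG i (sval p' x) = sval p (dF i x).
have step i (p : S i) : exists p', Q i p p'.
  case: p => p pP; have [|p' p'P] := proj_lift (g := dG i) (f := p \o dF i) (res_proj rF i.+1) => //.
  have h x : exists z, p' (dF i.+1 x) = dG i.+1 z.
    apply/(res_exS rG); rewrite p'P -[LHS]/(p (dF i _)).
    by have -> : dF i (dF i.+1 x) = 0; [apply/(res_exS rF); exists x|rewrite linear0].
  by exists (exist _ p' h).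
have [s [s0 sP]] := dep_choice (exist _ p0 h0 : S 0) step.
by exists (fun i => sval (s i)); split; [rewrite s0|exact: sP].
Qed.

Lemma homotopy_unique (f g : forall i, {linear F i -> G i}) :
  chain_map dF dG f -> chain_map dF dG g -> (forall x, eG (f 0 x) = eG (g 0 x)) ->
  exists h, homotopic dF dG f g h.
Proof.
move=> cf cg e0; pose D i : {linear F i -> G i} := f i \- g i.
have DE i x : D i x = f i x - g i x by [].
have cD i x : dG i (D i.+1 x) = D i (dF i x) by rewrite !DE linearB cf cg.
have [|h0 h0P] := proj_lift (g := dG 0) (f := D 0) (res_proj rF 0%N).
  by move=> x; apply/(res_ex0 rG); rewrite DE linearB e0 subrr.
pose S i := {h : {linear F i -> G i.+1} | forall x, dG i (h (dF i x)) = D i (dF i x)}.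
have H0 x : dG 0 (h0 (dF 0 x)) = D 0 (dF 0 x) by rewrite h0P.
pose Q i (h : S i) (h' : S i.+1) := forall x, dG i.+1 (sval h' x) = D i.+1 x - sval h (dF i x).
have step i (h : S i) : exists h', Q i h h'.
  case: h => h hP.
  have [|h' h'P] := proj_lift (g := dG i.+1) (f := D i.+1 \- (h \o dF i)) (res_proj rF i.+1).
    move=> x; apply/(res_exS rG); rewrite -[X in dG i X]/(D i.+1 x - h (dF i x)).
    by rewrite linearB cD hP subrr.
  have H x : dG i.+1 (h' (dF i.+1 x)) = D i.+1 (dF i.+1 x).
    rewrite h'P -[LHS]/(D i.+1 _ - h (dF i (dF i.+1 x))).
    by have -> : dF i (dF i.+1 x) = 0; [apply/(res_exS rF); exists x|rewrite linear0 subr0].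
  by exists (exist _ h' H).
have [s [s0 sP]] := dep_choice (exist _ h0 H0 : S 0) step.
exists (fun i => sval (s i)); split=> [x|i x].
  by rewrite s0 /= h0P DE addrC subrK.
by rewrite sP subrK DE addrC subrK.
Qed.

End Compare.

Lemma compare_res (M : lmodType R) (F G : nat -> lmodType R)
    (dF : forall i, {linear F i.+1 -> F i}) (dG : forall i, {linear G i.+1 -> G i})
    (eF : {linear F 0 -> M}) (eG : {linear G 0 -> M}) :
  is_res dF eF -> is_res dG eG ->
  exists (f : forall i, {linear F i -> G i}) (g : forall i, {linear G i -> F i}) h k,
    [/\ chain_map dF dG f, chain_map dG dF g,
        homotopic dF dF (fun i => idfun) (fun i => g i \o f i) h &
        homotopic dG dG (fun i => idfun) (fun i => f i \o g i) k].
Proof.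
move=> rF rG; have [f [f0 cf]] := lift_chain rF rG idfun.
have [g [g0 cg]] := lift_chain rG rF idfun.
have [|||h hP] := homotopy_unique rF rF (f := fun i => idfun) (g := fun i => g i \o f i).
- by move=> i x.
- by move=> i x; rewrite -[LHS]/(dF i (g i.+1 (f i.+1 x))) cg cf.
- by move=> x; rewrite -[RHS]/(eF (g 0 (f 0 x))) g0 -[RHS]/(eG _) f0.
have [|||k kP] := homotopy_unique rG rG (f := fun i => idfun) (g := fun i => f i \o g i).
- by move=> i x.
- by move=> i x; rewrite -[LHS]/(dG i (f i.+1 (g i.+1 x))) cf cg.
- by move=> x; rewrite -[RHS]/(eG (f 0 (g 0 x))) f0 -[RHS]/(eF _) g0.
by exists f, g, h, k.
Qed.

End Resolutions.

Section MinimalResolution.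
Variables (R : comNzRingType).
Hypotheses (noethR : noetherian_ring R) (localR : local_ring R).
Local Notation mx := (max_ideal R).

Lemma min_gensP (V : lmodType R) (S : set V) : fin_gen S -> minimal_gens S (min_gens S).
Proof.
move=> [s sS]; apply: xgetPex; apply: contrapT => nm.
have H n : forall t : seq V, span_set [set` t] = S -> (n <= size t)%N.
  elim: n => // n IH t tS; rewrite ltn_neqAle IH // andbT; apply/eqP => e.
  by apply: nm; exists t; split=> // u uS; rewrite -e; apply: IH.
by have := H (size s).+1 s sS; rewrite ltnn.
Qed.

(** A relation with an invertible coefficient would make one of the generators
    superfluous. *)
Lemma min_gens_relation (V : lmodType R) (S : set V) : fin_gen S ->
  forall c : 'rV[R]_(size (min_gens S)), relations (min_gens S) c -> forall i, mx (c 0 i).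
Proof.
move=> /min_gensP[]; set s := min_gens S => sS smin c rc i.
apply: contrapT => /(unit_mx noethR localR)[u uc].
pose t := [seq s`_(j : 'I_(size s)) | j <- rem i (enum 'I_(size s))].
have mt (j : 'I_(size s)) : j != i -> s`_j \in t.
  move=> ji; apply: (map_f (fun j : 'I_(size s) => s`_j)).
  by rewrite mem_rem_uniq ?enum_uniq // inE ji mem_enum.
have st : span_set [set` t] = S.
  rewrite -sS; apply/seteqP; split.
    by apply: span_setS => v /= /mapP[j _ ->]; exact: mem_nth.
  apply: span_sub; first exact: submodule_span.
  move=> v /= vs; have lt : (index v s < size s)%N by rewrite index_mem.
  have ve : v = s`_(Ordinal lt) by rewrite nth_index.
  have [e|ne] := eqVneq (Ordinal lt) i; last by apply: span_incl; rewrite ve; exact: mt.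
  have -> : v = - \sum_(j | j != i) (u * c 0 j) *: s`_j.
    rewrite ve e; apply/eqP; rewrite -addr_eq0 -[s`_i]scale1r -uc.
    have rc' : \sum_(j < size s) c 0 j *: s`_j = 0 by [].
    have : \sum_(j < size s) (u * c 0 j) *: s`_j = 0.
      by under eq_bigr do rewrite -scalerA; rewrite -scaler_sumr rc' scaler0.
    by rewrite (bigD1 i) //= => ->.
  apply: (smodN (submodule_span _)); apply: smod_sum; first exact: submodule_span.
  move=> j ji; apply: (smodZ _ (submodule_span _)).
  by apply: span_incl; exact: mt.
have := smin _ st; rewrite size_map size_rem ?mem_enum // size_enum_ord.
have s0 : (0 < size s)%N by exact: leq_ltn_trans (ltn_ord i).
by rewrite -ltnS prednK // ltnn.
Qed.

Variables (M : lmodType R).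
Hypothesis fgM : fg_module M.

Lemma relations_smod (V : lmodType R) (s : seq V) : submodule (relations s).
Proof.
split; first by rewrite /relations /= big1 // => i _; rewrite mxE scale0r.
move=> a c c'; rewrite /relations /= => e e'.
under eq_bigr do rewrite !mxE scalerDl -scalerA.
by rewrite big_split /= -scaler_sumr e e' scaler0 addr0.
Qed.

Lemma res_kernel_smod n : submodule (res_kernel M n).
Proof. by case: n => [|n]; exact: relations_smod. Qed.

Lemma free_noeth b : noeth ('rV[R]_b : lmodType R).
Proof. exact: fg_noeth (@free_fg R b). Qed.

Lemma res_kernel_fg n : fin_gen (res_kernel M n).
Proof. apply: noeth_fin_gen; [exact: free_noeth|exact: res_kernel_smod]. Qed.

Lemma res_diff_linear n : linear (@res_diff R M n).
Proof.
move=> a c c'; rewrite /res_diff scaler_sumr -big_split /=.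
by apply: eq_bigr => i _; rewrite !mxE scalerDl scalerA.
Qed.

Definition mdiff n : {linear free_mod M n.+1 -> free_mod M n} := mkl (@res_diff_linear n).

Lemma maug_linear :
  linear (fun c : free_mod M 0 => \sum_(i < betti M 0) c 0 i *: (min_gens [set: M])`_i).
Proof.
move=> a c c'; rewrite scaler_sumr -big_split /=.
by apply: eq_bigr => i _; rewrite !mxE scalerDl scalerA.
Qed.

Definition maug : {linear free_mod M 0 -> M} := mkl maug_linear.

Lemma mdiff_range n x : (exists z, x = mdiff n z) <-> res_kernel M n x.
Proof.
have [+ _] := min_gensP (res_kernel_fg n); rewrite span_seqE => E; split.
  move=> [z ->]; rewrite -E; exists (z 0) => //.
by rewrite -{1}E => -[c _ <-]; exists (\row_i c i); apply: eq_bigr => i _; rewrite mxE.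
Qed.

Lemma mres_is_res : is_res mdiff maug.
Proof.
split.
- move=> i; exact: free_projective.
- move=> i; exact: free_fg.
- move=> y; have [+ _] := min_gensP fgM; rewrite span_seqE => E.
  have : [set: M] y by []; rewrite -{1}E => -[c _ <-]; exists (\row_i c i).
  by apply: eq_bigr => i _; rewrite mxE.
- by move=> x; rewrite mdiff_range.
- by move=> i x; rewrite mdiff_range.
Qed.

Lemma mdiff_minimal n x j : mx (mdiff n x 0 j).
Proof.
have : res_kernel M n (mdiff n x) by apply/mdiff_range; exists x.
case: n x j => [|n] x j h; first exact: (min_gens_relation fgM h j).
exact: (min_gens_relation (res_kernel_fg n) h j).
Qed.

End MinimalResolution.

(** * Homology of a resolution tensored with a module *)

Arguments res_proj {R M F d e}.
Arguments res_fg {R M F d e}.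

Section Homology.
Variables (R : comNzRingType) (N : lmodType R).
Local Notation T := (tmap N).

Lemma tcomp (M M' M'' : lmodType R) (f : {linear M -> M'}) (g : {linear M' -> M''}) t :
  T (g \o f) t = T g (T f t).
Proof. exact: tmap_comp. Qed.

Section Cycles.
Variables (F : nat -> lmodType R) (d : forall i, {linear F i.+1 -> F i}).

Definition HZ (n : nat) : set (tensor (F n) N) :=
  match n with 0 => setT | n'.+1 => [set t | T (d n') t = 0] end.

Definition HB (n : nat) : set (tensor (F n) N) := range (T (d n)).

Arguments HZ n _ : clear implicits.
Arguments HB n _ : clear implicits.

Definition Hvan n : Prop := HZ n `<=` HB n.

Lemma HZP n t : HZ n.+1 t <-> T (d n) t = 0. Proof. by []. Qed.

Lemma HBI n u : HB n (T (d n) u). Proof. by exists u. Qed.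

Lemma HZ_smod n : submodule (HZ n).
Proof. by case: n => [|n]; [exact: smodT|exact: smod_ker]. Qed.

Lemma HB_smod n : submodule (HB n). Proof. exact: smod_range. Qed.

Lemma H_pair n : (forall i x, d i (d i.+1 x) = 0) -> sqpair (HZ n) (HB n).
Proof.
move=> dd; split; [exact: HZ_smod|exact: HB_smod|].
case: n => [|n] // _ [u _ <-]; apply/HZP; rewrite -tcomp; apply: tmap_zero => x.
exact: dd.
Qed.

End Cycles.

Arguments HZ {F} d n _.
Arguments HB {F} d n _.
Arguments Hvan {F} d n.

Lemma res_cplx (M : lmodType R) (F : nat -> lmodType R) (d : forall i, {linear F i.+1 -> F i})
  (e : {linear F 0 -> M}) : is_res d e -> forall i x, d i (d i.+1 x) = 0.
Proof. by move=> r i x; apply/(res_exS r); exists x. Qed.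

Lemma res_pair (M : lmodType R) (F : nat -> lmodType R) (d : forall i, {linear F i.+1 -> F i})
  (e : {linear F 0 -> M}) n : is_res d e -> sqpair (HZ d n) (HB d n).
Proof. by move=> r; apply: H_pair; exact: res_cplx r. Qed.

Section Independence.
Variables (F G : nat -> lmodType R).
Variables (dF : forall i, {linear F i.+1 -> F i}) (dG : forall i, {linear G i.+1 -> G i}).

Lemma tmap_chain (f : forall i, {linear F i -> G i}) : chain_map dF dG f ->
  forall i t, T (dG i) (T (f i.+1) t) = T (f i) (T (dF i) t).
Proof.
by move=> cf i t; rewrite -!tcomp; apply: tmap_ext => x; exact: cf.
Qed.

Lemma chain_HZ (f : forall i, {linear F i -> G i}) : chain_map dF dG f ->
  forall n t, HZ dF n t -> HZ dG n (T (f n) t).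
Proof.
move=> cf [|n] t // /HZP e; apply/HZP.
by rewrite tmap_chain // e linear0.
Qed.

Lemma chain_HB (f : forall i, {linear F i -> G i}) : chain_map dF dG f ->
  forall n t, HB dF n t -> HB dG n (T (f n) t).
Proof. by move=> cf n _ [u _ <-]; rewrite -tmap_chain //; exact: HBI. Qed.

End Independence.

Lemma homotopic_HB (F G : nat -> lmodType R)
    (dF : forall i, {linear F i.+1 -> F i}) (dG : forall i, {linear G i.+1 -> G i})
    (f : forall i, {linear F i -> G i}) (g : forall i, {linear G i -> F i}) h :
  homotopic dF dF (fun i => idfun) (fun i => g i \o f i) h ->
  forall n t, HZ dF n t -> HB dF n (t - T (g n) (T (f n) t)).
Proof.
move=> [h0 hS] [|n] t Zt.
  exists (T (h 0%N) t) => //; apply/eqP; rewrite eq_sym subr_eq; apply/eqP.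
  rewrite -!tcomp -[LHS](tmap_id (f := idfun)) // addrC.
  by apply: tmap_add => x; exact: h0.
exists (T (h n.+1) t) => //; apply/eqP; rewrite eq_sym subr_eq; apply/eqP.
have e0 : T (h n) (T (dF n) t) = 0 by rewrite (iffLR (HZP _ _) Zt) linear0.
rewrite -[T (dF n.+1) _]addr0 -{1}e0 -!tcomp -[LHS](tmap_id (f := idfun)) // addrC.
rewrite -(tmap_add (h := (dF n.+1 \o h n.+1) \+ (h n \o dF n))) //.
by apply: tmap_add => x; exact: hS.
Qed.

(** Chain maps between two resolutions that are inverse to each other up to
    homotopy remain so after tensoring. *)
Lemma res_indep (M : lmodType R) (F G : nat -> lmodType R)
    (dF : forall i, {linear F i.+1 -> F i}) (dG : forall i, {linear G i.+1 -> G i})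
    (eF : {linear F 0 -> M}) (eG : {linear G 0 -> M}) :
  is_res dF eF -> is_res dG eG -> forall n,
  exists f : {linear tensor (F n) N -> tensor (G n) N},
    piso f (HZ dF n) (HB dF n) (HZ dG n) (HB dG n).
Proof.
move=> rF rG n; have [f [g [h [k [cf cg hF hG]]]]] := compare_res rF rG.
exists (T (f n)); split.
- exact: chain_HZ.
- move=> t Zt; split; last exact: chain_HB.
  move=> Bt; rewrite -(subrK (T (g n) (T (f n) t)) t).
  by apply: (smodD (HB_smod _ _)); [exact: homotopic_HB hF _ _ Zt|exact: chain_HB].
move=> t Zt; exists (T (g n) t); split; first exact: chain_HZ.
exact: homotopic_HB hG _ _ Zt.
Qed.

Section IndepCor.
Variables (M : lmodType R) (F G : nat -> lmodType R).
Variables (dF : forall i, {linear F i.+1 -> F i}) (dG : forall i, {linear G i.+1 -> G i}).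
Variables (eF : {linear F 0 -> M}) (eG : {linear G 0 -> M}).
Hypotheses (rF : is_res dF eF) (rG : is_res dG eG).

Lemma Hvan_indep n : Hvan dF n -> Hvan dG n.
Proof.
have [f fi] := res_indep rF rG n; move=> v t Zt.
have [u [Zu Bu]] := piso_surj fi Zt.
rewrite -(subrK (f u) t); apply: (smodD (HB_smod _ _)) => //.
by apply/(piso_inj fi) => //; exact: v.
Qed.

Lemma dge_indep n k : dge k (HZ dF n) (HB dF n) -> dge k (HZ dG n) (HB dG n).
Proof.
have [f fi] := res_indep rF rG n.
by move/(piso_dge k (res_pair n rF) (res_pair n rG) fi).
Qed.

End IndepCor.

Lemma hasdep_indep (M : lmodType R) (F G : nat -> lmodType R)
    (dF : forall i, {linear F i.+1 -> F i}) (dG : forall i, {linear G i.+1 -> G i})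
    (eF : {linear F 0 -> M}) (eG : {linear G 0 -> M}) n k :
  is_res dF eF -> is_res dG eG ->
  hasdep (HZ dF n) (HB dF n) k -> hasdep (HZ dG n) (HB dG n) k.
Proof.
move=> rF rG [d nd]; split; first exact: (dge_indep rF rG d).
by move/(dge_indep rG rF).
Qed.

End Homology.

Arguments HZ {R} N {F} d n _.
Arguments HB {R} N {F} d n _.
Arguments Hvan {R} N {F} d n.

(** * Short exact sequences *)

Record short_exact (R : comNzRingType) (A B C : lmodType R) (i : {linear A -> B})
    (p : {linear B -> C}) : Prop := ShortExact {
  se_inj : forall x, i x = 0 -> x = 0;
  se_mid : forall y, p y = 0 <-> exists x, y = i x;
  se_surj : forall z, exists y, z = p y }.

Section Shift.
Variables (R : comNzRingType) (M : lmodType R) (F : nat -> lmodType R).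
Variables (d : forall i, {linear F i.+1 -> F i}) (e : {linear F 0 -> M}).
Hypothesis r : is_res d e.

Lemma shift_res n (C : lmodType R) (q : {linear F n -> C}) :
  (forall y, exists x, y = q x) -> (forall x, q x = 0 <-> exists z, x = d n z) ->
  @is_res R C (fun i => F (i + n)) (fun i => d (i + n)) q.
Proof.
move=> sq eq; split=> // [i|i|i x]; [exact: res_proj r _|exact: res_fg r _|].
exact: (res_exS r).
Qed.

Definition consF (P : lmodType R) (i : nat) : lmodType R := if i is j.+1 then F j else P.

Definition consd (P : lmodType R) (j : {linear M -> P}) (i : nat) :
    {linear consF P i.+1 -> consF P i} :=
  match i return {linear consF P i.+1 -> consF P i} with
  | 0 => j \o e | k.+1 => d k end.

Lemma cons_res (P C : lmodType R) (j : {linear M -> P}) (p : {linear P -> C}) :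
  projective P -> fg_module P -> short_exact j p -> @is_res R C (consF P) (consd j) p.
Proof.
move=> pP fP [ij ex sp]; split=> //.
- by case=> // i; exact: res_proj r _.
- by case=> // i; exact: res_fg r _.
- move=> x; rewrite ex; split=> -[y ->].
    by have [z ->] := res_aug r y; exists z.
  by exists (e y).
case=> [x|i x]; last exact: (res_exS r).
rewrite -(res_ex0 r); split=> [/ij//|/= ex0].
by rewrite -[LHS]/(j (e x)) ex0 linear0.
Qed.

End Shift.

Section Horseshoe.
Variables (R : comNzRingType) (A B C : lmodType R) (i : {linear A -> B}) (p : {linear B -> C}).
Hypothesis se : short_exact i p.
Variables (F G : nat -> lmodType R).
Variables (dF : forall i, {linear F i.+1 -> F i}) (dG : forall i, {linear G i.+1 -> G i}).
Variables (eF : {linear F 0 -> A}) (eG : {linear G 0 -> C}).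
Hypotheses (rF : is_res dF eF) (rG : is_res dG eG).
Hypothesis noethR : noetherian_ring R.

Definition prodF (n : nat) : lmodType R := (F n * G n)%type.

(** The resolution of [B] has the terms [F_n * G_n]; the component [theta] of
    its differential is lifted degree by degree. *)
Section Diff.
Variables (theta : forall n, {linear G n.+1 -> F n}).

Lemma hdiff_linear n :
  linear (fun y : prodF n.+1 => (dF n y.1 + theta n y.2, dG n y.2) : prodF n).
Proof.
by move=> a x y; congr pair; rewrite !linearP // addrACA -scalerDr.
Qed.

Definition hdiff n : {linear prodF n.+1 -> prodF n} := mkl (@hdiff_linear n).

End Diff.

Lemma horseshoe : exists theta (e : {linear prodF 0 -> B}), is_res (hdiff theta) e.
Proof.
have [|s sP] := proj_lift (g := p) (f := eG) (res_proj rG 0%N).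
  by move=> x; exact: (se_surj se).
have [|t0 t0P] := proj_lift (g := i \o eF) (f := \- (s \o dG 0%N)) (res_proj rG 1%N).
  move=> x; have [|a ae] := (se_mid se (- s (dG 0%N x))).1.
    by rewrite linearN sP; have -> : eG (dG 0%N x) = 0; [apply/(res_ex0 rG); exists x|rewrite oppr0].
  by have [y ye] := res_aug rF a; exists y; rewrite -[LHS]/(- s (dG 0%N x)) ae ye.
have t0E x : i (eF (t0 x)) = - s (dG 0%N x) by exact: t0P.
have dGdG n x : dG n (dG n.+1 x) = 0 by exact: (res_cplx rG).
pose S n := {t : {linear G n.+1 -> F n} | forall z, exists x, t (dG n.+1 z) = dF n x}.
have h0 z : exists x, t0 (dG 1%N z) = dF 0%N x.
  by apply/(res_ex0 rF); apply: (se_inj se); rewrite t0E dGdG linear0 oppr0.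
pose Q n (t : S n) (t' : S n.+1) := forall z, dF n (sval t' z) = - sval t (dG n.+1 z).
have step n (t : S n) : exists t', Q n t t'.
  case: t => t tP.
  have [|t' t'P] := proj_lift (g := dF n) (f := \- (t \o dG n.+1)) (res_proj rG n.+2).
    move=> x; have [y ye] := tP x; exists (- y).
    by rewrite linearN -ye.
  have H z : exists x, t' (dG n.+2 z) = dF n.+1 x.
    by apply/(res_exS rF); rewrite t'P -[LHS]/(- t (dG n.+1 _)) dGdG linear0 oppr0.
  by exists (exist _ t' H).
have [th [th0 thP]] := dep_choice (exist _ t0 h0 : S 0%N) step.
exists (fun n => sval (th n)), (copair (i \o eF) s); split.
- by move=> n; apply: prod_projective; [exact: res_proj rF _|exact: res_proj rG _].
- by move=> n; apply: fg_pair => //; [exact: res_fg rF _|exact: res_fg rG _].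
- move=> b; have [z ze] := res_aug rG (p b).
  have [|a ae] := (se_mid se (b - s z)).1; first by rewrite linearB sP ze subrr.
  have [x xe] := res_aug rF a; exists (x, z); rewrite mklE /=.
  by rewrite -xe -ae subrK.
- move=> [x z]; rewrite mklE /=; split.
    move=> e0; have /(res_ex0 rG)[z' ze] : eG z = 0.
      have ip a : p (i a) = 0 by apply/(se_mid se); exists a.
      by rewrite -sP -[LHS]add0r -(ip (eF x)) -linearD e0 linear0.
    have /(res_ex0 rF)[x' xe] : eF (x - t0 z') = 0.
      by apply: (se_inj se); rewrite linearB linearB t0E opprK -ze.
    by exists (x', z'); rewrite /= th0 /= -xe -ze subrK.
  move=> [[x' z']]; rewrite /= th0 /= => -[-> ->].
  rewrite [eF _]linearD [i (_ + _)]linearD t0E subrK.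
  have -> : eF (dF 0%N x') = 0 by apply/(res_ex0 rF); exists x'.
  exact: linear0.
move=> n [x z]; rewrite mklE /=; split.
  move=> [e1 /(res_exS rG)[z' ze]].
  have /(res_exS rF)[x' xe] : dF n (x - sval (th n.+1) z') = 0.
    by rewrite linearB thP opprK -ze.
  by exists (x', z'); rewrite /= -xe -ze subrK.
move=> [[x' z']] /= [-> ->]; congr pair; last exact: dGdG.
rewrite linearD thP (res_cplx rF) add0r addNr //.
Qed.

End Horseshoe.

Section LongExact.
Variables (R : comNzRingType) (N : lmodType R) (F G : nat -> lmodType R).
Local Notation T := (tmap N).
Variables (dF : forall i, {linear F i.+1 -> F i}) (dG : forall i, {linear G i.+1 -> G i}).
Variables (theta : forall n, {linear G n.+1 -> F n}).
Let B := prodF F G.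
Let dB : forall n, {linear B n.+1 -> B n} := hdiff dF dG theta.
Hypothesis ddF : forall i x, dF i (dF i.+1 x) = 0.
Hypothesis ddG : forall i x, dG i (dG i.+1 x) = 0.
Hypothesis ddB : forall i x, dB i (dB i.+1 x) = 0.

Let dth n z : dF n (theta n.+1 z) = - theta n (dG n.+1 z).
Proof.
have := congr1 fst (@ddB n (0, z)); rewrite /dB /hdiff !mklE /= linear0 add0r => e.
by apply/eqP; rewrite -addr_eq0; apply/eqP.
Qed.

Let prx n : {linear B n -> F n} := fst.
Let prz n : {linear B n -> G n} := snd.
Let inx n : {linear F n -> B n} := inj1 (F n) (G n).
Let inz n : {linear G n -> B n} := inj2 (F n) (G n).

Let Tprx_inx n t : T (prx n) (T (inx n) t) = t.
Proof. by rewrite -tcomp; exact: tmap_id. Qed.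
Let Tprz_inz n t : T (prz n) (T (inz n) t) = t.
Proof. by rewrite -tcomp; exact: tmap_id. Qed.
Let Tprx_inz n t : T (prx n) (T (inz n) t) = 0.
Proof. by rewrite -tcomp; exact: tmap_zero. Qed.
Let Tprz_inx n t : T (prz n) (T (inx n) t) = 0.
Proof. by rewrite -tcomp; exact: tmap_zero. Qed.

Let Tsplit n t : t = T (inx n) (T (prx n) t) + T (inz n) (T (prz n) t).
Proof.
rewrite -!tcomp -[LHS](tmap_id (f := idfun)) //; apply: tmap_add => -[x z].
by congr pair; rewrite /= ?addr0 ?add0r.
Qed.

Let Teq n t u : T (prx n) t = T (prx n) u -> T (prz n) t = T (prz n) u -> t = u.
Proof. by move=> ex ez; rewrite (Tsplit t) ex ez -Tsplit. Qed.

Let Tdx n t : T (prx n) (T (dB n) t) = T (dF n) (T (prx _) t) + T (theta n) (T (prz _) t).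
Proof.
by rewrite -!tcomp; exact: tmap_add.
Qed.

Let Tdz n t : T (prz n) (T (dB n) t) = T (dG n) (T (prz _) t).
Proof.
by rewrite -!tcomp; exact: tmap_ext.
Qed.

Let Tdth n t : T (dF n) (T (theta n.+1) t) = - T (theta n) (T (dG n.+1) t).
Proof.
by rewrite -!tcomp; apply: tmap_opp; exact: dth.
Qed.

Let HB_prod n t : HB N dB n t <-> exists x z,
  T (prx n) t = T (dF n) x + T (theta n) z /\ T (prz n) t = T (dG n) z.
Proof.
split=> [[u _ <-]|[x [z [ex ez]]]].
  by exists (T (prx _) u), (T (prz _) u); rewrite Tdx Tdz.
pose u := T (inx _) x + T (inz _) z.
have ux : T (prx _) u = x by rewrite linearD Tprx_inx Tprx_inz addr0.
have uz : T (prz _) u = z by rewrite linearD Tprz_inx Tprz_inz add0r.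
by exists u => //; apply: Teq; rewrite ?Tdx ?Tdz ?ux ?uz ?ex ?ez.
Qed.

Let inx_HZ n t : HZ N dF n t -> HZ N dB n (T (inx n) t).
Proof.
case: n t => [|n] t // /HZP Zt; apply/HZP; apply: Teq; rewrite ?Tdx ?Tdz Tprz_inx ?Tprx_inx ?Zt !linear0 ?addr0 //.
Qed.

Let prz_HZ n t : HZ N dB n t -> HZ N dG n (T (prz n) t).
Proof. by case: n t => [|n] t // /HZP Zt; apply/HZP; rewrite -Tdz Zt linear0. Qed.

Let inx_HB n t : HB N dF n t -> HB N dB n (T (inx n) t).
Proof.
move=> [u _ <-]; apply/HB_prod; exists u, 0.
by rewrite Tprx_inx Tprz_inx !linear0 addr0.
Qed.

Lemma les_inj n : Hvan N dG n.+1 ->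
  forall t, HB N dB n (T (inx n) t) -> HB N dF n t.
Proof.
move=> vG t /HB_prod[x [z]]; rewrite Tprx_inx Tprz_inx => -[-> /esym/vG[w _ <-]].
exists (x - T (theta n.+1) w) => //.
by rewrite linearB Tdth opprK.
Qed.

Let les_mid n t : HZ N dB n t -> HB N dG n (T (prz n) t) ->
  exists x, HZ N dF n x /\ HB N dB n (t - T (inx n) x).
Proof.
move=> Zt [w _ we].
exists (T (prx n) t - T (theta n) w); split; last first.
  apply/HB_prod; exists 0, w; split; rewrite [LHS]linearB ?Tprx_inx ?Tprz_inx.
    by rewrite linear0 add0r opprB addrCA subrr addr0.
  by rewrite subr0 we.
case: n t w Zt we => [|n] t w // /HZP Zt we; apply/HZP.
by rewrite linearB Tdth opprK we -Tdx Zt linear0.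
Qed.

Let les_third n := [set t | HZ N dB n t /\ HB N dG n (T (prz n) t)].

(** The third term is the image of [H_n(B (x) N)] in [H_n(G (x) N)]. *)
Lemma les_ses n : Hvan N dG n.+1 ->
  pses (T (inx n)) (idfun : {linear tensor (B n) N -> tensor (B n) N})
    (HZ N dF n) (HB N dF n) (HZ N dB n) (HB N dB n)
    (HZ N dB n) (@les_third n).
Proof.
move=> vG; split=> //.
- exact: H_pair.
- exact: H_pair.
- split; first exact: HZ_smod; last by move=> t [].
  split; first by split; [exact: smod0 (HZ_smod _ _ _)|rewrite linear0; exact: smod0 (HB_smod _ _ _)].
  move=> a u v [Zu Bu] [Zv Bv]; split; first exact: (HZ_smod _ _ _).2.
  by rewrite linearP; exact: (HB_smod _ _ _).2.
- exact: inx_HZ.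
- by move=> t Zt; split; [exact: les_inj|exact: inx_HB].
- move=> t Zt; split=> [[_ Bt]|[x [Zx Bx]]]; first exact: les_mid.
  split=> //; have [x' [z [_]]] := (HB_prod _).1 Bx.
  by rewrite linearB Tprz_inx subr0 => ->; exists z.
- by move=> t Zt; exists t; rewrite subrr; split=> //; split; [exact: smod0 (HZ_smod _ _ _)|rewrite linear0; exact: smod0 (HB_smod _ _ _)].
Qed.

Lemma les_third_dge1 n : dge 1 (HZ N dG n) (HB N dG n) -> dge 1 (HZ N dB n) (@les_third n).
Proof.
move=> [a [ma ra _]]; exists a; split=> // t Zt [_]; rewrite linearZ_LR => Bt.
by split=> //; apply: ra => //; exact: prz_HZ.
Qed.

Lemma les_ses0 : Hvan N dG 1 ->
  pses (T (inx 0)) (T (prz 0)) (HZ N dF 0) (HB N dF 0) (HZ N dB 0) (HB N dB 0)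
    (HZ N dG 0) (HB N dG 0).
Proof.
move=> /(@les_ses 0%N)[p1 p2 _ ff fi _ mid _]; split=> //.
- exact: H_pair.
- move=> t Zt; rewrite -mid //; split=> [Bt|[] //]; by split.
- move=> z _; exists (T (inz 0) z); split=> //.
  by rewrite Tprz_inz subrr; exact: smod0 (HB_smod _ _ _).
Qed.

Lemma van_mid n : Hvan N dF n -> Hvan N dG n -> Hvan N dB n.
Proof.
move=> vF vG t Zt; have [x [Zx Bx]] := les_mid Zt (vG _ (prz_HZ Zt)).
rewrite -(subrK (T (inx n) x) t); apply: (smodD (HB_smod _ _ _)) => //.
by apply: inx_HB; exact: vF.
Qed.

Lemma van_left n : Hvan N dG n.+1 -> Hvan N dB n -> Hvan N dF n.
Proof. by move=> vG vB t Zt; apply: les_inj => //; apply: vB; exact: inx_HZ. Qed.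

End LongExact.

(** * Modules of finite projective dimension *)

Arguments pow {R V} b A.

Lemma pses_iso_mid (R : comNzRingType) (V1 V2 W2 V3 : lmodType R)
    (f : {linear V1 -> V2}) (g : {linear V2 -> V3})
    (phi : {linear V2 -> W2}) (psi : {linear W2 -> V2})
    (A1 U1 : set V1) (A2 U2 : set V2) (B2 W : set W2) (A3 U3 : set V3) :
  (forall x, psi (phi x) = x) -> (forall y, phi (psi y) = y) -> sqpair B2 W ->
  (forall x, B2 (phi x) <-> A2 x) -> (forall x, W (phi x) <-> U2 x) ->
  pses f g A1 U1 A2 U2 A3 U3 -> pses (phi \o f) (g \o psi) A1 U1 B2 W A3 U3.
Proof.
move=> fK gK pW BA WU [p1 p2 p3 ff fi gg mid surj].
have ABp y : B2 y -> A2 (psi y) by rewrite -{1}(gK y) BA.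
split=> //.
- by move=> x Ax; apply/BA; exact: ff.
- by move=> x Ax; rewrite -fi //; exact: WU.
- by move=> y By; apply: gg; exact: ABp.
- move=> y By; apply: (iff_trans (mid _ (ABp _ By))).
  split=> -[x [Ax Ux]]; exists x; split=> //.
    by move/WU: Ux; rewrite linearB gK.
  by apply/WU; rewrite linearB gK.
move=> z /surj[y [Ay Uy]]; exists (phi y); split; first exact/BA.
by rewrite -[X in z - X]/(g (psi (phi y))) fK.
Qed.

Section Finite.
Variable R : comNzRingType.
Hypotheses (noethR : noetherian_ring R) (localR : local_ring R).
Local Notation mx := (max_ideal R).

Lemma socfree_dge1 (V : lmodType R) (A U : set V) :
  noeth V -> sqpair A U -> socfree A U -> dge 1 A U.
Proof.
move=> nV pA sf; have [a [ma ra]] := generic_ex localR (generic_sqreg noethR nV pA sf).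
by exists a.
Qed.

Lemma dge0_socle (V : lmodType R) (A U : set V) : noeth V -> sqpair A U ->
  ~ dge 1 A U -> exists v, [/\ A v, forall r, mx r -> U (r *: v) & ~ U v].
Proof.
move=> nV pA nd; apply: contrapT => nv; apply: nd; apply: socfree_dge1 => //.
by move=> v Av mv; apply: contrapT => Uv; apply: nv; exists v.
Qed.

Definition tun (N : lmodType R) b : {linear ('I_b -> N) -> tensor 'rV[R]_b N} :=
  mkl (@tuncoord_linear R N b).

(** The statement [inj_mod_max] carried over from [N^b] to [R^b (x) N]. *)
Lemma inj_mod_tensor b c (f : {linear 'rV[R]_b -> 'rV[R]_c}) s (N V0 V1 V2 : lmodType R)
    (A0 U0 : set V0) (A1 U1 : set V1) (A2 U2 : set V2)
    (f0 : {linear V0 -> tensor 'rV[R]_b N}) (g1 : {linear tensor 'rV[R]_b N -> V1})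
    (h1 : {linear V1 -> tensor 'rV[R]_c N}) (g2 : {linear tensor 'rV[R]_c N -> V2}) :
  noeth N -> noeth V0 -> noeth V1 -> noeth V2 ->
  pses f0 g1 A0 U0 setT [set 0] A1 U1 -> pses h1 g2 A1 U1 setT [set 0] A2 U2 ->
  (forall t, h1 (g1 t) = tmap N f t) ->
  hasdep [set: N] [set 0] s -> dge s.+1 A0 U0 -> dge s A1 U1 -> dge s A2 U2 ->
  forall x : 'rV[R]_b, (forall j, mx (f x 0 j)) -> forall i, mx (x 0 i).
Proof.
move=> nN n0 n1 n2 S T hg dN d0 d1 d2.
have pN := pair_full N.
have iso k : [/\ forall x, tun N k (tcoord N k x) = x, forall y, tcoord N k (tun N k y) = y,
    sqpair (pow k [set: N]) (pow k [set 0]),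
    forall x, pow k [set: N] (tcoord N k x) <-> [set: tensor 'rV[R]_k N] x &
    forall x, pow k [set 0] (tcoord N k x) <-> [set 0 : tensor 'rV[R]_k N] x].
  split=> [x|y||//|x]; [exact: tcoordK|exact: tuncoordK|exact: pow_pair|].
  split=> [e|-> i]; last by rewrite linear0.
  by apply: tcoord_inj; apply/funext => i; exact: e.
have [bK bK' bp bA bU] := iso b; have [cK cK' cp cA cU] := iso c.
have S' := pses_iso_mid bK bK' bp bA bU S.
have T' : pses (tcoord N c \o h1) (g2 \o tun N c) A1 U1
    (pow c setT) (pow c [set 0]) A2 U2 by exact: pses_iso_mid cK cK' cp cA cU T.
apply: (inj_mod_max noethR localR (f := f) nN n0 n1 n2 pN S' T' _ dN d0 d1 d2).
move=> v; apply/funext => j.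
by rewrite -[LHS]/(tcoord N c (h1 (g1 (tun N b v))) j) hg tcoord_tmap bK'.
Qed.

Section Syzygy.
Variables (N M : lmodType R) (F : nat -> lmodType R).
Variables (d : forall i, {linear F i.+1 -> F i}) (e : {linear F 0 -> M}).
Hypothesis r : is_res d e.

Lemma HB_full n : sqpair [set: tensor (F n) N] (HB N d n).
Proof. by split=> //; exact: HB_smod. Qed.

Lemma pses_syz n : Hvan N d n.+1 ->
  pses (tmap N (d n)) (idfun : {linear tensor (F n) N -> tensor (F n) N})
    setT (HB N d n.+1) setT [set 0] setT (HB N d n).
Proof.
move=> v; split=> //; try exact: HB_full; try exact: pair_full.
- move=> t _; split=> [e0|[u _ <-]]; first exact: v.
  by have [_ _ sub] := res_pair N n.+1 r; have /HZP := sub _ (@HBI _ N F d n.+1 u).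
- move=> t _; split=> [[u _ e0]|[u [_ /eqP]]].
    by exists u; split=> //; rewrite e0; exact: subrr.
  by rewrite subr_eq0 => /eqP e0; exists u.
by move=> t _; exists t; rewrite subrr; split=> //; exact: smod0 (HB_smod _ _ _).
Qed.

Lemma pses_cycles n : pses (idfun : {linear tensor (F n) N -> tensor (F n) N}) idfun
    (HZ N d n) (HB N d n) setT (HB N d n) setT (HZ N d n).
Proof.
split=> //; [exact: res_pair r|exact: HB_full|by split=> //; exact: HZ_smod| |].
- move=> t _; split=> [Zt|[x [Zx Bx]]].
    by exists t; rewrite subrr; split=> //; exact: smod0 (HB_smod _ _ _).
  rewrite -(subrK x t); apply: (smodD (HZ_smod _ _ _)) => //.
  by have [_ _ sub] := res_pair N n r; exact: sub.
by move=> t _; exists t; rewrite subrr; split=> //; exact: smod0 (HZ_smod _ _ _).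
Qed.

(** The quotient by the cycles embeds into [F_n (x) N]. *)
Lemma cycles_dge1 n : dge 1 [set: tensor (F n) N] [set 0] ->
  dge 1 [set: tensor (F n.+1) N] (HZ N d n.+1).
Proof.
move=> [a [ma ra _]]; exists a; split=> // t _ /HZP; rewrite linearZ_LR => e0.
by apply/HZP; apply: ra.
Qed.

Lemma shift1_res (C : lmodType R) (q : {linear F 1 -> C}) :
  (forall y, exists x, y = q x) -> (forall x, q x = 0 <-> exists z, x = d 1 z) ->
  @is_res R C (fun i => F i.+1) (fun i => d i.+1) q.
Proof.
move=> sq eq; split=> // [i|i|i x]; [exact: res_proj r _|exact: res_fg r _|].
exact: (res_exS r).
Qed.

End Syzygy.

Definition coker (A B : lmodType R) (f : {linear A -> B}) : lmodType R := quot_mod (range f).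
Definition cokp (A B : lmodType R) (f : {linear A -> B}) : {linear B -> coker f} :=
  mkl (@proj_linear R B (range f)).

Lemma cokp_surj (A B : lmodType R) (f : {linear A -> B}) y : exists x, y = cokp f x.
Proof. by exists (repr y); rewrite mklE projK. Qed.

Lemma cokpP (A B : lmodType R) (f : {linear A -> B}) x : cokp f x = 0 <-> exists z, x = f z.
Proof.
rewrite mklE proj0P; last exact: smod_range.
by split=> [[z _ <-]|[z ->]]; exists z.
Qed.

Lemma rV0_zero (x : 'rV[R]_0) : x = 0.
Proof. by apply/rowP => -[]. Qed.

Lemma tensor_zero (A N : lmodType R) : trivial_mod A -> forall t : tensor A N, t = 0.
Proof.
move=> A0 t; rewrite -[t](tmap_id (f := idfun)) //.
by apply: tmap_zero => x; exact: A0.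
Qed.

(** A minimal free resolution of length exactly [p], in particular of a nonzero
    module. *)
Definition mfree p (M : lmodType R) (b : nat -> nat)
    (d : forall i, {linear 'rV[R]_(b i.+1) -> 'rV[R]_(b i)})
    (e : {linear 'rV[R]_(b 0) -> M}) : Prop :=
  [/\ @is_res R M (fun i => 'rV[R]_(b i)) d e, forall i x j, mx (d i x 0 j),
      (0 < b p)%N & forall i, (p < i)%N -> b i = 0%N].

Section FiniteDepth.
Variables (N : lmodType R) (s : nat).
Hypotheses (nN : noeth N) (dN : hasdep [set: N] [set 0] s).

Lemma HB_top p (M : lmodType R) b d (e : {linear 'rV[R]_(b 0) -> M}) :
  mfree p d e -> @HB R N (fun i => 'rV[R]_(b i)) d p = [set 0].
Proof.
move=> [_ _ _ b0]; apply/seteqP; split=> [_ [u _ <-]|_ ->]; last first.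
  by exists 0 => //; rewrite linear0.
suff -> : u = 0 by rewrite linear0.
by apply: tensor_zero => x; move: x; rewrite b0 // => x; exact: rV0_zero.
Qed.

(** Induction on the length, by the depth lemma for
    [0 -> Tor_0(Omega M, N) -> F_0 (x) N -> Tor_0(M, N) -> 0].  It determines
    the depth of the third term only if the first one is less deep than [N];
    in length one, where both have the depth of [N], the depth must drop because
    the differential is zero, not injective, modulo the maximal ideal. *)
Lemma mfree_depth p (M : lmodType R) b d (e : {linear 'rV[R]_(b 0) -> M}) :
  mfree p d e -> (forall i, (0 < i)%N -> @Hvan R N (fun i => 'rV[R]_(b i)) d i) ->
  exists t, (t + p)%N = s /\
    hasdep [set: tensor 'rV[R]_(b 0) N] (@HB R N (fun i => 'rV[R]_(b i)) d 0) t.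
Proof.
elim: p M b d e => [|p IH] M b d e m van; have [r dm bp b0] := m;
  pose F := (fun i => 'rV[R]_(b i)) : nat -> lmodType R.
  exists s; rewrite addn0 (HB_top m); split=> //; exact: tensor_free_hasdep.
have nT i : noeth (tensor 'rV[R]_(b i) N) by exact: noeth_tensor_free.
have dF k i : (k <= s)%N -> dge k [set: tensor 'rV[R]_(b i) N] [set 0].
  by move=> ks; apply: tensor_free_dge; apply/(hasdep_dge _ dN).
have r' := shift1_res r (@cokp_surj _ _ (d 1%N)) (@cokpP _ _ (d 1%N)).
have m' : mfree p (fun i => d i.+1) (cokp (d 1%N)).
  by split=> // i pi; exact: b0.
have S := pses_syz r (van 1%N isT).
case: p m' bp b0 m IH => [|p] m' bp b0 m IH.
  have nd : ~ dge s setT (HB N (F := F) d 0).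
    move=> ds; have HB1 : HB N (F := F) d 1 = [set 0] by exact: (HB_top m).
    rewrite HB1 in S.
    have := inj_mod_tensor nN nN (nT 1%N) (nT 0%N) (@pses_id R N _) S (fun t => erefl) dN
      (dge_zero localR _ _) (dF _ _ (leqnn s)) ds.
    move=> /(_ (delta_mx 0 (Ordinal bp)) (fun j => dm _ _ _) (Ordinal bp)).
    by rewrite mxE !eqxx; exact: maxi1.
  case: s dN dF nd => [|s'] dN' dF nd; first by case: nd.
  exists s'; rewrite addn1; split=> //; split=> //.
  apply: (dge_right noethR localR (nT _) (nT _) (nT _) S); first exact: dF.
  by rewrite (HB_top m); exact: dF.
have [|t [ts [d1 nd1]]] := IH _ _ _ _ m'; first by move=> [|i] // _; exact: van.
have s1 : (0 < s)%N by rewrite -ts addnS.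
case: t ts d1 nd1 => [|t] ts d1 nd1.
  case: nd1; apply: socfree_dge1 => //; first exact: (pses_p1 S).
  by apply: (socfree_left S); apply: dge1_socfree (dF 1%N _ s1).
exists t; rewrite -addSnnS; split=> //; split.
  apply: (dge_right noethR localR (nT _) (nT _) (nT _) S) => //.
  by apply: dF; rewrite -ts addSnnS leq_addr.
move=> dt; apply: nd1; apply: (dge_left noethR localR (nT _) (nT _) S) => //.
by apply: dF; rewrite -ts addnS ltnS leq_addr.
Qed.

(** Auslander's formula.  The module of cycles modulo boundaries in degree
    [q] sits inside the [q]-th syzygy tensored with [N], whose depth is known
    because higher [Tor] vanish, and the quotient embeds in a power of [N]. *)
Lemma mfree_depth_top p q t (M : lmodType R) b d (e : {linear 'rV[R]_(b 0) -> M}) :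
  let F := (fun i => 'rV[R]_(b i)) : nat -> lmodType R in
  mfree p d e -> (0 < q)%N -> (forall i, (q < i)%N -> @Hvan R N F d i) ->
  ~ @Hvan R N F d q -> hasdep (@HZ R N F d q) (@HB R N F d q) t -> (t <= 1)%N ->
  (t + p = s + q)%N.
Proof.
move=> F m q0 van nvan dT t1; have [r dm bp b0] := m.
have nT i : noeth (tensor 'rV[R]_(b i) N) by exact: noeth_tensor_free.
have qp : (q <= p)%N.
  rewrite leqNgt; apply/negP => pq; apply: nvan => u _; exists 0 => //.
  rewrite linear0; symmetry; apply: tensor_zero => x.
  by move: x; rewrite /F b0 // => x; exact: rV0_zero.
have r' := shift_res r (@cokp_surj _ _ (d q)) (@cokpP _ _ (d q)).
have m' : @mfree (p - q) _ (fun i => b (i + q)%N) (fun i => d (i + q)%N) (cokp (d q)).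
  split=> //; first by rewrite subnK.
  by move=> i pi; apply: b0; rewrite addnC -ltn_subLR.
have [|t' [ts [d1 nd1]]] := mfree_depth m'.
  by case=> // i _; apply: (van (i.+1 + q)%N); rewrite addSn ltnS leq_addl.
have dtop : hasdep [set: tensor (F q) N] (HB N (F := F) d q) t' by [].
have S := @pses_cycles N _ _ _ _ r q.
suff -> : t = t' by rewrite -ts -addnA subnK.
case: q q0 van nvan dT qp r' m' ts d1 nd1 dtop S => // q _ van nvan dT qp r' m' ts d1 nd1 dtop S.
case: t dT t1 => [|[|//]] dT _.
  case: t' ts d1 nd1 dtop => // t' ts d1 nd1 dtop.
  have nd := dT.2; exfalso; apply: nd.
  have d2 : dge 1 setT (HB N (F := F) d q.+1) by exact: dge_le dtop.1.
  exact: (dge_left (n := 0) noethR localR (nT q.+1) (nT q.+1) S d2).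
(* If [s = 0] and [t = 1], let [v] be a socle element of [N] and [x] a basis
   vector in the top degree.  As [d x] has entries in the maximal ideal,
   [x (x) v] is a cycle killed by that ideal, hence a boundary because [t > 0];
   but in the top degree only zero is a boundary. *)
have [s0|s1] := posnP s.
  case: dN; rewrite s0 => _ /(dge0_socle nN (pair_full N))[v [_ mv v0]].
  move: ts; rewrite s0 => /eqP; rewrite addn_eq0 => /andP[_]; rewrite subn_eq0 => pq.
  have pE : p = q.+1 by apply/eqP; rewrite eqn_leq pq.
  rewrite pE in bp; pose x : 'rV[R]_(b q.+1) := delta_mx 0 (Ordinal bp).
  case: v0; have tB : HB N (F := F) d q.+1 (tens x v).
    apply: (dge1_socfree dT.1).
      apply/HZP; rewrite tmap_tens; apply: tcoord_inj; apply/funext => j.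
      by rewrite tcoordE; apply: mv; exact: dm.
    move=> a ma; rewrite -tensZr (mv a ma) -[tens x 0]/(mkl (@tens_linr _ _ N x) 0) linear0.
    exact: smod0 (HB_smod _ _ _).
  move: tB; rewrite pE in m; rewrite (HB_top m) => /(congr1 (fun t => tcoord N _ t (Ordinal bp))).
  by rewrite tcoordE mxE !eqxx scale1r linear0.
have d3 : dge 1 [set: tensor (F q.+1) N] (HZ N (F := F) d q.+1).
  apply: cycles_dge1.
  by apply: tensor_free_dge; apply/(hasdep_dge _ dN).
apply/eqP; rewrite eqn_leq; apply/andP; split.
  apply/(hasdep_dge _ dtop).
  exact: (dge_mid noethR localR (nT q.+1) (nT q.+1) S dT.1 d3).
rewrite leqNgt; apply/negP => t2; apply: dT.2.
apply: (dge_left noethR localR (nT q.+1) (nT q.+1) S) => //.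
by apply/(hasdep_dge _ dtop).
Qed.

End FiniteDepth.

Lemma Hvan_ring (M : lmodType R) (F : nat -> lmodType R)
    (d : forall i, {linear F i.+1 -> F i}) (e : {linear F 0 -> M}) i :
  is_res d e -> (0 < i)%N -> Hvan R^o d i.
Proof.
case: i => // i r _ t /HZP Zt.
have : d i (tens1 _ t) = 0 by rewrite -tens1_nat Zt linear0.
move=> /(res_exS r)[z ze]; exists (tens z (1 : R^o)) => //.
by rewrite tmap_tens -ze tens1K.
Qed.

Lemma H0_ring (M : lmodType R) (F : nat -> lmodType R)
    (d : forall i, {linear F i.+1 -> F i}) (e : {linear F 0 -> M}) :
  is_res d e -> piso (e \o tens1 (F 0)) setT (HB R^o d 0) setT [set 0].
Proof.
move=> r; split=> // [t _|y _].
  split=> [/(res_ex0 r)[z ze]|[u _ <-]].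
    by exists (tens z (1 : R^o)) => //; rewrite tmap_tens -ze tens1K.
  suff : e (d 0%N (tens1 _ u)) = 0 by rewrite -tens1_nat.
  by apply/(res_ex0 r); exists (tens1 _ u).
have [x ->] := res_aug r y; exists (tens x (1 : R^o)); split=> //.
by rewrite -[X in _ - X]/(e (tens1 _ _)) tens1E scale1r /= subrr.
Qed.

(** The case [N = R] of [mfree_depth], since [Tor_0(M, R)] is [M]. *)
Lemma auslander_buchsbaum p s (M : lmodType R) b d (e : {linear 'rV[R]_(b 0) -> M}) :
  mfree p d e -> hasdep [set: R^o] [set 0] s ->
  exists t, (t + p)%N = s /\ hasdep [set: M] [set 0] t.
Proof.
move=> m dR; have [r _ _ _] := m.
have [|t [ts dt]] := mfree_depth (noeth_ring noethR) dR m.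
  by move=> i i0; exact: Hvan_ring r i0.
exists t; split=> //.
by apply/(piso_hasdep _ (HB_full _ _ _) (pair_full M) (H0_ring r)).
Qed.

Lemma lin_max b c (f : {linear 'rV[R]_b -> 'rV[R]_c}) (x : 'rV[R]_b) :
  (forall i, mx (x 0 i)) -> forall j, mx (f x 0 j).
Proof.
move=> mxx j; rewrite (row_sum_delta x) linear_sum summxE.
apply: big_ind => [|u v mu mv|i _]; [exact: maxi0|exact: (idealD (maxi_smod localR))|].
rewrite linearZ_LR mxE; exact: maxiMr.
Qed.

(** In the degrees where the other resolution is zero, a homotopy writes the
    identity of the minimal one as [d h + h d], which has its entries in the
    maximal ideal. *)
Lemma fpd_betti (M : lmodType R) (F : nat -> lmodType R)
    (d : forall i, {linear F i.+1 -> F i}) (e : {linear F 0 -> M}) n :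
  fg_module M -> is_res d e -> (forall i, (n < i)%N -> trivial_mod (F i)) ->
  forall i, (n < i)%N -> betti M i = 0%N.
Proof.
move=> fM r F0 [//|i] ni.
have [f [g [h [k [_ _ [_ hS] _]]]]] := compare_res (mres_is_res noethR fM) r.
case E : (betti M i.+1) => [//|b0].
have lt : (0 < betti M i.+1)%N by rewrite E.
pose x : 'rV[R]_(betti M i.+1) := delta_mx 0 (Ordinal lt).
case: (maxi1 localR); have <- : x 0 (Ordinal lt) = 1 by rewrite mxE !eqxx.
have -> : x = mdiff M i.+1 (h i.+1 x) + h i (mdiff M i x).
  have gf0 : g i.+1 (f i.+1 x) = 0 by rewrite (F0 _ ni (f i.+1 x)) linear0.
  by have := hS i x; rewrite -[X in _ = X]/(g i.+1 (f i.+1 x) + _) gf0 add0r.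
rewrite mxE; apply: (idealD (maxi_smod localR)); first exact: mdiff_minimal.
by apply: lin_max => j; exact: mdiff_minimal.
Qed.

Lemma fpd_mfree (M : lmodType R) n : fg_module M -> ~ trivial_mod M ->
  (forall i, (n < i)%N -> betti M i = 0%N) ->
  exists p, @mfree p M (betti M) (@mdiff R M) (@maug R M).
Proof.
move=> fM M0 b0.
have ex : exists i, (0 < betti M i)%N.
  exists 0%N; rewrite lt0n; apply/eqP => e; apply: M0 => y.
  have [x ->] := res_aug (mres_is_res noethR fM) y.
  rewrite (_ : x = 0) ?linear0 //; by apply/rowP => -[j lj]; have : (j < 0)%N by rewrite -e.
have bd i : (0 < betti M i)%N -> (i <= n)%N.
  by move=> bi; rewrite leqNgt; apply/negP => /b0 e; rewrite e in bi.
exists (ex_maxn ex bd); case: ex_maxnP => p bp pmax; split=> //.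
- exact: mres_is_res.
- by move=> i x j; exact: mdiff_minimal.
by move=> i pi; apply/eqP; rewrite -leqn0 leqNgt; apply/negP => /pmax; rewrite leqNgt pi.
Qed.

End Finite.

(** * Modules without higher extensions by the ring *)

Section ExtVanishing.
Variable R : comNzRingType.
Hypothesis noethR : noetherian_ring R.

Lemma factor_surj (X B W : lmodType R) (q : {linear X -> B}) (f : {linear X -> W}) :
  (forall y, exists x, y = q x) -> (forall x, q x = 0 -> f x = 0) ->
  exists g : {linear B -> W}, forall x, g (q x) = f x.
Proof.
move=> sq kf; have /choice[l lP] : forall y, exists x, y = q x by [].
have fl x : f (l (q x)) = f x.
  apply/eqP; rewrite -subr_eq0 -linearB; apply/eqP; apply: kf.
  by rewrite linearB -lP subrr.
have lg : linear (fun y => f (l y)).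
  move=> a y y'; rewrite -linearP -[RHS]fl; congr (f (l _)).
  by rewrite linearP -!lP.
by exists (mkl lg) => x; rewrite mklE fl.
Qed.

Definition dual_exact (F : nat -> lmodType R) (d : forall i, {linear F i.+1 -> F i}) : Prop :=
  forall i (f : {linear F i.+1 -> R^o}), (forall x, f (d i.+1 x) = 0) ->
  exists g : {linear F i -> R^o}, forall x, f x = g (d i x).

Lemma dual_exact_indep (M : lmodType R) (F G : nat -> lmodType R)
    (dF : forall i, {linear F i.+1 -> F i}) (dG : forall i, {linear G i.+1 -> G i})
    (eF : {linear F 0 -> M}) (eG : {linear G 0 -> M}) :
  is_res dF eF -> is_res dG eG -> dual_exact dF -> dual_exact dG.
Proof.
move=> rF rG xF i f fd; have [phi [psi [h [k [cphi cpsi _ [_ kS]]]]]] := compare_res rF rG.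
have [|g gP] := xF i (f \o phi i.+1).
  by move=> x; rewrite -[LHS]/(f (phi i.+1 (dF i.+1 x))) -cphi fd.
exists ((g \o psi i) \+ (f \o k i)) => y.
rewrite -[RHS]/(g (psi i (dG i y)) + f (k i (dG i y))) -cpsi -gP.
rewrite -[X in X + _]/(f (phi i.+1 (psi i.+1 y))).
have e : y = phi i.+1 (psi i.+1 y) + (dG i.+1 (k i.+1 y) + k i (dG i y)) := kS i y.
by rewrite (congr1 f e) !linearD fd add0r.
Qed.

(** [Ext^i(M, R) = 0] for all [i > 0]. *)
Definition ext_van (M : lmodType R) : Prop := dual_exact (@mdiff R M).

Lemma ext_vanP (M : lmodType R) (F : nat -> lmodType R)
    (d : forall i, {linear F i.+1 -> F i}) (e : {linear F 0 -> M}) :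
  fg_module M -> is_res d e -> ext_van M <-> dual_exact d.
Proof.
move=> fM r; have rM := mres_is_res noethR fM.
by split; [exact: dual_exact_indep rM r|exact: dual_exact_indep r rM].
Qed.

(** As [Ext^1(C, R)] is zero: restricting a functional on [A] along the map from
    the first syzygy of [C] gives a cocycle, and a primitive of it is the
    missing component of the extension. *)
Lemma ext_van_extend (A B C : lmodType R) (i : {linear A -> B}) (p : {linear B -> C}) :
  fg_module C -> short_exact i p -> ext_van C ->
  forall phi : {linear A -> R^o}, exists psi : {linear B -> R^o}, forall x, psi (i x) = phi x.
Proof.
move=> fC se xC phi; have r := mres_is_res noethR fC.
have [|s sP] := proj_lift (g := p) (f := maug C) (res_proj r 0%N).
  by move=> x; exact: (se_surj se).
have dd : forall j x, mdiff C j (mdiff C j.+1 x) = 0 by exact: res_cplx r.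
have ed z : maug C (mdiff C 0 z) = 0 by apply/(res_ex0 r); exists z.
have [|t tP] := proj_lift (g := i) (f := s \o mdiff C 0) (res_proj r 1%N).
  move=> z; have [a ae] := (se_mid se (s (mdiff C 0 z))).1 (etrans (sP _) (ed z)).
  by exists a.
have [|g gP] := xC 0%N (phi \o t).
  move=> x; rewrite -[LHS]/(phi (t _)) (_ : t _ = 0) ?linear0 //.
  by apply: (se_inj se); rewrite tP -[LHS]/(s (mdiff C 0 _)) dd linear0.
have [||psi psiP] := @factor_surj (A * free_mod C 0)%type B R^o (copair i s) (copair phi g).
- move=> b; have [z ze] := res_aug r (p b).
  have [|a ae] := (se_mid se (b - s z)).1; first by rewrite linearB sP ze subrr.
  by exists (a, z); rewrite mklE /= -ae subrK.
- move=> [a z]; rewrite !mklE /= => e0.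
  have /(res_ex0 r)[w we] : maug C z = 0.
    have ia : p (i a) = 0 by apply/(se_mid se); exists a.
    by rewrite -sP -[LHS]add0r -ia -linearD e0 linear0.
  have -> : a = - t w.
    apply/eqP; rewrite -addr_eq0; apply/eqP; apply: (se_inj se).
    by rewrite linearD tP -[X in _ + X]/(s (mdiff C 0 w)) -we.
  by rewrite linearN we -gP -[X in _ + X]/(phi (t w)) addNr.
exists psi => x; have := psiP (x, 0).
by rewrite !mklE /= !linear0 !addr0.
Qed.

Lemma extend_free (A B : lmodType R) (i : {linear A -> B}) b :
  (forall phi : {linear A -> R^o}, exists psi : {linear B -> R^o}, forall x, psi (i x) = phi x) ->
  forall phi : {linear A -> 'rV[R]_b},
  exists psi : {linear B -> 'rV[R]_b}, forall x, psi (i x) = phi x.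
Proof.
move=> ext phi.
have lc k : linear (fun x => phi x 0 k : R^o) by move=> a x y; rewrite linearP !mxE.
have /choice[psi psiP] (k : 'I_b) := ext (mkl (lc k)).
have lp : linear (fun y => \row_k psi k y : 'rV[R]_b).
  by move=> a x y; apply/rowP => k; rewrite !mxE linearP.
by exists (mkl lp) => x; rewrite mklE; apply/rowP => k; rewrite mxE psiP mklE.
Qed.

Lemma ext_van_mid (A B C : lmodType R) (i : {linear A -> B}) (p : {linear B -> C}) :
  fg_module A -> fg_module B -> fg_module C -> short_exact i p ->
  ext_van A -> ext_van C -> ext_van B.
Proof.
move=> fA fB fC se xA xC.
have rA := mres_is_res noethR fA; have rC := mres_is_res noethR fC.
have [th [e r]] := horseshoe se rA rC noethR.
apply/(ext_vanP fB r) => n f fd.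
have dB x z : hdiff (mdiff A) (mdiff C) th n.+1 (x, z) =
    (mdiff A n.+1 x + th n.+1 z, mdiff C n.+1 z) by [].
have cplx := res_cplx r.
have [|g1 g1P] := xA n (f \o inj1 _ _).
  move=> x; rewrite -[RHS](fd (x, 0)) dB !linear0 addr0 //.
have thd z : mdiff A n (th n.+1 z) = - th n (mdiff C n.+1 z).
  have := congr1 fst (cplx n (0, z)); rewrite dB linear0 add0r /= => e0.
  by apply/eqP; rewrite -addr_eq0; apply/eqP.
have [|g2 g2P] := xC n ((f \o inj2 _ _) \- (g1 \o th n)).
  move=> z; rewrite -[LHS]/(f (0, mdiff C n.+1 z) - g1 (th n (mdiff C n.+1 z))).
  rewrite -[th n _]opprK -thd linearN opprK -g1P.
  rewrite -[X in _ + X]/(f (th n.+1 z, 0)) -linearD -[RHS](fd (0, z)) dB linear0 add0r.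
  by congr (f (_, _)); rewrite /= ?addr0 ?add0r.
exists (copair g1 g2) => -[x z].
rewrite -[RHS]/(g1 (mdiff A n x + th n z) + g2 (mdiff C n z)) -g2P linearD -g1P.
rewrite -[X in _ + X]/(f (0, z) - g1 (th n z)) addrACA subrr addr0 -[X in X + _]/(f (x, 0)).
by rewrite -linearD; congr (f (_, _)); rewrite /= ?addr0 ?add0r.
Qed.

Section Embedding.
Variables (M M' : lmodType R) (b : nat) (j : {linear M -> 'rV[R]_b}) (p : {linear 'rV[R]_b -> M'}).
Hypotheses (fM : fg_module M) (se : short_exact j p).

Lemma embed_res (F : nat -> lmodType R) (d : forall i, {linear F i.+1 -> F i})
  (e : {linear F 0 -> M}) : is_res d e -> is_res (consd d e j) p.
Proof. by move=> r; apply: cons_res => //; [exact: free_projective|exact: free_fg]. Qed.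

Lemma embed_fg : fg_module M'.
Proof. exact: fg_img noethR (free_fg R b) (se_surj se). Qed.

Let r := embed_res (mres_is_res noethR fM).

Lemma ext_van_sub : ext_van M' -> ext_van M.
Proof. by move=> /(ext_vanP embed_fg r) x i f; exact: (x i.+1 f). Qed.

Lemma ext_van_quot : ext_van M ->
  (forall phi : {linear M -> R^o}, exists psi : {linear 'rV[R]_b -> R^o}, forall x, psi (j x) = phi x) ->
  ext_van M'.
Proof.
move=> x ext; apply/(ext_vanP embed_fg r) => -[|i] f fd; last exact: (x i f fd).
have rM := mres_is_res noethR fM.
have [||phi phiP] := factor_surj (q := maug M) (f := f).
- exact: (res_aug rM).
- by move=> y /(res_ex0 rM)[z ->]; exact: fd.
have [psi psiP] := ext phi; exists psi => y.
by rewrite -[consd _ _ _ _ _]/(j (maug M y)) psiP phiP.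
Qed.

End Embedding.

(** [M] is the [J]-th syzygy of [L], in a resolution by free modules. *)
Fixpoint cosyz (J : nat) (M L : lmodType R) : Prop :=
  match J with
  | 0 => M = L
  | J'.+1 => exists b (M' : lmodType R) (j : {linear M -> 'rV[R]_b})
      (p : {linear 'rV[R]_b -> M'}), short_exact j p /\ cosyz J' M' L
  end.

Lemma cosyz_fg J M L : fg_module M -> cosyz J M L -> fg_module L.
Proof.
elim: J M => [M fM <- //|J IH M fM [b [M' [j [p [se]]]]]].
by apply: IH; exact: embed_fg se.
Qed.

Lemma cosyz_ext_van J M L : fg_module M -> cosyz J M L -> ext_van L -> ext_van M.
Proof.
elim: J M => [M _ -> //|J IH M fM [b [M' [j [p [se c]]]]]] xL.
apply: (ext_van_sub fM se); exact: IH (embed_fg se) c xL.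
Qed.

Lemma cosyz_cat J n M L L' : cosyz J M L -> cosyz n L L' -> cosyz (J + n) M L'.
Proof.
elim: J M => [M -> //|J IH M [b [M' [j [p [se c]]]]] c'].
by exists b, M', j, p; split=> //; exact: IH.
Qed.

Lemma cosyz_split J n M L' : cosyz (J + n) M L' -> exists L, cosyz J M L /\ cosyz n L L'.
Proof.
elim: J M => [M c|J IH M [b [M' [j [p [se /IH[L [c c']]]]]]]]; first by exists M.
by exists L; split=> //; exists b, M', j, p.
Qed.

(** The horseshoe lemma for one step of a coresolution: [A -> P_A] extends to
    [B], because [Ext^1(C, R) = 0]. *)
Lemma embed_horseshoe (A B C A' C' : lmodType R) (i : {linear A -> B}) (p : {linear B -> C})
    a c (jA : {linear A -> 'rV[R]_a}) (pA : {linear 'rV[R]_a -> A'})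
    (jC : {linear C -> 'rV[R]_c}) (pC : {linear 'rV[R]_c -> C'}) :
  fg_module C -> ext_van C -> short_exact i p -> short_exact jA pA -> short_exact jC pC ->
  exists b (B' : lmodType R) (j : {linear B -> 'rV[R]_b}) (q : {linear 'rV[R]_b -> B'})
    (i' : {linear A' -> B'}) (p' : {linear B' -> C'}),
    short_exact j q /\ short_exact i' p'.
Proof.
move=> fC xC se sA sC.
have [be beP] := extend_free (ext_van_extend fC se xC) jA.
have lj : linear (fun y => row_mx (be y) (jC (p y))).
  by move=> t y y'; rewrite !linearP scale_row_mx add_row_mx.
pose j := mkl lj; pose B' := coker j; pose q := cokp j.
have li1 : linear (fun u : 'rV[R]_a => row_mx u 0 : 'rV[R]_(a + c)).
  by move=> t y y'; rewrite scale_row_mx add_row_mx scaler0 addr0.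
have pj y : p (i y) = 0 by apply/(se_mid se); exists y.
have [||i' i'P] := factor_surj (q := pA) (f := q \o mkl li1).
- exact: (se_surj sA).
- move=> u /(se_mid sA)[x ->]; apply/cokpP; exists (i x).
  by rewrite !mklE beP pj linear0.
have i'E u : i' (pA u) = q (row_mx u 0) := i'P u.
have [||p' p'P] := factor_surj (q := q) (f := pC \o rsubmx).
- exact: cokp_surj.
- move=> w /cokpP[y ->]; rewrite -[LHS]/(pC (rsubmx (j y))) mklE row_mxKr.
  by apply/(se_mid sC); exists (p y).
have p'E u : p' (q u) = pC (rsubmx u) := p'P u.
exists (a + c)%N, B', j, q, i', p'; split; split.
- move=> y; rewrite mklE => e.
  have e1 : be y = 0 by rewrite -[be y](row_mxKl _ (jC (p y))) e linear0.
  have e2 : jC (p y) = 0 by rewrite -[jC _](row_mxKr (be y)) e linear0.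
  have [x xe] := (se_mid se y).1 (se_inj sC e2).
  by rewrite xe; move: e1; rewrite xe beP => /(se_inj sA) ->; rewrite linear0.
- by move=> y; exact: cokpP.
- exact: cokp_surj.
- move=> x e; have [u ue] := se_surj sA x; move: e; rewrite ue i'E => /cokpP[y]; rewrite mklE => /eq_row_mx[ub e0].
  have [z ze] := (se_mid se y).1 (se_inj sC (esym e0)).
  by apply/(se_mid sA); exists z; rewrite ub ze beP.
- move=> y'; have [w we] := cokp_surj y'; rewrite we p'E; split.
    move=> /(se_mid sC)[z ze]; have [y ye] := se_surj se z.
    exists (pA (lsubmx w - be y)); rewrite i'E; apply/eqP; rewrite -subr_eq0; apply/eqP.
    rewrite -linearB; apply/cokpP; exists y.
    rewrite mklE -{1}(hsubmxK w) opp_row_mx add_row_mx oppr0 addr0 opprB [lsubmx w + _]addrC subrK.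
    by congr row_mx; rewrite ze ye.
  move=> [x]; have [u ->] := se_surj sA x; rewrite i'E => e.
  have : q (w - row_mx u 0) = 0 by rewrite linearB e subrr.
  move=> /cokpP[y e']; apply/(se_mid sC); exists (p y).
  have := congr1 rsubmx e'; rewrite mklE row_mxKr linearB /= row_mxKr subr0 //.
- by move=> z; have [u ->] := se_surj sC z; exists (q (row_mx 0 u)); rewrite p'E row_mxKr.
Qed.

Lemma cosyz_horseshoe J (A B C LA LC : lmodType R) (i : {linear A -> B}) (p : {linear B -> C}) :
  fg_module A -> fg_module C -> short_exact i p ->
  cosyz J A LA -> cosyz J C LC -> ext_van LC ->
  exists (LB : lmodType R) (i' : {linear LA -> LB}) (p' : {linear LB -> LC}),
    cosyz J B LB /\ short_exact i' p'.
Proof.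
elim: J A B C i p => [|J IH] A B C i p fA fC se.
  by move=> /= <- <- _; exists B, i, p.
move=> [a [A' [jA [pA [sA cA]]]]] [c [C' [jC [pC [sC cC]]]]] xL.
have fA' := embed_fg sA; have fC' := embed_fg sC.
have xC : ext_van C by apply: (ext_van_sub fC sC); exact: cosyz_ext_van cC xL.
have [b [B' [j [q [i' [p' [s1 s2]]]]]]] := embed_horseshoe fC xC se sA sC.
have [LB [i'' [p'' [cB sB]]]] := IH _ _ _ _ _ fA' fC' s2 cA cC xL.
by exists LB, i'', p''; split=> //; exists b, B', j, q.
Qed.

(** * Vanishing of Tor for modules *)

Section TorVanishing.
Variable N : lmodType R.

Definition tor_van i (M : lmodType R) : Prop := Hvan N (@mdiff R M) i.

Lemma tor_vanP (M : lmodType R) (F : nat -> lmodType R)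
    (d : forall i, {linear F i.+1 -> F i}) (e : {linear F 0 -> M}) i :
  fg_module M -> is_res d e -> tor_van i M <-> Hvan N d i.
Proof.
move=> fM r; have rM := mres_is_res noethR fM.
by split; [exact: Hvan_indep rM r i|exact: Hvan_indep r rM i].
Qed.

Lemma tor_van_mid (A B C : lmodType R) (i : {linear A -> B}) (p : {linear B -> C}) n :
  fg_module A -> fg_module B -> fg_module C -> short_exact i p ->
  tor_van n A -> tor_van n C -> tor_van n B.
Proof.
move=> fA fB fC se vA vC.
have [th [e r]] := horseshoe se (mres_is_res noethR fA) (mres_is_res noethR fC) noethR.
by apply/(tor_vanP n fB r); apply: van_mid => //; exact: res_cplx r.
Qed.

Lemma tor_van_left (A B C : lmodType R) (i : {linear A -> B}) (p : {linear B -> C}) n :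
  fg_module A -> fg_module B -> fg_module C -> short_exact i p ->
  tor_van n.+1 C -> tor_van n B -> tor_van n A.
Proof.
move=> fA fB fC se vC vB.
have [th [e r]] := horseshoe se (mres_is_res noethR fA) (mres_is_res noethR fC) noethR.
have /(tor_vanP n fB r) vB' := vB.
by apply: van_left vB' => //; exact: res_cplx r.
Qed.

Lemma tor_van_embed (M M' : lmodType R) b (j : {linear M -> 'rV[R]_b})
    (p : {linear 'rV[R]_b -> M'}) i :
  fg_module M -> short_exact j p -> tor_van i.+2 M' <-> tor_van i.+1 M.
Proof.
move=> fM se; have r := embed_res se (mres_is_res noethR fM).
exact: (tor_vanP i.+2 (embed_fg se) r).
Qed.

Lemma tor_van_cosyz J M L i : fg_module M -> cosyz J M L ->
  tor_van (i + J).+1 L <-> tor_van i.+1 M.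
Proof.
elim: J M i => [M i _ ->|J IH M i fM [b [M' [j [p [se c]]]]]]; first by rewrite addn0.
by rewrite addnS -addSn (IH _ _ (embed_fg se) c); exact: tor_van_embed se.
Qed.

End TorVanishing.

End ExtVanishing.

(** * Totally reflexive modules *)

Section TotallyReflexive.
Variable R : comNzRingType.
Hypotheses (noethR : noetherian_ring R) (localR : local_ring R).
Local Notation mx := (max_ideal R).

(** [M] is an arbitrarily high syzygy of modules without extensions by [R].
    The definition is coinductive: [M] belongs to a class of such modules that
    is closed under passing to the cokernel of some embedding into a free
    module. *)
Definition coresolved (M : lmodType R) : Prop :=
  exists C : lmodType R -> Prop, C M /\
    forall X, C X -> [/\ fg_module X, ext_van X &
      exists b (X' : lmodType R) (j : {linear X -> 'rV[R]_b}) (p : {linear 'rV[R]_b -> X'}),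
        short_exact j p /\ C X'].

Lemma coresolved_fg M : coresolved M -> fg_module M.
Proof. by case=> C [CM /(_ _ CM)[]]. Qed.

Lemma coresolved_ext M : coresolved M -> ext_van M.
Proof. by case=> C [CM /(_ _ CM)[]]. Qed.

Lemma coresolved_step M : coresolved M ->
  exists b (X' : lmodType R) (j : {linear M -> 'rV[R]_b}) (p : {linear 'rV[R]_b -> X'}),
    short_exact j p /\ coresolved X'.
Proof.
case=> C [CM H]; have [_ _ [b [X' [j [p [se CX']]]]]] := H _ CM.
by exists b, X', j, p; split=> //; exists C.
Qed.

Lemma coresolved_mid (A B C : lmodType R) (i : {linear A -> B}) (p : {linear B -> C}) :
  fg_module B -> short_exact i p -> coresolved A -> coresolved C -> coresolved B.
Proof.
move=> fB se cA cC.
exists (fun X => fg_module X /\ exists (A C : lmodType R) (i : {linear A -> X}) (p : {linear X -> C}),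
  [/\ short_exact i p, coresolved A & coresolved C]).
split; first by split=> //; exists A, C, i, p.
move=> X [fX [A1 [C1 [i1 [p1 [s1 cA1 cC1]]]]]]; split=> //.
  by apply: (ext_van_mid noethR _ fX _ s1); [exact: coresolved_fg|exact: coresolved_fg|exact: coresolved_ext|exact: coresolved_ext].
have [a [A' [jA [pA [sA cA']]]]] := coresolved_step cA1.
have [c [C' [jC [pC [sC cC']]]]] := coresolved_step cC1.
have [b [B' [j [q [i' [p' [s2 s3]]]]]]] :=
  embed_horseshoe noethR (coresolved_fg cC1) (coresolved_ext cC1) s1 sA sC.
exists b, B', j, q; split=> //; split; first exact: embed_fg s2.
by exists A', C', i', p'.
Qed.

Lemma coresolved_sub (M X : lmodType R) b (j : {linear M -> 'rV[R]_b}) (p : {linear 'rV[R]_b -> X}) :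
  short_exact j p -> coresolved X -> coresolved M.
Proof.
move=> se cX; exists (fun Y => Y = M \/ coresolved Y); split; first by left.
move=> Y [->|cY]; last first.
  split; [exact: coresolved_fg|exact: coresolved_ext|].
  by have [c [Y' [j' [p' [s' cY']]]]] := coresolved_step cY; exists c, Y', j', p'; split=> //; right.
have fM : fg_module M by apply: fg_sub noethR (free_fg R b) (se_inj se).
split=> //; first by apply: (ext_van_sub noethR fM se); exact: coresolved_ext.
by exists b, X, j, p; split=> //; right.
Qed.

(** The resolution of a free module concentrated in degree zero. *)
Definition ptF b (i : nat) : lmodType R := if i is 0 then 'rV[R]_b else 'rV[R]_0.

Definition ptd b (i : nat) : {linear ptF b i.+1 -> ptF b i} := \0.

Lemma ptF0 b i : trivial_mod (ptF b i.+1).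
Proof. by move=> x; exact: rV0_zero. Qed.

Lemma pt_res (M : lmodType R) b (e : {linear 'rV[R]_b -> M}) :
  (forall x, e x = 0 -> x = 0) -> (forall y, exists x, y = e x) ->
  @is_res R M (ptF b) (@ptd b) e.
Proof.
move=> je se; split=> //.
- by case=> [|i]; exact: free_projective.
- by case=> [|i]; exact: free_fg.
- by move=> x; split=> [/je ->|[z ->]]; [exists 0|exact: linear0].
by move=> i x; split=> [_|[z ->]//]; exists 0; exact: ptF0.
Qed.

Lemma coresolved_free b : coresolved ('rV[R]_b : lmodType R).
Proof.
exists (fun X => exists k, X = ('rV[R]_k : lmodType R)); split; first by exists b.
move=> _ [k ->]; split; first exact: free_fg.
  apply/(ext_vanP noethR (free_fg R k) (pt_res (e := idfun) (fun x e => e) (fun y => ex_intro _ y erefl))).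
  by move=> i f _; exists \0 => x; rewrite (ptF0 x) linear0.
exists k, 'rV[R]_0, idfun, \0; split; last by exists 0%N.
split=> // [y|z]; first by split=> // _; exists y.
by exists 0; exact: rV0_zero.
Qed.

(** * The Gorenstein dimension *)

(** [G] and [H] are dual to each other under the pairing [b].  A module of
    Gorenstein dimension zero has such a partner, namely its dual; unlike the
    dual, the partner is determined up to isomorphism only, which makes the
    notion symmetric and stable under syzygies. *)
Record dual_pair (G H : lmodType R) (b : G -> H -> R) : Prop := DualPair {
  dp_l : forall y, linear (b^~ y : G -> R^o);
  dp_r : forall x, linear (b x : H -> R^o);
  dp_fgl : fg_module G;
  dp_fgr : fg_module H;
  dp_xl : ext_van G;
  dp_xr : ext_van H;
  dp_repr : forall f : {linear G -> R^o}, exists y, forall x, f x = b x y;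
  dp_sepr : forall y, (forall x, b x y = 0) -> y = 0;
  dp_repl : forall f : {linear H -> R^o}, exists x, forall y, f y = b x y;
  dp_sepl : forall x, (forall y, b x y = 0) -> x = 0 }.

Definition dotr n (y w : 'rV[R]_n) : R := \sum_i y 0 i * w 0 i.

Lemma dotr_r n (y : 'rV[R]_n) : linear (dotr y : 'rV[R]_n -> R^o).
Proof.
move=> a u v; rewrite /dotr scaler_sumr -big_split /=; apply: eq_bigr => i _.
by rewrite !mxE mulrDr mulrCA.
Qed.

Lemma dotrC n (y w : 'rV[R]_n) : dotr y w = dotr w y.
Proof. by apply: eq_bigr => i _; rewrite mulrC. Qed.

Lemma dotr_l n (w : 'rV[R]_n) : linear (fun y => dotr y w : R^o).
Proof. by move=> a u v; rewrite !(dotrC _ w); exact: dotr_r. Qed.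

Lemma dotr_rep n (f : {linear 'rV[R]_n -> R^o}) : exists w, forall y, f y = dotr y w.
Proof.
exists (\row_i f (delta_mx 0 i)) => y; rewrite [in LHS](row_sum_delta y) linear_sum.
by apply: eq_bigr => i _; rewrite linearZ_LR !mxE.
Qed.

Lemma dotr_sep n (w : 'rV[R]_n) : (forall y, dotr y w = 0) -> w = 0.
Proof.
move=> H; apply/rowP => i; rewrite mxE -[LHS]mul1r -[RHS](H (delta_mx 0 i)) /dotr.
rewrite (bigD1 i) //= big1 ?addr0 ?mxE ?eqxx // => k ki.
by rewrite mxE (negPf ki) andbF mul0r.
Qed.

Definition kerm (A B : lmodType R) (f : {linear A -> B}) : lmodType R :=
  submod [set x : A | f x = 0].

Lemma kerv_linear (A B : lmodType R) (f : {linear A -> B}) : linear (val : kerm f -> A).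
Proof. by []. Qed.

Definition kerv (A B : lmodType R) (f : {linear A -> B}) : {linear kerm f -> A} :=
  mkl (@kerv_linear A B f).

Lemma kerv_exact (A B : lmodType R) (f : {linear A -> B}) :
  (forall y, exists x, y = f x) -> short_exact (kerv f) f.
Proof.
move=> sf; split=> // [x e|y]; first by apply: val_inj.
split=> [fy|[x ->]]; last by apply: (span_pred_id (smod_ker f)); exact: valP.
by exists (Sub y (mem_span (fy : [set x | f x = 0] y))); rewrite mklE SubK.
Qed.

Lemma kerv_lift (A B C : lmodType R) (f : {linear B -> C}) (g : {linear A -> B}) :
  (forall x, f (g x) = 0) -> exists h : {linear A -> kerm f}, forall x, kerv f (h x) = g x.
Proof.
move=> fg; have m x : g x \in span_pred [set y | f y = 0] by exact: mem_span.
have lh : linear (fun x => Sub (g x) (m x) : kerm f).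
  by move=> a x y; apply: val_inj; rewrite val_submodP !SubK linearP.
by exists (mkl lh) => x; rewrite !mklE SubK.
Qed.

(** Cover the partner [H] of [G] by a free module.  The pairing then embeds [G]
    into the dual free module, and the cokernel of this embedding is paired with
    the kernel of the cover. *)
Lemma dual_pair_step (G H : lmodType R) (b : G -> H -> R) : dual_pair b ->
  exists n (G' H' : lmodType R) (b' : G' -> H' -> R) (j : {linear G -> 'rV[R]_n})
    (p : {linear 'rV[R]_n -> G'}), short_exact j p /\ dual_pair b'.
Proof.
move=> D; have [n [g sg]] := fg_cover (dp_fgr D).
pose q i := g (delta_mx 0 i).
have gE w : g w = \sum_i w 0 i *: q i.
  by rewrite [in LHS](row_sum_delta w) linear_sum; apply: eq_bigr => i _; rewrite linearZ_LR.
have lj : linear (fun x => \row_i b x (q i) : 'rV[R]_n).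
  move=> a x y; apply/rowP => i; rewrite !mxE; exact: dp_l.
pose j := mkl lj.
have jE x w : dotr (j x) w = b x (g w).
  rewrite gE -[RHS]/(mkl (dp_r D x) _) linear_sum; apply: eq_bigr => i _.
  by rewrite linearZ_LR !mxE mulrC.
have j0 x : j x = 0 -> x = 0.
  move=> e; apply: (dp_sepl D) => y; have [w ->] := sg y.
  by rewrite -jE e -[LHS]/(mkl (@dotr_l n w) 0) linear0.
pose p := cokp j.
have sejp : short_exact j p by split=> // [y|]; [exact: cokpP|exact: cokp_surj].
pose k := kerv g; have sek : short_exact k g := kerv_exact sg.
have gk w : g (k w) = 0 by apply/(se_mid sek); exists w.
pose b' (y : coker j) (w : kerm g) := dotr (repr y) (k w).
have b'E y w : b' (p y) w = dotr y (k w).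
  have /cokpP[x xe] : p (repr (p y) - y) = 0.
    by rewrite linearB /p mklE projK subrr.
  apply/eqP; rewrite -subr_eq0; have := linearB (mkl (@dotr_l n (k w))) (repr (p y)) y.
  by rewrite !mklE => <-; rewrite xe jE gk -[b x 0]/(mkl (dp_r D x) 0) linear0.
exists n, (coker j), (kerm g), b', j, p; split=> //.
have fk : fg_module (kerm g) by apply: fg_sub noethR (free_fg R n) (se_inj sek).
split=> //.
- move=> w a y y'; have [u ->] := cokp_surj y; have [u' ->] := cokp_surj y'.
  by rewrite -linearP !b'E; exact: dotr_l.
- by move=> y a w w'; rewrite /b' linearP; exact: dotr_r.
- exact: embed_fg sejp.
- apply: (ext_van_quot noethR (dp_fgl D) sejp (dp_xl D)) => f.
  have [y yE] := dp_repr D f; have [w we] := sg y.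
  by exists (mkl (@dotr_l n w)) => x; rewrite mklE jE yE we.
- exact: (ext_van_sub noethR fk sek (dp_xr D)).
- move=> f; have [w wE] := dotr_rep (f \o p).
  have [v ve] : exists v, w = k v.
    apply/(se_mid sek); apply: (dp_sepr D) => x; rewrite -jE -wE.
    rewrite -[LHS]/(f (p (j x))) (_ : p (j x) = 0) ?linear0 //.
    by apply/(se_mid sejp); exists x.
  exists v => y; have [u ->] := cokp_surj y.
  by rewrite b'E -ve -wE.
- move=> w H0; apply: (se_inj sek); apply: dotr_sep => y; rewrite -b'E; exact: H0.
- move=> f; have [F FE] := ext_van_extend noethR (dp_fgr D) sek (dp_xr D) f.
  have [y yE] := dotr_rep F; exists (p y) => w.
  by rewrite b'E -FE yE dotrC.
move=> y; have [u ->] := cokp_surj y => H0.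
have [|h hE] := factor_surj (q := g) (f := mkl (@dotr_r n u)) sg.
  by move=> w /(se_mid sek)[v ->]; rewrite mklE -b'E H0.
have [x xE] := dp_repl D h.
apply/(se_mid sejp); exists x; apply/eqP; rewrite -subr_eq0; apply/eqP.
apply: dotr_sep => w; rewrite dotrC.
have := linearB (mkl (@dotr_l n w)) u (j x); rewrite !mklE => ->.
by rewrite jE -xE hE mklE subrr.
Qed.

Lemma dual_pair_coresolved (G H : lmodType R) (b : G -> H -> R) : dual_pair b -> coresolved G.
Proof.
move=> D; exists (fun X : lmodType R => exists (Y : lmodType R) (c : X -> Y -> R), dual_pair c).
split; first by exists H, b.
move=> X [Y [c Dc]]; split; [exact: dp_fgl Dc|exact: dp_xl Dc|].
have [n [G' [H' [b' [j [p [se D']]]]]]] := dual_pair_step Dc.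
by exists n, G', j, p; split=> //; exists H', b'.
Qed.

Lemma subquot_trivial (V : lmodType R) (Z B : set V) : sqpair Z B ->
  trivial_mod (subquot Z B) <-> Z `<=` B.
Proof.
move=> [sZ sB BZ].
have sS : submodule [set x : submod Z | B (val x)].
  exact: (smod_preim (mkl (fun a (x y : submod Z) => erefl (val (a *: x + y))))).
split=> [H v Zv|ZB x].
  have /proj0P := H (proj _ (Sub v (mem_span Zv) : submod Z)).
  by move=> /(_ sS) Bv; have : B (val (Sub v (mem_span Zv) : submod Z)) := Bv; rewrite SubK.
rewrite -(projK x); apply/proj0P => //=; apply: ZB.
by apply: (span_pred_id sZ); exact: valP.
Qed.

Lemma lin_fct0 (A B : lmodType R) : linear ((0 : A -> B) : A -> B).
Proof. by move=> a x y; rewrite -[LHS]/(0 : B) -[RHS]/(a *: 0 + 0) scaler0 addr0. Qed.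

Lemma lin_fctP (A B : lmodType R) a (f g : A -> B) :
  linear f -> linear g -> linear (a *: f + g).
Proof.
move=> lf lg c x y; rewrite -![(a *: f + g) _]/(a *: f _ + g _) lf lg.
by rewrite !scalerDr !scalerA [a * c]mulrC addrACA.
Qed.

Lemma Ext_cocycles_smod n (M N : lmodType R) : submodule (@Ext_cocycles R n M N).
Proof.
split; first by split; [exact: lin_fct0|exact/funext].
move=> a u v [lu u0] [lv v0]; split; first exact: lin_fctP.
apply/funext => x; rewrite -[LHS]/(a *: (u \o res_diff M n) x + (v \o res_diff M n) x).
by rewrite u0 v0 -[LHS]/(a *: 0 + 0) scaler0 addr0.
Qed.

Lemma Ext_ext_van (M : lmodType R) : fg_module M ->
  (forall i, (0 < i)%N -> trivial_mod (Ext i M R^o)) -> ext_van M.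
Proof.
move=> fM E i f fd; have r := mres_is_res noethR fM.
pose Z := @Ext_cocycles R i.+1 M R^o; pose B := @Ext_coboundaries R i.+1 M R^o.
have pZB : sqpair Z B.
  split.
  - exact: Ext_cocycles_smod.
  - split; first by exists 0; [exact: lin_fct0|exact/funext].
    by move=> a _ _ [g lg <-] [h lh <-]; exists (a *: g + h); [exact: lin_fctP|exact/funext].
  move=> _ [g lg <-]; split.
    by move=> a x y /=; rewrite (@res_diff_linear R M i) lg.
  apply/funext => x /=; rewrite -[res_diff M i _]/(mdiff M i (mdiff M i.+1 x)).
  rewrite (_ : mdiff M i _ = 0) ?(linear0 (mkl lg)) //; last exact: res_cplx r _ _.
  exact: (linear0 (mkl lg)).
have [|g lg gE] := (subquot_trivial pZB).1 (E i.+1 isT) (f : _ -> _).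
  split; first exact: linearP.
  by apply/funext => x; exact: fd.
exists (mkl lg) => x; rewrite mklE -[LHS]/((f : _ -> _) x) -gE //.
Qed.

Lemma Gdim_zero_coresolved (G : lmodType R) : Gdim_zero G -> coresolved G.
Proof.
move=> [fG [bi biK Kbi] xG xD].
have vl (h : dual G) : linear (val h : G -> R^o).
  have sl : submodule [set f : G -> R^o | linear f].
    by split; [exact: lin_fct0|move=> a u v; exact: lin_fctP].
  exact: (span_pred_id sl (valP h)).
have fD : fg_module (dual G).
  have [n [g sg]] := fg_cover fG.
  have lr : linear (fun (h : dual G) (i : 'I_n) => (val h (g (delta_mx 0 i)) : R^o)).
    by move=> a x y; apply/funext => i; rewrite val_submodP.
  apply: noeth_fg; apply: (noeth_inj (f := mkl lr)); last exact: noeth_pow (noeth_ring noethR).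
  move=> h e; apply: val_inj; apply/funext => x; have [w ->] := sg x.
  rewrite (row_sum_delta w) linear_sum -[LHS]/(mkl (vl h) _) linear_sum big1 // => i _.
  rewrite !linearZ_LR mklE.
  by have -> : val h (g (delta_mx 0 i)) = 0; [exact: (congr1 (fun u => u i) e)|exact: scaler0].
apply: (@dual_pair_coresolved G (dual G) (fun x h => val h x : R)); apply: DualPair.
- exact: vl.
- by move=> x a g h; exact: (congr1 (fun h : G -> R^o => h x) (val_submodP a g h)).
- exact: fG.
- exact: fD.
- exact: Ext_ext_van fG xG.
- exact: Ext_ext_van fD xD.
- move=> f.
  have lf : [set h : G -> R^o | linear h] (f : G -> R^o) by exact: linearP.
  by exists (Sub (f : G -> R^o) (mem_span lf)) => x; rewrite SubK.
- by move=> h h0; apply: val_inj; apply/funext.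
- move=> f.
  have lf : [set h : dual G -> R^o | linear h] (f : dual G -> R^o) by exact: linearP.
  pose F : dual (dual G) := Sub (f : dual G -> R^o) (mem_span lf).
  exists (bi F) => h; have e0 := congr1 (fun u : dual (dual G) => val u h) (Kbi F).
  have FE : val F h = f h by rewrite /F SubK.
  by rewrite -FE; exact: esym e0.
move=> x x0; rewrite -(biK x) -(biK 0); congr bi; apply: val_inj; apply/funext => h /=.
exact: (etrans (x0 h) (esym (linear0 (mkl (vl h))))).
Qed.

(** * Approximation by totally reflexive modules *)

Definition fpd n (M : lmodType R) : Prop :=
  exists (F : nat -> lmodType R) (d : forall i, {linear F i.+1 -> F i}) (e : {linear F 0 -> M}),
    is_res d e /\ forall i, (n < i)%N -> trivial_mod (F i).

Lemma fpd_embed n (M M' : lmodType R) b (j : {linear M -> 'rV[R]_b}) (p : {linear 'rV[R]_b -> M'}) :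
  short_exact j p -> fpd n M -> fpd n.+1 M'.
Proof.
move=> se [F [d [e [r F0]]]]; exists (consF F 'rV[R]_b), (consd d e j), p.
by split; [exact: embed_res|case=> // i ni; exact: F0].
Qed.

Lemma fpd_fg n M : fpd n M -> fg_module M.
Proof.
by move=> [F [d [e [r _]]]]; apply: fg_img noethR (res_fg r 0%N) (res_aug r).
Qed.

Lemma fpd_cosyz n J M L : fpd n M -> cosyz J M L -> exists n', fpd n' L.
Proof.
elim: J n M => [n M fM <-|J IH n M fM [b [M' [j [p [se c]]]]]]; first by exists n.
exact: IH (fpd_embed se fM) c.
Qed.

Lemma coker_exact (A B : lmodType R) (f : {linear A -> B}) :
  (forall x, f x = 0 -> x = 0) -> short_exact f (cokp f).
Proof. by move=> jf; split=> // [y|]; [exact: cokpP|exact: cokp_surj]. Qed.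

(** Approximate the kernel of [G_0 -> M] by [X1 -> kernel], embed [X1] into a
    free module with totally reflexive cokernel [X1'], and let [X] be the
    pushout of this embedding and of [X1 -> G_0].  It is an extension of [X1']
    by [G_0], hence totally reflexive, and it maps onto [M]; the kernel is the
    cokernel of the composite [H1 -> X1 -> R^b]. *)
Lemma approximation n (M : lmodType R) : resolution (@Gdim_zero R) M n ->
  exists (H X : lmodType R) (i : {linear H -> X}) (p : {linear X -> M}) k,
    [/\ short_exact i p, coresolved X & fpd k H].
Proof.
elim: n M => [|n IH] M [G [d [e [Gz G0 se ex0 exS]]]].
  exists 'rV[R]_0, (G 0%N), \0, e, 0%N; split.
  - split=> [x _|y|y]; first exact: rV0_zero.
      split=> [ey|[x ->]]; last exact: linear0.
      have : range (d 0%N) y by rewrite ex0.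
      by case=> x _ <-; exists 0; rewrite (G0 1%N isT x) !linear0.
    by have : range e y by [rewrite se]; case=> x _ <-; exists x.
  - by apply: Gdim_zero_coresolved; apply: Gz.
  exists (ptF 0), (@ptd 0), idfun; split; last by case=> // i _; exact: ptF0.
  by apply: pt_res => // y; exists y.
have se' y : exists x, y = e x by have : range e y by [rewrite se]; case=> x _ <-; exists x.
pose k := kerv e; have sek : short_exact k e := kerv_exact se'.
have ed x : e (d 0%N x) = 0 by have : range (d 0%N) (d 0%N x) by [exists x]; rewrite ex0.
have [d1 d1E] := kerv_lift ed.
have [|H1 [X1 [i1 [p1 [m [s1 cX1 fH1]]]]]] := IH (kerm e).
  exists (fun i => G i.+1), (fun i => d i.+1), d1; split=> //.
  - by move=> i ni; exact: Gz.
  - by move=> i ni; exact: G0.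
  - apply/seteqP; split=> // y _.
    have : range (d 0%N) (kerv e y) by rewrite ex0; apply/(se_mid sek); exists y.
    case=> x _ xy; exists x => //; apply/eqP; rewrite -subr_eq0; apply/eqP.
    by apply: (se_inj sek); rewrite linearB d1E xy subrr.
  rewrite exS; apply/seteqP; split=> x /= x0.
    by apply: (se_inj sek); rewrite d1E.
  by rewrite -d1E x0 linear0.
have [b [X1' [j [q [s2 cX1']]]]] := coresolved_step cX1.
have fG0 : fg_module (G 0%N) by case: (Gz 0%N isT).
have lphi : linear (fun x => (k (p1 x), - j x) : (G 0%N * 'rV[R]_b)%type).
  by move=> a x y; congr pair; rewrite /= !linearP // opprD scalerN.
pose phi := mkl lphi; pose X := coker phi; pose c := cokp phi.
have cphi x : c (k (p1 x), - j x) = 0 by apply/cokpP; exists x.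
have kp x : e (k (p1 x)) = 0 by apply/(se_mid sek); exists (p1 x).
have [||r rE] := factor_surj (q := c) (f := copair e \0); first exact: cokp_surj.
  by move=> y /cokpP[x ->]; rewrite -[LHS]/(e (k (p1 x)) + 0) kp addr0.
have rE' g u : r (c (g, u)) = e g by rewrite rE -[LHS]/(e g + 0) addr0.
have [||t tE] := factor_surj (q := c) (f := copair \0 q); first exact: cokp_surj.
  move=> y /cokpP[x ->]; rewrite -[LHS]/(0 + q (- j x)) add0r linearN.
  by rewrite (_ : q (j x) = 0) ?oppr0 //; apply/(se_mid s2); exists x.
have tE' g u : t (c (g, u)) = q u by rewrite tE -[LHS]/(0 + q u) add0r.
have cB g g' u u' : c (g, u) = c (g', u') <-> exists x, g - g' = k (p1 x) /\ u - u' = - j x.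
  have -> : (c (g, u) = c (g', u')) <-> c (g - g', u - u') = 0.
    rewrite -[(g - g', u - u')]/((g, u) - (g', u')) linearB.
    by split=> [->|/eqP]; [rewrite subrr|rewrite subr_eq0 => /eqP].
  split=> [/cokpP[x [-> ->]]|[x [-> ->]]]; [by exists x|exact: cphi].
have sX : short_exact (c \o inj1 _ _) t.
  split=> [g e0|y|z].
  - have : c (g, 0) = c (0, 0) by rewrite -[c (g, 0)]/((c \o inj1 _ _) g) e0 linear0.
    move=> /cB[x []]; rewrite !subr0 => -> /esym/eqP; rewrite oppr_eq0 => /eqP/(se_inj s2) ->.
    by rewrite !linear0.
  - have [[g u] ->] := cokp_surj y; rewrite tE'; split=> [/(se_mid s2)[x ux]|[g' e0]].
      exists (g + k (p1 x)); apply/cB; exists (- x).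
      by rewrite !linearN opprK subr0 opprD addrA subrr sub0r.
    have e1 : c (g, u) = c (g', 0) := e0.
    by rewrite -(tE' g u) e1 tE' linear0.
  by have [u ->] := se_surj s2 z; exists (c (0, u)); rewrite tE'.
have fX : fg_module X.
  apply: fg_img noethR (fg_pair noethR fG0 (free_fg R b)) (@cokp_surj _ _ _ phi).
have cX := coresolved_mid fX sX (Gdim_zero_coresolved (Gz 0%N isT)) cX1'.
pose H := coker (j \o i1); have jH := coker_exact (f := j \o i1).
have sH : short_exact (j \o i1) (cokp (j \o i1)).
  by apply: jH => x /(se_inj s2)/(se_inj s1).
have [||h hE] := factor_surj (q := cokp (j \o i1)) (f := c \o inj2 _ _); first exact: cokp_surj.
  move=> u /cokpP[x ->]; rewrite -[LHS]/(c (0, j (i1 x))) -(linear0 c).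
  apply/cB; exists (- i1 x); rewrite !linearN !subr0 opprK.
  by rewrite (_ : p1 (i1 x) = 0) ?linear0 ?oppr0 //; apply/(se_mid s1); exists x.
have hE' u : h (cokp (j \o i1) u) = c (0, u) := hE u.
exists H, X, h, r, m.+1; split=> //; last exact: fpd_embed sH fH1.
split=> [y|y|z].
- have [u ->] := cokp_surj y; rewrite hE' -(linear0 c) => /cB[x []].
  rewrite !subr0 => /esym/(se_inj sek)/(se_mid s1)[w ->] ->.
  by apply/cokpP; exists (- w); rewrite linearN.
- have [[g u] ->] := cokp_surj y; rewrite rE'; split=> [/(se_mid sek)[w ->]|[z]].
    have [x ->] := se_surj s1 w; exists (cokp (j \o i1) (u + j x)); rewrite hE'.
    by apply/cB; exists x; rewrite subr0 opprD addrA subrr sub0r.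
  by have [v ->] := cokp_surj z; rewrite hE' => /cB[x []]; rewrite subr0 => ->; rewrite kp.
by have [g ->] := se' z; exists (c (g, 0)); rewrite rE'.
Qed.

End TotallyReflexive.

(** * Regular sequences *)

Section DepthDge.
Variable R : comNzRingType.
Hypotheses (noethR : noetherian_ring R) (localR : local_ring R).
Local Notation mx := (max_ideal R).

Section OneModule.
Variable V : lmodType R.
Hypothesis nV : noeth V.

Definition qmuls (U : set V) (s : seq R) : set V :=
  foldl (fun U a => qmul a setT U) U s.

Lemma span_ideal_mul s : span_set (ideal_mul (M := V) s) = qmuls [set 0] s.
Proof.
elim/last_ind: s => [|s a IH].
  apply/seteqP; split; last by move=> _ ->; exact: smod0 (submodule_span _).
  by apply: span_sub; [exact: smod00|move=> v [a [w []]]].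
rewrite /qmuls -cats1 foldl_cat /= -/(qmuls _ _) -IH cats1; apply/seteqP; split.
  apply: span_sub.
    by apply: smod_add; [exact: submodule_span|exact: smod_scale (@smodT _ V)].
  move=> _ [c [w [+ ->]]]; rewrite mem_rcons inE => /orP[/eqP ->|cs].
    by apply: addm_r; [exact: submodule_span|exists w].
  apply: addm_l; first exact: smod_scale (@smodT _ V).
  by apply: span_incl; exists c, w.
move=> _ /qmulE[u [w [Su _ ->]]]; apply: (smodD (submodule_span _)).
  apply: (span_setS _ Su) => _ [c [w' [cs ->]]].
  by exists c, w'; rewrite mem_rcons inE cs orbT.
by apply: span_incl; exists a, w; rewrite mem_rcons inE eqxx.
Qed.

Lemma proj0span (S : set V) v : proj S v = 0 <-> span_set S v.
Proof.
have p0 : proj S 0 = 0 by apply: (addrI (proj S 0)); rewrite -projD !addr0.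
split=> [|Sv]; rewrite -p0.
  by move=> /projP; rewrite subr0 => /asboolP.
by apply/projP; rewrite subr0; apply/asboolP.
Qed.

Lemma dge_seqP n U : dge n setT U <-> exists s, [/\ size s = n, forall a, a \in s -> mx a &
  forall i, (i < n)%N -> sqreg (nth 0 s i) setT (qmuls U (take i s))].
Proof.
elim: n U => [|n IH] U; first by split=> // _; exists [::].
split=> [[a [ma ra /IH[s [ss ms rs]]]]|[[|a s] [ss ms rs]] //].
  exists (a :: s); split=> [|b|[|i] lt] //=; first by rewrite ss.
    by rewrite inE => /orP[/eqP ->|/ms].
  exact: rs.
exists a; split; first by apply: ms; rewrite inE eqxx.
  exact: (rs 0%N).
apply/IH; exists s; split=> [|b bs|i lt]; first by case: ss.
  by apply: ms; rewrite inE bs orbT.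
exact: (rs i.+1).
Qed.

Lemma qmuls_proper U s : submodule U -> U <> setT -> (forall a, a \in s -> mx a) ->
  qmuls U s <> setT.
Proof.
elim: s U => //= a s IH U sU neU ms; apply: IH.
- by apply: smod_add => //; exact: smod_scale (@smodT _ V).
- move=> e; apply: neU; apply: (nakayama noethR localR nV (@smodT _ V) sU) e => //.
  by apply: ms; rewrite inE eqxx.
by move=> b bs; apply: ms; rewrite inE bs orbT.
Qed.

Lemma regular_seq_dge s : regular_seq V s -> dge (size s) [set: V] [set 0].
Proof.
move=> [ms rs _]; apply/dge_seqP; exists s; split=> // i lt v _ H.
rewrite -span_ideal_mul in H *; apply/proj0span; apply: (rs _ lt).
by have := linearZ_LR (mkl (@proj_linear R V (ideal_mul (take i s)))) s`_i v; rewrite !mklE => <-; apply/proj0span.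
Qed.

Lemma dge_regular_seq n : ~ trivial_mod V -> dge n [set: V] [set 0] ->
  exists s, regular_seq V s /\ size s = n.
Proof.
move=> V0 /dge_seqP[s [ss ms rs]]; exists s; split=> //; split=> // [i lt v|tr].
  rewrite -(projK v) => H; apply/proj0span; rewrite span_ideal_mul.
  apply: rs => //; rewrite -?ss // -span_ideal_mul; apply/proj0span.
  by have := linearZ_LR (mkl (@proj_linear R V (ideal_mul (take i s)))) s`_i (repr v); rewrite !mklE => ->.
have ne : [set 0 : V] <> setT.
  by move=> e; apply: V0 => v; have : [set: V] v by []; rewrite -e.
apply: (qmuls_proper (@smod00 R V) ne ms); apply/seteqP; split=> // v _.
by rewrite -span_ideal_mul; apply/proj0span.
Qed.

Lemma hasdep_depth n : hasdep [set: V] [set 0] n -> depth V = ((n%:R : RR)%:E)%E.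
Proof.
move=> h; have V0 : ~ trivial_mod V.
  by move=> tr; apply: (hasdep_neq localR h); apply/seteqP; split=> // v _; exact: tr.
rewrite /depth asboolF //; apply/eqP; rewrite eq_le; apply/andP; split.
  apply: ge_ereal_sup => _ [s rs <-]; rewrite lee_fin ler_nat.
  by apply/(hasdep_dge _ h); exact: regular_seq_dge.
have [s [rs ss]] := dge_regular_seq V0 h.1.
by apply: ereal_sup_ubound; exists s => //; rewrite ss.
Qed.

Lemma nontriv_hasdep : ~ trivial_mod V -> exists n, hasdep [set: V] [set 0] n.
Proof.
move=> V0; apply: (hasdep_ex noethR localR nV); first exact: pair_full.
by move=> e; apply: V0 => v; have : [set: V] v by []; rewrite -e.
Qed.

Lemma depth_hasdep n : depth V = ((n%:R : RR)%:E)%E -> hasdep [set: V] [set 0] n.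
Proof.
move=> e; have [tr|/nontriv_hasdep[k hk]] := pselect (trivial_mod V).
  by move: e; rewrite /depth asboolT.
have := hasdep_depth hk; rewrite e => -[/eqP].
by rewrite eqr_nat => /eqP ->.
Qed.

End OneModule.

(** * Totally reflexive modules of full depth *)

Lemma noeth_subquot (V : lmodType R) (Z B : set V) : noeth V -> noeth (subquot Z B).
Proof.
move=> nV.
apply: (noeth_surj (f := mkl (@proj_linear R (submod Z) [set x : submod Z | B (val x)]))).
  by move=> y; exists (repr y); rewrite mklE projK.
apply: (noeth_inj (f := mkl (fun a (x y : submod Z) => erefl (val (a *: x + y))))) nV.
by move=> x e; apply: val_inj.
Qed.

Lemma se_pses (A B C : lmodType R) (i : {linear A -> B}) (p : {linear B -> C}) :
  short_exact i p -> pses i p [set: A] [set 0] [set: B] [set 0] [set: C] [set 0].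
Proof.
move=> se; split=> //; try exact: pair_full.
- by move=> x _; split=> [/(se_inj se)|->]; rewrite ?linear0.
- move=> y _; split=> [/(se_mid se)[x ->]|[x [_ /eqP]]]; first by exists x; rewrite subrr.
  by rewrite subr_eq0 => /eqP ->; apply/(se_mid se); exists x.
by move=> z _; have [y ->] := se_surj se z; exists y; rewrite subrr.
Qed.

Lemma tens1_piso (A : lmodType R) :
  piso (tens1 A) [set: tensor A R^o] [set 0] [set: A] [set 0].
Proof.
split=> // [t _|y _].
  split=> [e|->]; last exact: linear0.
  have e' : tens1 A t = 0 := e; rewrite -(tens1K t) e'.
  exact: (linear0 (mkl (@tens_linl R A R^o (1 : R^o)))).
by exists (tens y (1 : R^o)); split=> //; rewrite tens1E scale1r subrr.
Qed.

Lemma free_dge n b : dge n [set: R^o] [set 0] -> dge n [set: 'rV[R]_b] [set 0].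
Proof.
move=> d; apply/(piso_dge n (pair_full _) (pair_full _) (tens1_piso _)).
exact: tensor_free_dge.
Qed.

Lemma coresolved_dge n (M : lmodType R) : coresolved M -> dge n [set: R^o] [set 0] -> dge n [set: M] [set 0].
Proof.
elim: n M => // n IH M cM d; have [b [X' [j [p [se cX']]]]] := coresolved_step cM.
have nX' : noeth X' by exact: (fg_noeth noethR (coresolved_fg cX')).
apply: (dge_left noethR localR (@free_noeth R noethR b) nX' (se_pses se)).
- exact: free_dge.
by apply: IH => //; exact: dgeS.
Qed.

(** Embed [X] into a free module.  The composite of the two embeddings is
    injective modulo the maximal ideal, hence split, so that [M] is a direct
    summand of [X]. *)
Lemma coresolved_quotient (X M : lmodType R) b r (i : {linear 'rV[R]_b -> X}) (p : {linear X -> M}) :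
  short_exact i p -> coresolved X -> hasdep [set: R^o] [set 0] r ->
  dge r [set: M] [set 0] -> coresolved M.
Proof.
move=> se cX dR dM; have [c [X' [j [q [s cX']]]]] := coresolved_step cX.
have nR := noeth_ring noethR.
have nX : noeth X by exact: (fg_noeth noethR (coresolved_fg cX)).
have fM : fg_module M by exact: fg_img noethR (coresolved_fg cX) (se_surj se).
pose f : {linear 'rV[R]_b -> 'rV[R]_c} := j \o i.
have fE x : f x = j (i x) by [].
have pi x : p (i x) = 0 by apply/(se_mid se); exists x.
have pX : sqpair [set: X] (range i) by split=> //; exact: smod_range.
have pf : sqpair [set: 'rV[R]_c] (range f) by split=> //; exact: smod_range.
have S1 : pses j q setT (range i) setT (range f) setT [set 0].
  split=> //; try exact: pair_full.
  - move=> x _; split=> [[w _ e]|[w _ <-]]; last by exists w.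
    by exists w => //; apply/eqP; rewrite -subr_eq0; apply/eqP; apply: (se_inj s); rewrite linearB -[j (i w)]/(f w) e subrr.
  - move=> y _; split=> [/(se_mid s)[x ->]|[x [_ [w _ e]]]].
      by exists x; rewrite subrr; split=> //; exact: smod0 (smod_range f).
    apply/(se_mid s); exists (x + i w); rewrite linearD -fE e addrC subrK //.
  by move=> z _; have [y ->] := se_surj s z; exists y; rewrite subrr.
have df : dge r setT (range f).
  apply: (dge_mid noethR localR nX _ S1).
  - exact: (fg_noeth noethR (coresolved_fg cX')).
  - have i1 : piso p setT (range i) setT [set 0].
      split=> // [v _|w _].
        by split=> [/(se_mid se)[x ->]|[x _ <-]]; [exists x|exact: pi].
      by have [v ->] := se_surj se w; exists v; rewrite subrr.
    by apply/(piso_dge r pX (pair_full M) i1).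
  exact: coresolved_dge cX' dR.1.
have jf x : f x = 0 -> x = 0 by move=> /(se_inj s)/(se_inj se).
have Tf t : tens1 _ (tmap R^o f t) = f (tens1 _ t) by exact: tens1_nat.
have t0 b' (t : tensor 'rV[R]_b' R^o) : tens1 _ t = 0 -> t = 0.
  by move=> e; apply/(piso_inj (tens1_piso 'rV[R]_b') (v := t)).
have S2 : pses (tmap R^o f) (tens1 _) setT [set 0] setT [set 0] setT (range f).
  split=> //; try exact: pair_full.
  - move=> t _; split=> [e|->]; last exact: linear0.
    by apply: t0; apply: jf; rewrite -Tf e linear0.
  - move=> t _; split=> [[x _ xe]|[u [_ /eqP]]].
      exists (tens x (1 : R^o)); split=> //; apply: t0.
      by rewrite linearB Tf tens1E scale1r xe subrr.
    by rewrite subr_eq0 => /eqP ->; rewrite Tf; exists (tens1 _ u).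
  move=> z _; exists (tens z (1 : R^o)); split=> //.
  by rewrite tens1E scale1r subrr; exact: smod0 (smod_range f).
have dT : dge r [set: tensor 'rV[R]_b R^o] [set 0] by exact: tensor_free_dge dR.1.
(* Take [N = R]: the map [f] has no kernel and its cokernel has full depth. *)
have inj := inj_mod_tensor noethR localR nR nR (@noeth_tensor_free R R^o b nR) (@free_noeth R noethR c)
  (@pses_id R R^o _) S2 (fun t => erefl) dR (dge_zero localR _ _) dT df.
have [g gf] := split_mod_max noethR localR inj.
pose rho : {linear X -> 'rV[R]_b} := g \o j.
have rhoE x : rho x = g (j x) by [].
have ri x : rho (i x) = x by rewrite rhoE -fE.
(* The retraction [rho] of [i] makes [M] a direct summand of [X]. *)
have [||sg sgE] := factor_surj (q := p) (f := idfun \- (i \o rho)).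
- exact: (se_surj se).
- by move=> x /(se_mid se)[w ->]; rewrite -[LHS]/(i w - i (rho (i w))) ri subrr.
have sgE' x : sg (p x) = x - i (rho x) by exact: sgE.
have ss : short_exact sg rho.
  split=> [m|y|z].
  - by have [x ->] := se_surj se m; rewrite sgE' => /eqP; rewrite subr_eq0 => /eqP ->.
  - split=> [y0|[m]]; first by exists (p y); rewrite sgE' y0 linear0 subr0.
    by have [x ->] := se_surj se m; rewrite sgE' => ->; rewrite linearB ri subrr.
  by exists (i z); rewrite ri.
pose jm : {linear M -> 'rV[R]_c} := j \o sg.
have jmE m : jm m = j (sg m) by [].
have sjm : short_exact jm (cokp jm).
  by apply: coker_exact => m; rewrite jmE => /(se_inj s)/(se_inj ss).
have [||u uE] := factor_surj (q := rho) (f := cokp jm \o j).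
- exact: (se_surj ss).
- by move=> x /(se_mid ss)[m ->]; apply/cokpP; exists m.
have uE' x : u (rho x) = cokp jm (j x) by exact: uE.
have [||v vE] := factor_surj (q := cokp jm) (f := q).
- exact: cokp_surj.
- by move=> x /cokpP[m ->]; apply/(se_mid s); exists (sg m).
have suv : short_exact u v.
  split=> [z|y|z].
  - have [x ->] := se_surj ss z; rewrite uE' => /cokpP[m]; rewrite jmE => e.
    apply/(se_mid ss); exists m; apply/eqP; rewrite -subr_eq0; apply/eqP.
    by apply: (se_inj s); rewrite linearB e subrr.
  - have [w ->] := cokp_surj y; rewrite vE; split=> [/(se_mid s)[x ->]|[z]].
      by exists (rho x); rewrite uE'.
    have [x ->] := se_surj ss z; rewrite uE' => e.
    have : cokp jm (w - j x) = 0 by rewrite linearB e subrr.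
    move=> /cokpP[m]; rewrite jmE => e2; apply/(se_mid s); exists (sg m + x).
    by rewrite linearD -e2 subrK.
  by have [w ->] := se_surj s z; exists (cokp jm w); rewrite vE.
apply: (coresolved_sub noethR sjm); apply: (coresolved_mid noethR _ suv) => //.
  exact: (embed_fg noethR sjm).
exact: coresolved_free noethR b.
Qed.

(** The case of full depth of the Auslander-Bridger formula.  In an
    approximation [0 -> H -> X -> M -> 0] the module [H] then has full depth as
    well, so that it is free by the Auslander-Buchsbaum formula. *)
Lemma Gdim_full_depth n r (M : lmodType R) : resolution (@Gdim_zero R) M n ->
  hasdep [set: R^o] [set 0] r -> dge r [set: M] [set 0] -> coresolved M.
Proof.
move=> /(approximation noethR)[H [X [i [p [k [se cX fH]]]]]] dR dM.
suff [b [u [ju su]]] : exists b (u : {linear 'rV[R]_b -> H}),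
    (forall x, u x = 0 -> x = 0) /\ forall y, exists x, y = u x.
  have se' : short_exact (i \o u) p; last exact: (coresolved_quotient se' cX dR dM).
  split.
  - by move=> x /(se_inj se)/ju.
  - move=> y; rewrite (se_mid se); split=> -[x ->]; last by exists (u x).
    by have [w ->] := su x; exists w.
  exact: (se_surj se).
have fgH := fpd_fg noethR fH.
have [tr|nt] := pselect (trivial_mod H).
  exists 0%N, \0; split=> [x _|y]; first exact: rV0_zero.
  by exists 0; rewrite (tr y).
have [F [d [e [rs F0]]]] := fH.
have [q m] := fpd_mfree noethR localR fgH nt (fpd_betti noethR localR fgH rs F0).
have [t [tq dt]] := auslander_buchsbaum noethR localR m dR.
have dH : dge r [set: H] [set 0].
  case: r dR dM {tq dt} => [//|r] dR dM.
  have nX : noeth X by exact: (fg_noeth noethR (coresolved_fg cX)).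
  have nM := noeth_surj (se_surj se) nX.
  apply: (dge_left noethR localR nX nM (se_pses se)); last exact: dgeS.
  exact: coresolved_dge cX dR.1.
have q0 : q = 0%N.
  have := (hasdep_dge r dt).1 dH; rewrite -tq -[X in (_ <= X)%N]addn0 leq_add2l leqn0.
  by move/eqP.
have [r' _ _ b0] := m; rewrite q0 in b0.
exists (betti H 0), (maug H); split=> [x /(res_ex0 r')[z ->]|]; last exact: (res_aug r').
suff -> : z = 0 by rewrite linear0.
apply/rowP => -[l ll]; exfalso; suff : (l < 0)%N by [].
by rewrite -(b0 1%N isT).
Qed.

End DepthDge.

(** * The exact sequence of an extension class *)

Section Reduction.
Variable R : comNzRingType.
Hypotheses (noethR : noetherian_ring R) (localR : local_ring R).
Local Notation mx := (max_ideal R).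

Lemma syzygy_cosyz n (M : lmodType R) : fg_module M ->
  exists (C : lmodType R) (q : {linear free_mod M n -> C}),
    [/\ forall y, exists x, y = q x, forall x, q x = 0 <-> exists z, x = mdiff M n z &
      cosyz n C M].
Proof.
move=> fM; have r := mres_is_res noethR fM.
elim: n => [|n [C [q [sq kq c]]]].
  by exists M, (maug M); split=> //; [exact: (res_aug r)|exact: (res_ex0 r)].
exists (coker (mdiff M n.+1)), (cokp (mdiff M n.+1)); split.
- exact: cokp_surj.
- exact: cokpP.
have [||j jE] := factor_surj (q := cokp (mdiff M n.+1)) (f := mdiff M n).
- exact: cokp_surj.
- by move=> x /cokpP/(res_exS r).
exists (betti M n), C, j, q; split=> //; split=> [y|y|//].
  have [x ->] := cokp_surj y; rewrite jE => /(res_exS r)[z ->].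
  by apply/cokpP; exists z.
rewrite kq; split=> -[x ->]; first by exists (cokp (mdiff M n.+1) x); rewrite jE.
by have [z ->] := cokp_surj x; exists z; rewrite jE.
Qed.

(** Let the cocycle [f] on [F_(n+1)] represent the class.  The module [K] is the
    cokernel of [(f, - d) : F_(n+1) -> M * F_n], so [F_n -> C] extends to it, and
    [M] embeds because [f] vanishes where [d] does. *)
Lemma K_exact n (M : lmodType R) (eta : Ext n.+1 M M) : fg_module M ->
  exists (C : lmodType R) (q : {linear free_mod M n -> C})
    (i : {linear M -> K_mod eta}) (p : {linear K_mod eta -> C}),
  [/\ short_exact i p, cosyz n C M &
      @is_res R C (fun i => free_mod M (i + n)) (fun i => mdiff M (i + n)) q].
Proof.
move=> fM; have r := mres_is_res noethR fM.
have [C [q [sq kq c]]] := syzygy_cosyz n fM.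
have [lf fd] : @Ext_cocycles R n.+1 M M (val (repr eta)).
  exact: (span_pred_id (Ext_cocycles_smod _ _ _) (valP (repr eta))).
pose f := mkl lf.
have fdE z : f (mdiff M n.+1 z) = 0 by have := congr1 (fun h => h z) fd.
have lpsi : linear (fun y => (f y, - mdiff M n y) : (M * free_mod M n)%type).
  move=> a x y; congr pair; first exact: linearP.
  by rewrite (linearP (mdiff M n)) opprD -scalerN.
pose psi := mkl lpsi.
have psiE y : psi y = (f y, - mdiff M n y) by [].
(* The map [Ext_map] is defined by representatives, which are determined up to
   boundaries. *)
have rp y : exists z, repr (proj (range (res_diff M n.+1)) y) = y + mdiff M n.+1 z.
  have : proj (range (res_diff M n.+1)) (repr (proj (range (res_diff M n.+1)) y) - y) = 0.
    have := linearB (mkl (@proj_linear R _ (range (res_diff M n.+1))))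
      (repr (proj (range (res_diff M n.+1)) y)) y.
    by rewrite !mklE projK subrr.
  move=> /(proj0P _ (smod_range (mdiff M n.+1)))[z _ ze].
  by exists z; apply/eqP; rewrite addrC -subr_eq; apply/eqP/esym.
have KE : K_mod eta = coker psi.
  rewrite /K_mod /pushout /coker.
  suff -> : [set p | exists a : syzygy M n.+1, p = (Ext_map eta a, - syz_incl M n a)]
    = range psi by [].
  apply/seteqP; split=> [_ [a ->]|_ [y _ <-]]; first by exists (repr a).
  exists (proj _ y); rewrite -[RHS]/(psi (repr (proj (range (res_diff M n.+1)) y))).
  have [z ->] := rp y; rewrite !psiE (linearD f) (linearD (mdiff M n)) fdE (res_cplx r).
  by rewrite !addr0.
rewrite KE.
have [||p pE] := factor_surj (q := cokp psi) (f := copair \0 q).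
- exact: cokp_surj.
- move=> x /cokpP[y ->]; rewrite psiE -[LHS]/(0 + q (- mdiff M n y)) linearN add0r.
  by rewrite (_ : q _ = 0) ?oppr0 //; apply/kq; exists y.
have pE' x w : p (cokp psi (x, w)) = q w by rewrite pE -[LHS]/(0 + q w) add0r.
exists C, q, (cokp psi \o inj1 _ _), p; split=> //; last exact: (shift_res r sq kq).
split=> [x|y|z].
- move=> /cokpP[y]; rewrite psiE => -[-> /esym/eqP]; rewrite oppr_eq0 => /eqP.
  by move=> /(res_exS r)[z ->]; exact: fdE.
- have [[x w] ->] := cokp_surj y; rewrite pE'; split=> [/kq[v ->]|[x']].
    exists (x + f v); apply/eqP; rewrite -subr_eq0 -[X in _ - X]/(cokp psi (x + f v, 0)) -linearB.
    apply/eqP/cokpP; exists (- v); rewrite linearN psiE.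
    by congr pair; rewrite /= ?opprK ?subr0 // opprD addrA subrr sub0r.
  by move=> e; rewrite -(pE' x w) e -[X in p X]/(cokp psi (x', 0)) pE' linear0.
by have [w ->] := sq z; exists (cokp psi (0, w)); rewrite pE'.
Qed.

Lemma proj_dim_fpd (M : lmodType R) : (proj_dim M < +oo)%E -> exists n, fpd n M.
Proof.
move=> pd; have [[n [G [d [e [Gz G0 se ex0 exS]]]]]|nr] := pselect (exists n,
    resolution (fun P : lmodType R => fg_module P /\ projective P) M n); last first.
  move: pd; rewrite /proj_dim (_ : [set _ | _ in _] = set0) ?ereal_inf0 ?ltxx //.
  by apply/seteqP; split=> [y [n rn _]|//]; apply: nr; exists n.
have Gz' i : fg_module (G i) /\ projective (G i).
  have [|/G0 tr] := leqP i n; first exact: Gz.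
  split; first by exists [::]; apply/seteqP; split=> // x _; rewrite (tr x); exact: smod0 (submodule_span _).
  by move=> A B p f _; exists \0 => x; rewrite (tr x) !linear0.
exists n, G, d, e; split=> //; split.
- by move=> i; case: (Gz' i).
- by move=> i; case: (Gz' i).
- by move=> y; have : range e y by [rewrite se]; case=> x _ <-; exists x.
- move=> x; have -> : (e x = 0) = range (d 0%N) x by rewrite ex0.
  by split=> [[z _ <-]|[z ->]]; exists z.
move=> i x; have -> : (d i x = 0) = range (d i.+1) x by rewrite exS.
by split=> [[z _ <-]|[z ->]]; exists z.
Qed.

(** * Vanishing of Tor on cosyzygies *)

Lemma tor_van_trivial N i (M : lmodType R) : fg_module M -> trivial_mod M -> tor_van N i M.
Proof.
move=> fM M0; have r : is_res (@ptd R 0) (\0 : {linear 'rV[R]_0 -> M}).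
  by apply: pt_res => [x _|y]; [exact: rV0_zero|exists 0; exact: M0].
apply/(tor_vanP noethR N i fM r) => t _; exists 0 => //.
rewrite linear0; symmetry; apply: tensor_zero.
by case: i t => [|i] t; [exact: rV0_zero|exact: ptF0].
Qed.

(** Such a module is free.  A coordinate of the last term of its minimal
    resolution is a cocycle; if that term were in positive degree, the
    coordinate would factor through the differential, whose entries lie in the
    maximal ideal. *)
Lemma fpd_ext_van_tor N n (L : lmodType R) : fpd n L -> ext_van L -> forall i, tor_van N i.+1 L.
Proof.
move=> fL xL i; have fgL := fpd_fg noethR fL.
have [L0|nL] := pselect (trivial_mod L); first exact: tor_van_trivial.
have [F [d [e [r F0]]]] := fL.
have [p [rp dm bp b0]] := fpd_mfree noethR localR fgL nL (fpd_betti noethR localR fgL r F0).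
case: p bp b0 => [|p] bp b0.
  move=> t _; exists 0 => //; rewrite linear0; symmetry; apply: tensor_zero => x.
  by move: x; rewrite /free_mod b0 // => x; exact: rV0_zero.
have lc : linear (fun x : free_mod L p.+1 => x 0 (Ordinal bp) : R^o).
  by move=> a x y; rewrite !mxE.
have [|h hE] := xL p (mkl lc).
  move=> x; rewrite (_ : x = 0) ?linear0 //.
  by move: x; rewrite /free_mod b0 // => x; exact: rV0_zero.
have lv : linear (fun y : free_mod L p => \row_(j < 1) h y : 'rV[R]_1).
  by move=> a x y; apply/rowP => j; rewrite !mxE linearP.
case: (maxi1 localR).
have e1 : 1 = h (mdiff L p (delta_mx 0 (Ordinal bp))).
  by rewrite -hE mklE mxE !eqxx.
rewrite e1.
have := @lin_max R localR _ _ (mkl lv) _ (fun j => dm p (delta_mx 0 (Ordinal bp)) j) 0.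
by rewrite mklE mxE.
Qed.

Lemma rc_fg (M : lmodType R) : reducible_complexity M -> fg_module M.
Proof. by case. Qed.

(** The sequence [0 -> M -> K -> C -> 0] coresolves to
    [0 -> L -> LB -> LC -> 0], where [LC] is the [n]-th syzygy of [L].  The
    vanishing for [LB], known by induction, reduces [Tor_i(L, N)] to
    [Tor_(i+1)(LC, N)], that is to [Tor_(i+n+1)(L, N)]; in large degrees this
    is a [Tor] of [M]. *)
Lemma rc_cosyz_tor N (M : lmodType R) : reducible_complexity M ->
  (exists n0, forall i, (n0 <= i)%N -> tor_van N i M) ->
  forall J L, cosyz J M L -> ext_van L -> forall i, tor_van N i.+1 L.
Proof.
elim=> {M} [M fM /proj_dim_fpd[n fp]|M n eta fM _ _ _ _ rK IH] [n0 v] J L c xL.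
  have [n' fL] := fpd_cosyz fp c; exact: fpd_ext_van_tor fL xL.
have [C [q [i [p [se cC rC]]]]] := K_exact eta fM.
have fK := rc_fg rK.
have fC : fg_module C by apply: fg_img noethR (free_fg R (betti M n)) (res_aug rC).
have fL := cosyz_fg noethR fM c.
have := cosyz_cat cC c; rewrite addnC => /cosyz_split[LC [cLC cL]].
have fLC := cosyz_fg noethR fC cLC.
have xLC := cosyz_ext_van noethR fLC cL xL.
have [LB [i' [p' [cLB sL]]]] := cosyz_horseshoe noethR fM fC se c cLC xLC.
have fLB := cosyz_fg noethR fK cLB.
have vC k : (n0 <= k)%N -> tor_van N k.+1 C.
  move=> nk; apply/(tor_van_cosyz noethR N k fC cC); apply: v.
  by apply: leq_trans nk _; rewrite -addSn ltnW // ltnS leq_addr.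
have vLB : forall k, tor_van N k.+1 LB.
  apply: (IH _ _ _ cLB (ext_van_mid noethR fL fLB fLC sL xL xLC)).
  exists n0.+1 => -[//|k] nk; apply: (tor_van_mid noethR fM fK fC se); last exact: vC.
  by apply: v; exact: ltnW.
have down k : tor_van N (k + n.+1).+1 L -> tor_van N k.+1 L.
  move=> vL; apply: (tor_van_left noethR fL fLB fLC sL) => //.
  by apply/(tor_van_cosyz noethR N k.+1 fLC cL); rewrite addSnnS.
have high k : (n0 + J <= k)%N -> tor_van N k.+1 L.
  move=> nk; have Jk : (J <= k)%N by apply: leq_trans nk; exact: leq_addl.
  rewrite -(subnK Jk); apply/(tor_van_cosyz noethR N _ fM c); apply: v.
  by rewrite ltnW // ltnS leq_subRL // addnC.
have all m : forall k, tor_van N (k + m * n.+1).+1 L -> tor_van N k.+1 L.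
  elim: m => [|m IHm] k; first by rewrite addn0.
  by rewrite mulSn addnA => /IHm/down.
move=> k; apply: (all (n0 + J)%N); apply: high.
by rewrite mulnS addnCA leq_addr.
Qed.

(** * Tensoring a coresolution *)

Definition cosyz_tor_van N (M : lmodType R) : Prop :=
  forall J L, cosyz J M L -> ext_van L -> forall i, tor_van N i.+1 L.

Lemma cosyz_tor_van_step N (M M' : lmodType R) b (j : {linear M -> 'rV[R]_b})
    (p : {linear 'rV[R]_b -> M'}) :
  short_exact j p -> cosyz_tor_van N M -> cosyz_tor_van N M'.
Proof. by move=> se v J L c; apply: (v J.+1); exists b, M', j, p. Qed.

Section TensorDepth.
Variables (N : lmodType R) (s : nat).
Hypotheses (nN : noeth N) (dN : hasdep [set: N] [set 0] s).

Let nT b : noeth (tensor 'rV[R]_b N). Proof. exact: noeth_tensor_free. Qed.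

Let dT b k : (k <= s)%N -> dge k [set: tensor 'rV[R]_b N] [set 0].
Proof. by move=> ks; apply: tensor_free_dge; apply/(hasdep_dge _ dN). Qed.

Lemma coresolved_tensor_dge k (M : lmodType R) : (k <= s)%N -> coresolved M -> cosyz_tor_van N M ->
  dge k [set: tensor (free_mod M 0) N] (HB N (@mdiff R M) 0).
Proof.
elim: k M => // k IH M ks cM v.
have fM := coresolved_fg cM; have rM := mres_is_res noethR fM.
have [b [M' [j [p [se cM']]]]] := coresolved_step cM.
have fM' := coresolved_fg cM'; have r := embed_res se rM.
have v' := cosyz_tor_van_step se v.
have /(tor_vanP noethR N 1 fM' r) v1 : tor_van N 1 M'.
  exact: (v' 0%N M' erefl (coresolved_ext cM')).
apply: (dge_left noethR localR (@nT _) (@nT _) (pses_syz r v1)); first exact: dT.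
exact (dge_indep (mres_is_res noethR fM') r (IH M' (ltnW ks) cM' v')).
Qed.

(** If the depth were larger, the composite of two consecutive maps of the
    coresolution of [M] would be injective modulo the maximal ideal, hence
    injective; but it vanishes on [M]. *)
Lemma coresolved_tensor_hasdep (M : lmodType R) : coresolved M -> cosyz_tor_van N M ->
  ~ trivial_mod M ->
  hasdep [set: tensor (free_mod M 0) N] (HB N (@mdiff R M) 0) s.
Proof.
move=> cM v M0; split; first exact: coresolved_tensor_dge.
move=> dM; apply: M0 => x.
have fM := coresolved_fg cM; have rM := mres_is_res noethR fM.
have [b [M' [j [p [se cM']]]]] := coresolved_step cM.
have fM' := coresolved_fg cM'; have rM' := embed_res se rM.
have v' := cosyz_tor_van_step se v.
have [b' [M'' [j' [p' [se' cM'']]]]] := coresolved_step cM'.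
have fM'' := coresolved_fg cM''; have rM'' := embed_res se' rM'.
have v'' := cosyz_tor_van_step se' v'.
have /(tor_vanP noethR N 1 fM' rM') v1 : tor_van N 1 M'.
  exact: (v' 0%N M' erefl (coresolved_ext cM')).
have /(tor_vanP noethR N 1 fM'' rM'') v2 : tor_van N 1 M''.
  exact: (v'' 0%N M'' erefl (coresolved_ext cM'')).
have d1 := dge_indep (mres_is_res noethR fM') rM' (coresolved_tensor_dge (leqnn s) cM' v').
have d2 := dge_indep (mres_is_res noethR fM'') rM'' (coresolved_tensor_dge (leqnn s) cM'' v'').
have inj := inj_mod_tensor noethR localR (f := j' \o p) nN (@nT _) (@nT _) (@nT _)
  (pses_syz rM' v1) (pses_syz rM'' v2) (fun t => erefl) dN dM d1 d2.
have [g gf] := split_mod_max noethR localR inj.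
apply: (se_inj se); rewrite -(gf (j x)) -[X in g X]/(j' (p (j x))).
by rewrite (_ : p (j x) = 0) ?linear0 //; apply/(se_mid se); exists x.
Qed.

(** * The depth formula along a reduction *)

(** The module [Tor_0(Omega^(j+1) M, N)] is the kernel of a surjection from a
    power of [N] to [Tor_0(Omega^j M, N)]. *)
Lemma syzygy_tensor_dge k n (M : lmodType R) : fg_module M -> (k <= s)%N ->
  (forall i, tor_van N i.+1 M) ->
  dge k [set: tensor (free_mod M 0) N] (HB N (@mdiff R M) 0) ->
  dge k [set: tensor (free_mod M n) N] (HB N (@mdiff R M) n).
Proof.
case: k => // k fM ks v d0; elim: n => // n IH.
apply: (dge_left noethR localR (@nT _) (@nT _) (pses_syz (mres_is_res noethR fM) (v n))).
  exact: dT.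
exact: dgeS.
Qed.

(** The depth formulas for a nonzero module [M] whose depth is [p] less than
    that of the ring. *)
Definition depth_formulas p (M : lmodType R) : Prop :=
  ((0 < p)%N -> (forall i, tor_van N i.+1 M) -> ~ tor_van N 0 M ->
    exists t, hasdep (HZ N (@mdiff R M) 0) (HB N (@mdiff R M) 0) t /\ (t + p)%N = s) /\
  (forall q t, (0 < q)%N -> (forall i, (q < i)%N -> tor_van N i M) -> ~ tor_van N q M ->
    hasdep (HZ N (@mdiff R M) q) (HB N (@mdiff R M) q) t -> (t <= 1)%N ->
    (t + p)%N = (s + q)%N).

Section Step.
Variables (M K C : lmodType R) (n : nat) (i : {linear M -> K}) (p : {linear K -> C}).
Variable (q : {linear free_mod M n -> C}).
Hypotheses (fM : fg_module M) (fK : fg_module K) (se : short_exact i p).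
Hypothesis rC : @is_res R C (fun i => free_mod M (i + n)) (fun i => mdiff M (i + n)) q.

(** In degree zero the depth of [Tor_0(M, N)] is raised one by one up to that of
    [Tor_0(K, N)]: a depth below [s] is also reached by the third term.  In
    degree [q > 0] the third term embeds in [Tor_(q+n)(M, N)]. *)
Lemma depth_formulas_step e : depth_formulas e K -> depth_formulas e M.
Proof.
have rM := mres_is_res noethR fM; have rK := mres_is_res noethR fK.
have [th [a rB]] := horseshoe se rM rC noethR.
have ddM := res_cplx rM; have ddC := res_cplx rC; have ddB := res_cplx rB.
have nB k : noeth (tensor (prodF (free_mod M) (fun i => free_mod M (i + n)) k) N).
  by apply: noeth_tensor => //; exact: res_fg rB k.
have vK k : tor_van N k.+1 M -> tor_van N (k.+1 + n) M -> tor_van N k.+1 K.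
  by move=> v1 v2; apply/(tor_vanP noethR N _ fK rB); apply: van_mid.
have vM k : tor_van N (k.+1 + n) M -> tor_van N k K -> tor_van N k M.
  move=> v1 /(tor_vanP noethR N _ fK rB) v2.
  have v1' : Hvan N (fun i => mdiff M (i + n)) k.+1 by [].
  by apply: van_left v2.
move=> [H1 H2]; split=> [e0 v v0|k t k0 v vk dt t1].
  have [|K0|t [dt ts]] := H1 e0.
  - by move=> k; apply: vK => //; rewrite addSn; exact: v.
  - by apply: v0; apply: vM => //; rewrite addSn; exact: v.
  have lt : (t < s)%N by rewrite -ts -[X in (X < _)%N]addn0 ltn_add2l.
  have [dB nB1] := hasdep_indep rK rB dt.
  have v1 : Hvan N (fun i => mdiff M (i + n)) 1 by exact: (v n).
  have S := les_ses0 ddM ddC ddB v1.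
  have syz k : (k <= s)%N -> dge k (HZ N (@mdiff R M) 0) (HB N (@mdiff R M) 0) ->
    dge k (HZ N (fun i => mdiff M (i + n)) 0) (HB N (fun i => mdiff M (i + n)) 0).
    by move=> ks; exact: syzygy_tensor_dge.
  exists t; split=> //; split=> [|dS]; last first.
    by apply: nB1; apply: (dge_mid noethR localR (@nT _) (@nT _) S) => //; exact: syz.
  have low k : (k <= t)%N -> dge k (HZ N (@mdiff R M) 0) (HB N (@mdiff R M) 0).
    elim: k => // k IH kt; apply: (dge_left noethR localR (@nB _) (@nT _) S).
      exact: dge_le dB.
    by apply: syz; [exact: leq_trans (ltnW kt) (ltnW lt)|apply: IH; exact: ltnW].
  exact: low.
have v1 : Hvan N (fun i => mdiff M (i + n)) k.+1.
  by apply: (v (k.+1 + n)%N); rewrite addSn ltnS leq_addr.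
have S := les_ses ddM ddB v1.
apply: (H2 k t k0) => //.
- by case=> // l kl; apply: vK; apply: v => //; exact: leq_trans (leq_addr _ _).
- by move=> vk'; apply: vk; apply: vM.
apply: (hasdep_indep rB rK).
have d3 : (0 < t)%N -> dge 1 (HZ N (fun i => mdiff M (i + n)) k) (HB N (fun i => mdiff M (i + n)) k).
  case: k k0 v {vk v1 S} dt => // k _ v dt t0.
  suff : dge 1 (HZ N (@mdiff R M) (k.+1 + n)) (HB N (@mdiff R M) (k.+1 + n)) by [].
  have [n0|n0] := posnP n; first by rewrite n0 addn0; exact: dge_le dt.1.
  have -> : HZ N (@mdiff R M) (k.+1 + n) = HB N (@mdiff R M) (k.+1 + n).
    have [_ _ BZ] := res_pair N (k.+1 + n) rM.
    apply/seteqP; split=> //; apply: v.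
    by rewrite -[X in (X < _)%N]addn0 ltn_add2l.
  exact: dge_zero.
have nTk : noeth (tensor (free_mod M k) N) := @nT _.
case: t dt t1 d3 => [|[|//]] [dM ndM] _ d3.
  by split=> // dK; apply: ndM; exact: (dge_left noethR localR (@nB _) (@nB _) S dK).
have d4 := les_third_dge1 (@mdiff R M) th (d3 isT).
split; first exact: (dge_mid noethR localR nTk (@nB _) S dM d4).
by move=> dK; apply: ndM; exact: (dge_left noethR localR (@nB _) (@nB _) S dK d4).
Qed.

End Step.

Lemma fpd_depth_formulas n r (M : lmodType R) : fpd n M -> ~ trivial_mod M ->
  hasdep [set: R^o] [set 0] r ->
  exists e m, [/\ hasdep [set: M] [set 0] m, (m + e)%N = r & depth_formulas e M].
Proof.
move=> fM M0 dR; have fgM := fpd_fg noethR fM; have [F [d [a [rF F0]]]] := fM.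
have [e mf] := fpd_mfree noethR localR fgM M0 (fpd_betti noethR localR fgM rF F0).
have [m [mr dm]] := auslander_buchsbaum noethR localR mf dR.
exists e, m; split=> //; split=> [e0 v _|q t q0 v v0 dt t1].
  have [|t [ts dt]] := mfree_depth noethR localR nN dN mf; last by exists t.
  by case=> // i _; exact: v.
exact: (mfree_depth_top noethR localR nN dN mf q0 v v0 dt t1).
Qed.

Lemma rc_depth_formulas r (M : lmodType R) : reducible_complexity M -> ~ trivial_mod M ->
  hasdep [set: R^o] [set 0] r ->
  exists e m, [/\ hasdep [set: M] [set 0] m, (m + e)%N = r & depth_formulas e M].
Proof.
move=> rc + dR; elim: rc => {M} [M fM /proj_dim_fpd[n fp] M0|M n eta fM _ _ _ dMK rK IH M0].
  exact: fpd_depth_formulas fp M0 dR.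
have fK := rc_fg rK.
have [m dm] := nontriv_hasdep noethR localR (fg_noeth noethR fM) M0.
have dK : hasdep [set: K_mod eta] [set 0] m.
  apply: (depth_hasdep noethR localR (fg_noeth noethR fK)); rewrite -dMK.
  exact: (hasdep_depth noethR localR (fg_noeth noethR fM) dm).
have [|e [m' [dm' em df]]] := IH.
  by move=> tr; apply: (hasdep_neq localR dK); apply/seteqP; split=> // v _; exact: tr.
have mm := hasdep_inj dm' dK; rewrite mm in em.
have [C [q [i [p [se _ rC]]]]] := K_exact eta fM.
by exists e, m; split=> //; exact: (depth_formulas_step fM fK se rC df).
Qed.

End TensorDepth.
End Reduction.

(** * The depth formula *)

Section Comparison.
Variable R : comNzRingType.
Hypotheses (noethR : noetherian_ring R) (localR : local_ring R).
Variables (M N : lmodType R).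
Hypotheses (fM : fg_module M) (fN : fg_module N).

Let rM := mres_is_res noethR fM.

Lemma HZ_Tor_cycles i : HZ N (@mdiff R M) i = @Tor_cycles R i M N.
Proof. by case: i. Qed.

Lemma Tor_pair i : sqpair (@Tor_cycles R i M N) (@Tor_boundaries R i M N).
Proof. by rewrite -HZ_Tor_cycles; exact: res_pair rM. Qed.

Lemma Tor_trivial i : trivial_mod (Tor i M N) <-> tor_van N i M.
Proof.
rewrite -[tor_van N i M]/(HZ N (@mdiff R M) i `<=` HB N (@mdiff R M) i) HZ_Tor_cycles.
exact: subquot_trivial (Tor_pair i).
Qed.

Lemma depth_Tor i t : hasdep (HZ N (@mdiff R M) i) (HB N (@mdiff R M) i) t <->
  depth (Tor i M N) = ((t%:R : RR)%:E)%E.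
Proof.
rewrite HZ_Tor_cycles; have p := Tor_pair i.
have nT : noeth (tensor (free_mod M i) N) := @noeth_tensor_free R N (betti M i) (fg_noeth noethR fN).
have nS : noeth (Tor i M N) := @noeth_subquot R _ _ _ nT.
have d k := subquot_dge k p.
have h : hasdep (@Tor_cycles R i M N) (@Tor_boundaries R i M N) t <-> hasdep [set: Tor i M N] [set 0] t.
  by rewrite /hasdep; have := d t; have := d t.+1; rewrite -/(Tor i M N); tauto.
apply: (iff_trans h); split; first exact: (hasdep_depth noethR localR nS).
exact: (depth_hasdep noethR localR nS).
Qed.

Lemma depth_tensor t : hasdep (HZ N (@mdiff R M) 0) (HB N (@mdiff R M) 0) t ->
  depth (tensor M N) = ((t%:R : RR)%:E)%E.
Proof.
move=> h; have nN := fg_noeth noethR fN.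
apply: (hasdep_depth noethR localR); first exact: noeth_tensor.
apply/(piso_hasdep t (res_pair N 0 rM) (pair_full _) (f := tmap N (maug M))) => //.
have ex := tmap_exact (res_aug rM) (res_ex0 rM).
split=> // [t' _|y _].
  by split=> [/ex[u ->]|[u _ <-]]; [exists u|apply/ex; exists u].
have [x ->] := tmap_surj (res_aug rM) y.
by exists x; rewrite subrr.
Qed.

Lemma tensor_zero_r b : trivial_mod N -> trivial_mod (tensor 'rV[R]_b N).
Proof. by move=> N0 t; apply: tcoord_inj; apply/funext => i; exact: N0. Qed.

Lemma Tor_supP q : Tor_sup M N = ((q%:R : RR)%:E)%E ->
  ~ tor_van N q M /\ forall i, (q < i)%N -> tor_van N i M.
Proof.
move=> e; have le i : ~ tor_van N i M -> (i <= q)%N.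
  move=> nv; rewrite -(ler_nat RR) -lee_fin -e; apply: ereal_sup_ubound; exists i => //.
  by move/Tor_trivial.
have van i : (q < i)%N -> tor_van N i M.
  by move=> qi; apply: contrapT => /le; rewrite leqNgt qi.
split=> // vq; have : (Tor_sup M N <= ((q%:R - 1 : RR)%:E))%E.
  apply: ge_ereal_sup => _ [i nv <-]; rewrite lee_fin lerBrDr natr1 ler_nat.
  have nv' : ~ tor_van N i M by move/Tor_trivial.
  by rewrite ltn_neqAle le // andbT; apply/eqP => iq; apply: nv'; rewrite iq.
by rewrite e lee_fin lerBrDr gerDl ler10.
Qed.

Lemma Gdim_resolution : (Gdim M < +oo)%E -> exists n, resolution (@Gdim_zero R) M n.
Proof.
move=> gd; apply: contrapT => nr; move: gd.
rewrite /Gdim (_ : [set _ | _ in _] = set0) ?ereal_inf0 ?ltxx //.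
by apply/seteqP; split=> [y [n rn _]|//]; apply: nr; exists n.
Qed.

End Comparison.

Local Open Scope ereal_scope.

Theorem theorem3p2 (R : comNzRingType)
    (noethR : noetherian_ring R) (localR : local_ring R)
    (M N : lmodType R) (fgM : fg_module M) (fgN : fg_module N)
    (Tor_vanish : exists n0 : nat, forall i : nat,
        (n0 <= i)%N -> trivial_mod (Tor i M N))
    (redM : reducible_complexity M) :
  (Gdim M < +oo -> Tor_sup M N = 0 ->
     depth M + depth N = depth (tensor M N) + depth (R^o : lmodType R)) /\
  (forall q : nat, Tor_sup M N = (q%:R)%:E -> (0 < q)%N ->
     depth (Tor q M N) <= 1 ->
     depth M + depth N =
       depth (R^o : lmodType R) + depth (Tor q M N) - (q%:R)%:E).
Proof.
have nM := fg_noeth noethR fgM; have nN := fg_noeth noethR fgN.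
have rM := mres_is_res noethR fgM.
have nR := noeth_ring noethR.
have R0 : ~ trivial_mod (R^o : lmodType R) by move=> /(_ 1%R)/eqP; rewrite oner_eq0.
have [r dR] := nontriv_hasdep noethR localR nR R0.
have main q : Tor_sup M N = ((q%:R : RR)%:E) ->
    exists s e m, [/\ hasdep [set: N] [set 0%R] s, hasdep [set: M] [set 0%R] m,
      (m + e)%N = r & depth_formulas N s e M].
  move=> /(Tor_supP noethR fgM)[nv _].
  have M0 : ~ trivial_mod M by move=> M0; apply: nv; exact: tor_van_trivial.
  have N0 : ~ trivial_mod N.
    move=> N0; apply: nv => t _; exists 0%R => //.
    by rewrite linear0; symmetry; exact: tensor_zero_r.
  have [s dN] := nontriv_hasdep noethR localR nN N0.
  have [e [m [dm em df]]] := rc_depth_formulas noethR localR nN dN redM M0 dR.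
  by exists s, e, m.
split=> [gd e0|q eq q0 dT].
  have [s [e [m [dN dM mr df]]]] := main 0%N e0.
  have [nv v] := Tor_supP (q := 0) noethR fgM e0.
  have v' i : tor_van N i.+1 M by exact: v.
  rewrite (hasdep_depth noethR localR nN dN) (hasdep_depth noethR localR nM dM).
  rewrite (hasdep_depth noethR localR nR dR).
  have [e00|ep] := posnP e; last first.
    have [t [dt ts]] := df.1 ep v' nv.
    rewrite (depth_tensor noethR localR fgM fgN dt) -!EFinD -!natrD -mr -ts.
    by rewrite addnCA [(m + e)%N]addnC.
  have [n rn] := Gdim_resolution gd.
  have cM : coresolved M.
    apply: (Gdim_full_depth noethR localR rn dR).
    by rewrite -mr e00 addn0; exact: dM.1.
  have cv : cosyz_tor_van N M.
    apply: (rc_cosyz_tor noethR localR redM); exists 1%N => -[//|i] _; exact: v'.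
  have M0 : ~ trivial_mod M by move=> M0; apply: nv; exact: tor_van_trivial.
  have dt := coresolved_tensor_hasdep noethR localR nN dN cM cv M0.
  by rewrite (depth_tensor noethR localR fgM fgN dt) -!EFinD -!natrD -mr e00 addn0 addnC.
have [s [e [m [dN dM mr df]]]] := main q eq.
have [nv v] := Tor_supP noethR fgM eq.
have [t dt] : exists t, hasdep (HZ N (@mdiff R M) q) (HB N (@mdiff R M) q) t.
  apply: (hasdep_ex noethR localR).
  - exact: (@noeth_tensor_free R N (betti M q) nN).
  - exact: res_pair rM.
  by move=> BZ; apply: nv => x; rewrite -BZ.
have dTq := (depth_Tor noethR localR fgM fgN q t).1 dt.
have t1 : (t <= 1)%N by move: dT; rewrite dTq lee_fin lern1.
have ts := df.2 q t q0 v nv dt t1.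
rewrite (hasdep_depth noethR localR nN dN) (hasdep_depth noethR localR nM dM).
rewrite (hasdep_depth noethR localR nR dR) dTq -EFinN -!EFinD.
congr (_%:E); apply/eqP; rewrite eq_sym subr_eq -!natrD eqr_nat; apply/eqP.
by rewrite -mr -!addnA -ts [(e + t)%N]addnC.
Qed.
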